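(* Let $u$ be the exact solution of the time-fractional Black-Scholes problem $${}_0^CD_t^\mu u(x,t)=\alpha u_{xx}(x,t)+\beta u_x(x,t)-\gamma u(x,t)+\psi(x,t),\quad (x,t)\in(I_p,F_p)\times(0,\widetilde T),$$ $$u(x,0)=z(x),\qquad u(I_p,t)=\mathscr H(t),\qquad u(F_p,t)=\mathscr G(t).$$ Assume $u\in C^{4,0}$ and $\psi\in C^{2,0}$ on $[I_p,F_p]\times[0,\widetilde T]$, and that the L1 truncation error satisfies $|R_1^{n+1}(x)|\le k_1h_t^{2-\mu}$ for all $x\in[I_p,F_p]$ and $0\le n\le N_t-1$, with a constant $k_1$ independent of $h_t$, $n$ and $x$. Then the exponential B-spline collocation scheme defined in the context is convergent of order $O(h_t^{2-\mu}+h_x^2)$: there exist positive constants $k_2,k_3$, independent of $h_x$, $h_t$ and $n$, such that for all $0\le n\le N_t-1$ $$\|u(\cdot,t_{n+1})-\mathscr U^{n+1}\|_\infty\le k_2h_t^{2-\mu}+k_3h_x^2,$$ where $\|\cdot\|_\infty$ is the supremum norm over $[I_p,F_p]$.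
   Context: Parameters: $0<\mu\le1$, $\sigma>0$, $r_f>0$, $\alpha=\sigma^2/2$, $\beta=r_f-\sigma^2/2$, $\gamma=r_f$; tension parameter $\rho>0$ fixed. The Caputo derivative is ${}_0^CD_t^\mu u(x,t)=\frac1{\Gamma(1-\mu)}\int_0^t(t-s)^{-\mu}\partial_su(x,s)\,ds$ for $0<\mu<1$, and $\partial_tu$ for $\mu=1$. $C^{k,0}$ denotes functions $k$ times continuously differentiable in $x$ and continuous in $t$. Meshes: $h_x=(F_p-I_p)/N_x$, $x_m=I_p+mh_x$ (also for the extra indices $m=-3,-2,-1,N_x+1,N_x+2,N_x+3$); $h_t=\widetilde T/N_t$, $t_n=nh_t$. L1 truncation error: with $w_0=1$ and $w_k=(k+1)^{1-\mu}-k^{1-\mu}$ for $k\ge1$, $$R_1^{n+1}(x)={}_0^CD_t^\mu u(x,t_{n+1})-\frac{h_t^{-\mu}}{\Gamma(2-\mu)}\sum_{k=0}^nw_k\left[u(x,t_{n-k+1})-u(x,t_{n-k})\right].$$ Exponential B-splines: let $\tilde s=\sinh(\rho h_x)$, $\tilde c=\cosh(\rho h_x)$, and $$\tilde r=\frac{\rho}{2(\rho h_x\tilde c-\tilde s)},\quad \tilde a=\frac{\rho h_x\tilde c}{\rho h_x\tilde c-\tilde s},\quad \tilde b=\frac\rho2\,\frac{\tilde c(\tilde c-1)+\tilde s^2}{(\rho h_x\tilde c-\tilde s)(1-\tilde c)},$$ $$\bar c=\frac14\,\frac{e^{-\rho h_x}(1-\tilde c)+\tilde s(e^{-\rho h_x}-1)}{(\rho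 h_x\tilde c-\tilde s)(1-\tilde c)},\quad q=\frac14\,\frac{e^{\rho h_x}(\tilde c-1)+\tilde s(e^{\rho h_x}-1)}{(\rho h_x\tilde c-\tilde s)(1-\tilde c)}.$$ For $m=-1,0,\dots,N_x+1$, $\mathscr Q_m(x)$ equals: $\tilde r(x_{m-2}-x)-\frac{\tilde r}{\rho}\sinh(\rho(x_{m-2}-x))$ on $[x_{m-2},x_{m-1}]$; $\tilde a+\tilde b(x_m-x)+\bar ce^{\rho(x_m-x)}+qe^{-\rho(x_m-x)}$ on $[x_{m-1},x_m]$; $\tilde a+\tilde b(x-x_m)+\bar ce^{\rho(x-x_m)}+qe^{-\rho(x-x_m)}$ on $[x_m,x_{m+1}]$; $\tilde r(x-x_{m+2})-\frac{\tilde r}{\rho}\sinh(\rho(x-x_{m+2}))$ on $[x_{m+1},x_{m+2}]$; and $0$ otherwise. These functions are $C^2$. $\mathscr W_{N_x+3}=\mathrm{span}\{\mathscr Q_m\}_{m=-1}^{N_x+1}$ over $[I_p,F_p]$. Scheme: $\mathscr U^n=\sum_{m=-1}^{N_x+1}\mathscr R_m^n\mathscr Q_m\in\mathscr W_{N_x+3}$, $0\le n\le N_t$, is determined as follows. Initially, $\mathscr U^0(x_m)=z(x_m)$ for $0\le m\le N_x$, $(\mathscr U^0)'(I_p)=z'(I_p)$, $(\mathscr U^0)'(F_p)=z'(F_p)$. For $0\le n\le N_t-1$ and $0\le m\le N_x$, $$\sum_{k=0}^nw_k\left[\mathscr U^{n-k+1}(x_m)-\mathscr U^{n-k}(x_m)\right]=\widetilde\gamma\left[\alpha(\mathscr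 U^{n+1})''(x_m)+\beta(\mathscr U^{n+1})'(x_m)-\gamma\,\mathscr U^{n+1}(x_m)+\psi(x_m,t_{n+1})\right],$$ together with $\mathscr U^{n+1}(I_p)=\mathscr H(t_{n+1})$, $\mathscr U^{n+1}(F_p)=\mathscr G(t_{n+1})$, where $\widetilde\gamma=\Gamma(2-\mu)h_t^\mu$.
   Formalization: The estimate is proved for all meshes with h_x at most a threshold h_0 > 0 depending only on mu, sigma, r_f, rho, I_p, F_p and T (h_t is unrestricted); on some coarse meshes, e.g. N_x = 1, the scheme can be singular and the claim fails. *)

(* Defs.v *)
From Stdlib Require Import Reals ZArith.
From Coquelicot Require Import Coquelicot.

Open Scope R_scope.

Definition GammaR (s : R) : R :=
  RInt_gen (fun t => Rpower t (s - 1) * exp (- t))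
    (at_right 0) (Rbar_locally p_infty).

(* One-sided when [x] is an end point of [a, b]. *)
Definition is_derive_seg (a b : R) (f : R -> R) (x l : R) : Prop :=
  D_in f (fun _ => l) (fun y => a <= y <= b) x.

(* The integral is improper at both ends, since [(t - s)^(-mu)] is singular at
   [s = t] and [f'] may be singular at [s = 0].  For [mu = 1] the derivative at
   the final time [T] is taken from the left. *)
Definition is_caputo (mu T : R) (f : R -> R) (t d : R) : Prop :=
  (mu < 1 /\ (forall s, 0 < s < t -> ex_derive f s) /\
   exists I, is_RInt_gen (fun s => Rpower (t - s) (- mu) * Derive f s)
               (at_right 0) (at_left t) I /\
             d = / GammaR (1 - mu) * I)
  \/ (mu = 1 /\ is_derive_seg 0 T f t d).

Definition rect (a b T : R) (p : R * R) : Prop :=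
  a <= fst p <= b /\ 0 <= snd p <= T.

(* [D i] is the [i]-th partial derivative in the first variable; all of them
   are jointly continuous on the closed rectangle. *)
Definition class_C0 (k : nat) (a b T : R) (f : R -> R -> R) : Prop :=
  exists D : nat -> R -> R -> R,
    (forall x t, rect a b T (x, t) -> D 0%nat x t = f x t) /\
    (forall i x t, (i < k)%nat -> rect a b T (x, t) ->
       is_derive_seg a b (fun y => D i y t) x (D (S i) x t)) /\
    (forall i, (i <= k)%nat ->
       continuous_on (rect a b T) (fun p : R * R => D i (fst p) (snd p))).

Definition sup_norm (a b : R) (f : R -> R) : Rbar :=
  Lub_Rbar (fun y => exists x, a <= x <= b /\ y = Rabs (f x)).

Definition bs_alpha (sigma : R) : R := sigma ^ 2 / 2.
Definition bs_beta (sigma rf : R) : R := rf - sigma ^ 2 / 2.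
Definition bs_gamma (rf : R) : R := rf.

Definition is_bs_solution (mu sigma rf Ip Fp T : R) (psi : R -> R -> R)
    (z H G : R -> R) (u : R -> R -> R) : Prop :=
  (forall x t, Ip < x < Fp -> 0 < t < T ->
     is_caputo mu T (u x) t
       (bs_alpha sigma * Derive_n (fun y => u y t) 2 x
        + bs_beta sigma rf * Derive (fun y => u y t) x
        - bs_gamma rf * u x t + psi x t)) /\
  (forall x, Ip <= x <= Fp -> u x 0 = z x) /\
  (forall t, 0 < t <= T -> u Ip t = H t /\ u Fp t = G t).

Definition step_x (Ip Fp : R) (Nx : nat) : R := (Fp - Ip) / INR Nx.
Definition node_x (Ip Fp : R) (Nx : nat) (m : Z) : R :=
  Ip + IZR m * step_x Ip Fp Nx.
Definition step_t (T : R) (Nt : nat) : R := T / INR Nt.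
Definition node_t (T : R) (Nt n : nat) : R := INR n * step_t T Nt.

(* [Rpower 0 y = 1] in the library, hence the separate case [k = 0]. *)
Definition l1_weight (mu : R) (k : nat) : R :=
  match k with
  | 0%nat => 1
  | S _ => Rpower (INR k + 1) (1 - mu) - Rpower (INR k) (1 - mu)
  end.

(* [v k] is the value at time [t_k]. *)
Definition l1_sum (mu : R) (v : nat -> R) (n : nat) : R :=
  sum_f_R0 (fun k => l1_weight mu k * (v (n - k + 1)%nat - v (n - k)%nat)) n.

Definition is_l1_error (mu T : R) (Nt : nat) (f : R -> R) (n : nat) (r : R)
    : Prop :=
  exists d, is_caputo mu T f (node_t T Nt (n + 1)) d /\
    r = d - Rpower (step_t T Nt) (- mu) / GammaR (2 - mu)
            * l1_sum mu (fun k => f (node_t T Nt k)) n.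

Section ExponentialBSpline.
Context (rho h : R).
Let s := sinh (rho * h).
Let c := cosh (rho * h).

Definition eb_r : R := rho / (2 * (rho * h * c - s)).
Definition eb_a : R := rho * h * c / (rho * h * c - s).
Definition eb_b : R :=
  rho / 2 * ((c * (c - 1) + s ^ 2) / ((rho * h * c - s) * (1 - c))).
Definition eb_c : R :=
  1 / 4 * ((exp (- (rho * h)) * (1 - c) + s * (exp (- (rho * h)) - 1))
           / ((rho * h * c - s) * (1 - c))).
Definition eb_q : R :=
  1 / 4 * ((exp (rho * h) * (c - 1) + s * (exp (rho * h) - 1))
           / ((rho * h * c - s) * (1 - c))).
End ExponentialBSpline.

Definition bspline (rho Ip Fp : R) (Nx : nat) (m : Z) (x : R) : R :=
  let h := step_x Ip Fp Nx in
  let X := node_x Ip Fp Nx in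
  let r := eb_r rho h in
  let a := eb_a rho h in
  let b := eb_b rho h in
  let c := eb_c rho h in
  let q := eb_q rho h in
  if Rlt_dec x (X (m - 2)%Z) then 0
  else if Rle_dec x (X (m - 1)%Z) then
    r * (X (m - 2)%Z - x) - r / rho * sinh (rho * (X (m - 2)%Z - x))
  else if Rle_dec x (X m) then
    a + b * (X m - x) + c * exp (rho * (X m - x)) + q * exp (- rho * (X m - x))
  else if Rle_dec x (X (m + 1)%Z) then
    a + b * (x - X m) + c * exp (rho * (x - X m)) + q * exp (- rho * (x - X m))
  else if Rle_dec x (X (m + 2)%Z) then
    r * (x - X (m + 2)%Z) - r / rho * sinh (rho * (x - X (m + 2)%Z))
  else 0.

(* [sum_f_R0 _ (Nx + 2)] has [Nx + 3] terms; the summation index [j] stands for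
   [m = j - 1], so that [m] runs over [-1, ..., Nx + 1]. *)
Definition spline (rho Ip Fp : R) (Nx : nat) (coef : Z -> R) (x : R) : R :=
  sum_f_R0 (fun j => let m := (Z.of_nat j - 1)%Z in
                     coef m * bspline rho Ip Fp Nx m x) (Nx + 2).

(* [coef n m] is the coefficient of the [m]-th B-spline at time level [n]. *)
Definition is_collocation_solution (mu sigma rf rho Ip Fp T : R)
    (psi : R -> R -> R) (z H G : R -> R) (Nx Nt : nat) (coef : nat -> Z -> R)
    : Prop :=
  let U n := spline rho Ip Fp Nx (coef n) in
  let X (m : nat) := node_x Ip Fp Nx (Z.of_nat m) in
  let tau := node_t T Nt in
  let gt := GammaR (2 - mu) * Rpower (step_t T Nt) mu in
  (forall m, (m <= Nx)%nat -> U 0%nat (X m) = z (X m)) /\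
  is_derive_seg Ip Fp z Ip (Derive (U 0%nat) Ip) /\
  is_derive_seg Ip Fp z Fp (Derive (U 0%nat) Fp) /\
  (forall n m, (n < Nt)%nat -> (m <= Nx)%nat ->
     l1_sum mu (fun k => U k (X m)) n
     = gt * (bs_alpha sigma * Derive_n (U (n + 1)%nat) 2 (X m)
             + bs_beta sigma rf * Derive (U (n + 1)%nat) (X m)
             - bs_gamma rf * U (n + 1)%nat (X m)
             + psi (X m) (tau (n + 1)%nat))) /\
  (forall n, (n < Nt)%nat ->
     U (n + 1)%nat Ip = H (tau (n + 1)%nat) /\
     U (n + 1)%nat Fp = G (tau (n + 1)%nat)).

(* Main.v *)
Require Import Defs.
From Stdlib Require Import Reals ZArith Lra Lia Psatz Classical ClassicalEpsilon List.
From Coquelicot Require Import Coquelicot.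
Open Scope R_scope.

(** Why the scheme converges.

    On a mesh interval a spline of the scheme lies in the span of
    1, x, e^(rho x), e^(-rho x), so it is determined there by the values and the
    second derivatives at the two ends, and so are its slopes at these ends
    ([tension_spline_slopes]).  Matching the slopes of neighbouring intervals at
    a node gives two relations between nodal values ([tension_spline_avg]):
    with y = rho h, P v = (1 - 2 lam) v_i + lam (v_(i-1) + v_(i+1)) and d2 the
    second difference,
      P U'' = theta d2 U / h^2,   P U' = (U_(i+1) - U_(i-1)) / (2 h).
    Applying P to the collocation equations therefore turns the scheme into a
    three-point scheme for the nodal values alone.  The exact solution satisfies
    this scheme with a residual O(h_t^(2 - mu) + h^2), by Taylor expansion and
    by theta = 1 + O(h^2).

    The error e of this three-point scheme vanishes at time 0 and at both ends
    of the interval.  The mass operator P destroys the discrete maximum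
    principle when h_t^mu is small compared with h^2, so stability in the
    maximum norm is obtained from an energy.  The equation is tested with
    K e - d2 e / h^2.  This makes the time part a symmetric positive form in e
    that controls the differences of e, and for K large the diffusion absorbs
    the convection ([energy_dissipation]).  The weights of the L1 formula
    decrease, so the new value of the energy is compared with a convex
    combination of the old ones.  The reaction term gamma e damps the energy,
    so an induction on time bounds it uniformly, without a Gronwall factor
    ([scheme_energy_bound]).  A discrete Sobolev inequality then gives the
    maximum norm ([scheme_max_bound]).

    Between the nodes, the error is at most the nodal error plus
    h^2 sup |u'' - U''|, so it is enough that h^2 U'' is O(h^2 + max |e|).  The
    second derivatives at the nodes solve a tridiagonal system, whose interior
    rows are the relation for P U'' and whose end rows are the collocation
    equations at the end points.  It is diagonally dominant as soon as
    |beta| h <= alpha, which is the only condition on the mesh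
    ([spline_curvature_bound], [spline_sup_error]).

    The differential equation is given in the open rectangle only, while the
    scheme uses it at the end points of the interval and at the final time.  At
    the end points it is recovered for the truncation residual by continuity
    in x ([l1_residual_bound]).  At the final time one has to show that the
    Caputo derivative, which exists, is the limit of the right-hand side
    ([caputo_final_fractional]): convergence of the improper integral forces
    f(T) - f(T - s) = o(s^mu) ([fractional_little_o]), and Abel summation turns
    this into the fact that the L1 quotients at the last two time levels have
    the same limit. *)

(** * Hyperbolic functions *)

Lemma mvt_interval (f df : R -> R) a b : a < b ->
  (forall x, a <= x <= b -> is_derive f x (df x)) ->
  exists c, a <= c <= b /\ f b - f a = df c * (b - a).
Proof.
  intros Hab Hd. destruct (MVT_gen f a b df) as [c [Hc E]].
  - intros t [Ht Ht']. apply Hd. rewrite Rmin_left in Ht by lra.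
    rewrite Rmax_right in Ht' by lra. lra.
  - intros t [Ht Ht']. apply continuity_pt_filterlim.
    apply (ex_derive_continuous f). exists (df t). apply Hd.
    rewrite Rmin_left in Ht by lra. rewrite Rmax_right in Ht' by lra. lra.
  - rewrite Rmin_left, Rmax_right in Hc by lra. eauto.
Qed.

Lemma nonneg_of_derive (f df : R -> R) (x : R) :
  (forall t, 0 <= t -> is_derive f t (df t)) ->
  (forall t, 0 <= t -> 0 <= df t) -> 0 <= f 0 -> 0 <= x -> 0 <= f x.
Proof.
  intros Hd Hpos H0 Hx.
  destruct (Req_dec x 0) as [->|Hx0]; [exact H0|].
  destruct (mvt_interval f df 0 x) as [c [Hc E]]; [lra|intros; apply Hd; lra|].
  assert (0 <= df c) by (apply Hpos; lra). nra.
Qed.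

Lemma is_derive_sinh x : is_derive sinh x (cosh x).
Proof. unfold sinh, cosh. auto_derive; [exact I|]. field. Qed.

(** From here to [mul_sinh_le] each function vanishes at 0 and has a derivative
    that is nonnegative by the earlier lemmas. *)
Lemma sinh_nonneg y : 0 <= y -> 0 <= sinh y.
Proof.
  intros Hy. apply (nonneg_of_derive sinh cosh); auto.
  - intros; apply is_derive_sinh.
  - intros t _. unfold cosh. pose proof (exp_pos t). pose proof (exp_pos (-t)). lra.
  - rewrite sinh_0; lra.
Qed.

Lemma cosh_ge_1 y : 0 <= y -> 0 <= cosh y - 1.
Proof.
  intros Hy. apply (nonneg_of_derive (fun t => cosh t - 1) sinh); auto.
  - intros; unfold cosh, sinh; auto_derive; [exact I|]; field.
  - intros; now apply sinh_nonneg.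
  - rewrite cosh_0; lra.
Qed.

Lemma sinh_ge_id y : 0 <= y -> 0 <= sinh y - y.
Proof.
  intros Hy. apply (nonneg_of_derive (fun t => sinh t - t) (fun t => cosh t - 1)); auto.
  - intros; unfold cosh, sinh; auto_derive; [exact I|]; field.
  - apply cosh_ge_1.
  - rewrite sinh_0; lra.
Qed.

Lemma cosh_ge_quadratic y : 0 <= y -> 0 <= cosh y - 1 - y ^ 2 / 2.
Proof.
  intros Hy.
  apply (nonneg_of_derive (fun t => cosh t - 1 - t ^ 2 / 2) (fun t => sinh t - t)); auto.
  - intros; unfold cosh, sinh; auto_derive; [exact I|]; field.
  - apply sinh_ge_id.
  - rewrite cosh_0; lra.
Qed.

Lemma sinh_le_mul_cosh y : 0 <= y -> 0 <= y * cosh y - sinh y.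
Proof.
  intros Hy.
  apply (nonneg_of_derive (fun t => t * cosh t - sinh t) (fun t => t * sinh t)); auto.
  - intros; unfold cosh, sinh; auto_derive; [exact I|]; field.
  - intros t Ht. pose proof (sinh_nonneg t Ht). nra.
  - rewrite sinh_0; lra.
Qed.

Lemma two_cosh_le_mul_sinh y : 0 <= y -> 0 <= y * sinh y - 2 * (cosh y - 1).
Proof.
  intros Hy.
  apply (nonneg_of_derive (fun t => t * sinh t - 2 * (cosh t - 1))
                          (fun t => t * cosh t - sinh t)); auto.
  - intros; unfold cosh, sinh; auto_derive; [exact I|]; field.
  - apply sinh_le_mul_cosh.
  - rewrite sinh_0, cosh_0; lra.
Qed.

Lemma three_sinh_le y : 0 <= y -> 0 <= y * (cosh y - 1) - 3 * (sinh y - y).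
Proof.
  intros Hy.
  apply (nonneg_of_derive (fun t => t * (cosh t - 1) - 3 * (sinh t - t))
                          (fun t => t * sinh t - 2 * (cosh t - 1))); auto.
  - intros; unfold cosh, sinh; auto_derive; [exact I|]; field.
  - apply two_cosh_le_mul_sinh.
  - rewrite sinh_0, cosh_0; lra.
Qed.

Lemma mul_sinh_le y : 0 <= y ->
  0 <= (2 + 2 * y ^ 2) * (cosh y - 1) - y * sinh y.
Proof.
  intros Hy.
  apply (nonneg_of_derive
    (fun t => (2 + 2 * t ^ 2) * (cosh t - 1) - t * sinh t)
    (fun t => 3 * t * (cosh t - 1) + 2 * t ^ 2 * sinh t + (sinh t - t)));
    auto.
  - intros; unfold cosh, sinh; auto_derive; [exact I|]; field.
  - intros t Ht. pose proof (sinh_nonneg t Ht). pose proof (cosh_ge_1 t Ht).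
    pose proof (sinh_ge_id t Ht). nra.
  - rewrite sinh_0, cosh_0; lra.
Qed.

Lemma sinh_gt y : 0 < y -> 0 < sinh y.
Proof. intros. rewrite <- sinh_0. now apply sinh_lt. Qed.

Lemma cosh_gt_1 y : 0 < y -> 0 < cosh y - 1.
Proof. intros Hy. pose proof (cosh_ge_quadratic y ltac:(lra)). nra. Qed.

Lemma sinh_lt_mul_cosh y : 0 < y -> 0 < y * cosh y - sinh y.
Proof.
  intros Hy. pose proof (three_sinh_le y ltac:(lra)).
  assert (0 <= sinh y - y - y ^ 3 / 6).
  { apply (nonneg_of_derive (fun t => sinh t - t - t ^ 3 / 6)
             (fun t => cosh t - 1 - t ^ 2 / 2)); try lra.
    - intros; unfold cosh, sinh; auto_derive; [exact I|]; field.
    - apply cosh_ge_quadratic.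
    - rewrite sinh_0; lra. }
  assert (0 < y ^ 3) by (apply pow_lt; lra). nra.
Qed.

(** The coefficients of the two nodal relations of a tension spline, for
    y = rho h.  Their limits at y = 0, namely 1/6 and 1, are the coefficients for
    cubic splines. *)
Definition lam (y : R) : R := (sinh y - y) / (2 * y * (cosh y - 1)).
Definition theta (y : R) : R := y * sinh y / (2 * (cosh y - 1)).

(** The bound 1/6 keeps the mean with weights lam, 1 - 2 lam, lam positive
    definite with margin 1 - 4 lam >= 1/3, uniformly in the mesh. *)
Lemma lam_bounds y : 0 < y -> 0 <= lam y <= 1 / 6.
Proof.
  intros Hy. pose proof (cosh_gt_1 y Hy). pose proof (sinh_ge_id y ltac:(lra)).
  pose proof (three_sinh_le y ltac:(lra)). unfold lam.
  assert (0 < 2 * y * (cosh y - 1)) by nra.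
  split; [apply Rdiv_le_0_compat; lra|apply Rle_div_l; lra].
Qed.

(** The upper bound makes the second difference scaled by theta consistent of
    order 2; the lower bound is used for coercivity. *)
Lemma theta_bounds y : 0 < y -> 1 <= theta y <= 1 + y ^ 2.
Proof.
  intros Hy. pose proof (cosh_gt_1 y Hy).
  pose proof (two_cosh_le_mul_sinh y ltac:(lra)).
  pose proof (mul_sinh_le y ltac:(lra)). unfold theta.
  split; [apply Rle_div_r; lra|apply Rle_div_l; lra].
Qed.

(** * Exponential B-splines *)

Definition pos_part_of (g : R -> R) (y : R) : R := if Rle_dec y 0 then 0 else g y.

(** At 0 the difference quotients of the truncated function are 0 or those of
    g, and both tend to 0. *)
Lemma is_derive_pos_part (g dg : R -> R) x :
  (forall y, is_derive g y (dg y)) -> g 0 = 0 -> dg 0 = 0 ->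
  is_derive (pos_part_of g) x (pos_part_of dg x).
Proof.
  intros Hd H0 H1.
  destruct (Rtotal_order x 0) as [Hx|[->|Hx]].
  - apply (is_derive_ext_loc (fun _ => 0)).
    + exists (mkposreal (- x) ltac:(lra)). intros y Hy.
      change (Rabs (y - x) < - x) in Hy. apply Rabs_def2 in Hy.
      unfold pos_part_of. destruct (Rle_dec y 0); lra.
    + unfold pos_part_of. destruct (Rle_dec x 0); [|lra].
      auto_derive; auto.
  - unfold pos_part_of at 2. destruct (Rle_dec 0 0); [|lra].
    apply is_derive_Reals. intros eps Heps.
    pose proof (proj1 (is_derive_Reals _ _ _) (Hd 0)) as D.
    destruct (D eps Heps) as [del Hdel]. exists del. intros h Hh Hlt.
    specialize (Hdel h Hh Hlt). rewrite H0, H1 in Hdel.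
    unfold pos_part_of. destruct (Rle_dec 0 0); [|lra].
    destruct (Rle_dec (0 + h) 0); [|exact Hdel].
    replace ((0 - 0) / h - 0) with 0 by (field; exact Hh).
    rewrite Rabs_R0; exact Heps.
  - apply (is_derive_ext_loc g).
    + exists (mkposreal x Hx). intros y Hy.
      change (Rabs (y - x) < x) in Hy. apply Rabs_def2 in Hy.
      unfold pos_part_of. destruct (Rle_dec y 0); lra.
    + unfold pos_part_of. destruct (Rle_dec x 0); [lra|]. apply Hd.
Qed.

(** The tension analogue of the truncated cubic power x_+^3, followed by its
    first two derivatives. *)
Definition tpow (rho : R) : R -> R :=
  pos_part_of (fun y => sinh (rho * y) - rho * y).
Definition tpow1 (rho : R) : R -> R :=
  pos_part_of (fun y => rho * (cosh (rho * y) - 1)).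
Definition tpow2 (rho : R) : R -> R :=
  pos_part_of (fun y => rho ^ 2 * sinh (rho * y)).

Lemma is_derive_tpow rho x : is_derive (tpow rho) x (tpow1 rho x).
Proof.
  apply (is_derive_pos_part _ (fun y => rho * (cosh (rho * y) - 1))).
  - intros; unfold sinh, cosh; auto_derive; [exact I|]; field.
  - rewrite Rmult_0_r, sinh_0; ring.
  - rewrite Rmult_0_r, cosh_0; ring.
Qed.

Lemma is_derive_tpow1 rho x : is_derive (tpow1 rho) x (tpow2 rho x).
Proof.
  apply (is_derive_pos_part _ (fun y => rho ^ 2 * sinh (rho * y))).
  - intros; unfold sinh, cosh; auto_derive; [exact I|]; field.
  - rewrite Rmult_0_r, cosh_0; ring.
  - rewrite Rmult_0_r, sinh_0; ring.
Qed.

(** The coefficients 1, -(2 c + 2), 4 c + 2, -(2 c + 2), 1 are those of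
    (E - 1)^2 (E^2 - 2 c E + 1), where E is the shift by h: this operator
    annihilates 1, x and e^(rho x), e^(-rho x), so the combination vanishes again
    to the right of the last knot.  The piecewise formula thus describes a
    function that is visibly C^2. *)
Lemma bspline_tpow rho Ip Fp Nx m x :
  0 < rho -> 0 < step_x Ip Fp Nx ->
  let h := step_x Ip Fp Nx in
  let X := node_x Ip Fp Nx in
  let c := cosh (rho * h) in
  bspline rho Ip Fp Nx m x =
  eb_r rho h / rho *
    (tpow rho (x - X (m - 2)%Z) - (2 * c + 2) * tpow rho (x - X (m - 1)%Z)
     + (4 * c + 2) * tpow rho (x - X m) - (2 * c + 2) * tpow rho (x - X (m + 1)%Z)
     + tpow rho (x - X (m + 2)%Z)).
Proof.
  intros Hr Hh h X c. unfold bspline. fold h X.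
  assert (Em2 : X (m - 2)%Z = X m - 2 * h)
    by (unfold X, node_x; fold h; rewrite minus_IZR; ring).
  assert (Em1 : X (m - 1)%Z = X m - h)
    by (unfold X, node_x; fold h; rewrite minus_IZR; ring).
  assert (Ep1 : X (m + 1)%Z = X m + h)
    by (unfold X, node_x; fold h; rewrite plus_IZR; ring).
  assert (Ep2 : X (m + 2)%Z = X m + 2 * h)
    by (unfold X, node_x; fold h; rewrite plus_IZR; ring).
  rewrite Em2, Em1, Ep1, Ep2. clear Em2 Em1 Ep1 Ep2.
  set (xm := X m). clearbody xm. clear X.
  fold h in Hh. clearbody h. clear Ip Fp Nx m.
  assert (Hy : 0 < rho * h) by nra.
  pose proof (sinh_lt_mul_cosh _ Hy) as D1. pose proof (cosh_gt_1 _ Hy) as D2.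
  unfold eb_r, eb_a, eb_b, eb_c, eb_q, tpow, pos_part_of, c.
  set (y := x - xm).
  replace (xm - 2 * h - x) with (- (y + 2 * h)) by (unfold y; ring).
  replace (x - (xm - 2 * h)) with (y + 2 * h) by (unfold y; ring).
  replace (x - (xm - h)) with (y + h) by (unfold y; ring).
  replace (x - (xm + h)) with (y - h) by (unfold y; ring).
  replace (x - (xm + 2 * h)) with (y - 2 * h) by (unfold y; ring).
  replace (xm - x) with (- y) by (unfold y; ring).
  assert (Hxy : x = xm + y) by (unfold y; ring). clearbody y. subst x.
  assert (D1' : rho * h * cosh (rho * h) - sinh (rho * h) <> 0) by lra.
  assert (D2' : 1 - cosh (rho * h) <> 0) by lra.
  revert D1' D2'. clear D1 D2.
  unfold cosh, sinh.
  replace (rho * - (y + 2 * h)) with (- (rho * y + rho * h + rho * h)) by ring.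
  replace (rho * (y + 2 * h)) with (rho * y + rho * h + rho * h) by ring.
  replace (rho * (y + h)) with (rho * y + rho * h) by ring.
  replace (rho * (y - h)) with (rho * y + - (rho * h)) by ring.
  replace (rho * (y - 2 * h)) with (rho * y + - (rho * h) + - (rho * h)) by ring.
  replace (rho * - y) with (- (rho * y)) by ring.
  replace (- rho * - y) with (rho * y) by ring.
  replace (- rho * y) with (- (rho * y)) by ring.
  repeat rewrite ?exp_Ropp, ?exp_plus.
  pose proof (exp_pos (rho * h)) as HE. pose proof (exp_pos (rho * y)) as HY.
  set (E := exp (rho * h)) in *. set (Y := exp (rho * y)) in *.
  intros D1 D2.
  assert (D2n : - E * E - 1 + 2 * E <> 0).
  { intro Q. apply D2. apply (Rmult_eq_reg_l (2 * E)); [|lra].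
    rewrite Rmult_0_r, <- Q. field. lra. }
  assert (D1n : rho * h * (E * E + 1) - (E * E - 1) <> 0).
  { intro Q. apply D1. apply (Rmult_eq_reg_l (2 * E)); [|lra].
    rewrite Rmult_0_r, <- Q. field. lra. }
  destruct (Rlt_dec (xm + y) (xm - 2 * h)).
  { destruct (Rle_dec (y + 2 * h) 0), (Rle_dec (y + h) 0), (Rle_dec y 0),
      (Rle_dec (y - h) 0), (Rle_dec (y - 2 * h) 0); try lra. }
  destruct (Rle_dec (xm + y) (xm - h)).
  { destruct (Rle_dec (y + h) 0), (Rle_dec y 0),
      (Rle_dec (y - h) 0), (Rle_dec (y - 2 * h) 0); try lra.
    destruct (Rle_dec (y + 2 * h) 0).
    (* the left end of the support, where the truncated power is cut off *)
    - assert (y = - (2 * h)) by lra.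
      assert (HYE : Y = / (E * E)).
      { unfold Y, E. subst y. rewrite <- exp_plus, <- exp_Ropp. f_equal; ring. }
      rewrite HYE. subst y. field. split; [|lra].
      repeat split; try lra; auto.
    - field. repeat split; try lra; auto. }
  destruct (Rle_dec (xm + y) xm).
  { destruct (Rle_dec (y + h) 0), (Rle_dec y 0), (Rle_dec (y + 2 * h) 0),
      (Rle_dec (y - h) 0), (Rle_dec (y - 2 * h) 0); try lra.
    field. repeat split; try lra; auto. }
  destruct (Rle_dec (xm + y) (xm + h)).
  { destruct (Rle_dec (y + h) 0), (Rle_dec y 0), (Rle_dec (y + 2 * h) 0),
      (Rle_dec (y - h) 0), (Rle_dec (y - 2 * h) 0); try lra.
    field. repeat split; try lra; auto. }
  destruct (Rle_dec (xm + y) (xm + 2 * h)).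
  { destruct (Rle_dec (y + h) 0), (Rle_dec y 0), (Rle_dec (y + 2 * h) 0),
      (Rle_dec (y - h) 0), (Rle_dec (y - 2 * h) 0); try lra.
    field. repeat split; try lra; auto. }
  { destruct (Rle_dec (y + h) 0), (Rle_dec y 0), (Rle_dec (y + 2 * h) 0),
      (Rle_dec (y - h) 0), (Rle_dec (y - 2 * h) 0); try lra.
    field. repeat split; try lra; auto. }
Qed.

(** The first two derivatives are parameters, so that closure under linear
    combinations needs no differentiation.  Twofold differentiability is
    required on the whole line because the scheme uses two-sided derivatives at
    the end points. *)
Definition tension_spline (rho a h : R) (N : nat) (U U1 U2 : R -> R) : Prop :=
  (forall x, is_derive U x (U1 x)) /\ (forall x, is_derive U1 x (U2 x)) /\
  forall i, (i < N)%nat -> exists A B C D, forall x,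
    a + INR i * h <= x <= a + INR (S i) * h ->
    U x = A + B * x + C * exp (rho * x) + D * exp (- (rho * x)) /\
    U1 x = B + rho * (C * exp (rho * x) - D * exp (- (rho * x))) /\
    U2 x = rho ^ 2 * (C * exp (rho * x) + D * exp (- (rho * x))).

Lemma tension_spline_zero rho a h N :
  tension_spline rho a h N (fun _ => 0) (fun _ => 0) (fun _ => 0).
Proof.
  split; [|split]; try (intros; auto_derive; auto; fail).
  intros i _. exists 0, 0, 0, 0. intros. repeat split; ring.
Qed.

Lemma tension_spline_lin rho a h N k U U1 U2 V V1 V2 :
  tension_spline rho a h N U U1 U2 -> tension_spline rho a h N V V1 V2 ->
  tension_spline rho a h N (fun x => U x + k * V x) (fun x => U1 x + k * V1 x)
    (fun x => U2 x + k * V2 x).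
Proof.
  intros [HU [HU1 HU2]] [HV [HV1 HV2]]. split; [|split].
  - intros x. apply @is_derive_plus; [apply HU|]. apply is_derive_scal, HV.
  - intros x. apply @is_derive_plus; [apply HU1|]. apply is_derive_scal, HV1.
  - intros i Hi. destruct (HU2 i Hi) as (A & B & C & D & H).
    destruct (HV2 i Hi) as (A' & B' & C' & D' & H').
    exists (A + k * A'), (B + k * B'), (C + k * C'), (D + k * D').
    intros x Hx. destruct (H x Hx) as (-> & -> & ->).
    destruct (H' x Hx) as (-> & -> & ->). repeat split; ring.
Qed.

Lemma tension_spline_tpow rho a h N (j : Z) : 0 < h ->
  let b := a + IZR j * h in
  tension_spline rho a h N (fun x => tpow rho (x - b)) (fun x => tpow1 rho (x - b))
    (fun x => tpow2 rho (x - b)).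
Proof.
  intros Hh b. split; [|split].
  - intros x. evar_last.
    + apply (is_derive_comp (tpow rho) (fun x => x - b)).
      apply is_derive_tpow. auto_derive; auto.
    + rewrite Rmult_1_l. reflexivity.
  - intros x. evar_last.
    + apply (is_derive_comp (tpow1 rho) (fun x => x - b)).
      apply is_derive_tpow1. auto_derive; auto.
    + rewrite Rmult_1_l. reflexivity.
  - intros i _. unfold tpow, tpow1, tpow2, pos_part_of.
    destruct (Z_lt_le_dec (Z.of_nat i) j) as [Hj|Hj].
    + exists 0, 0, 0, 0. intros x Hx.
      assert (IZR (Z.of_nat (S i)) <= IZR j) by (apply IZR_le; lia).
      rewrite <- INR_IZR_INZ in H.
      destruct (Rle_dec (x - b) 0); [repeat split; ring|].
      unfold b in *; nra.
    + exists (rho * b), (- rho), (exp (- (rho * b)) / 2), (- exp (rho * b) / 2).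
      intros x Hx.
      assert (IZR j <= IZR (Z.of_nat i)) by (apply IZR_le; lia).
      rewrite <- INR_IZR_INZ in H.
      assert (Hs : 0 <= x - b) by (unfold b; nra).
      assert (E1 : exp (rho * (x - b)) = exp (- (rho * b)) * exp (rho * x))
        by (rewrite <- exp_plus; f_equal; ring).
      assert (E2 : exp (- (rho * (x - b))) = exp (rho * b) * exp (- (rho * x)))
        by (rewrite <- exp_plus; f_equal; ring).
      destruct (Rle_dec (x - b) 0) as [H0|_].
      * assert (x = b) by lra. subst x.
        assert (E3 : exp (rho * b) * exp (- (rho * b)) = 1)
          by (rewrite <- exp_plus; replace (_ + _) with 0 by ring; apply exp_0).
        split; [field|split; [|field]].
        transitivity (rho * (exp (rho * b) * exp (- (rho * b)) - 1)).
        { rewrite E3; ring. } { field. }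
      * unfold sinh, cosh. rewrite E1, E2. repeat split; field.
Qed.

Lemma tension_spline_ext rho a h N U U' U1 U2 :
  (forall x, U x = U' x) ->
  tension_spline rho a h N U U1 U2 -> tension_spline rho a h N U' U1 U2.
Proof.
  intros E [H [H1 H2]]. split; [|split]; auto.
  - intros x. apply (is_derive_ext U); auto.
  - intros i Hi. destruct (H2 i Hi) as (A & B & C & D & H').
    exists A, B, C, D. intros x Hx. rewrite <- E. auto.
Qed.

Lemma tension_spline_bspline rho Ip Fp Nx N m :
  0 < rho -> 0 < step_x Ip Fp Nx ->
  exists Q1 Q2,
    tension_spline rho Ip (step_x Ip Fp Nx) N (bspline rho Ip Fp Nx m) Q1 Q2.
Proof.
  intros Hr Hh.
  set (h := step_x Ip Fp Nx) in *. set (c := cosh (rho * h)).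
  set (k := eb_r rho h / rho).
  do 2 eexists.
  eapply tension_spline_ext.
  2:{ apply tension_spline_lin with (k := k) (V := fun x => tpow rho (x - node_x Ip Fp Nx (m + 2)%Z)).
      apply tension_spline_lin with (k := - k * (2 * c + 2)) (V := fun x => tpow rho (x - node_x Ip Fp Nx (m + 1)%Z)).
      apply tension_spline_lin with (k := k * (4 * c + 2)) (V := fun x => tpow rho (x - node_x Ip Fp Nx m)).
      apply tension_spline_lin with (k := - k * (2 * c + 2)) (V := fun x => tpow rho (x - node_x Ip Fp Nx (m - 1)%Z)).
      apply tension_spline_lin with (k := k) (V := fun x => tpow rho (x - node_x Ip Fp Nx (m - 2)%Z)).
      apply tension_spline_zero.
      all: apply tension_spline_tpow; exact Hh. }
  intros x. cbv beta. rewrite bspline_tpow by assumption. fold h c k. ring.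
Qed.

Lemma tension_spline_spline rho Ip Fp Nx N coef :
  0 < rho -> 0 < step_x Ip Fp Nx ->
  exists U1 U2,
    tension_spline rho Ip (step_x Ip Fp Nx) N (spline rho Ip Fp Nx coef) U1 U2.
Proof.
  intros Hr Hh. unfold spline. generalize (Nx + 2)%nat. intros n.
  induction n as [|n (U1 & U2 & IH)].
  - destruct (tension_spline_bspline rho Ip Fp Nx N (-1) Hr Hh) as (Q1 & Q2 & HQ).
    do 2 eexists. eapply tension_spline_ext.
    2:{ apply tension_spline_lin with (k := coef (-1)%Z).
        apply tension_spline_zero. exact HQ. }
    intros x; simpl. ring.
  - destruct (tension_spline_bspline rho Ip Fp Nx N (Z.of_nat (S n) - 1) Hr Hh)
      as (Q1 & Q2 & HQ).
    do 2 eexists. eapply tension_spline_ext.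
    2:{ apply tension_spline_lin with (k := coef (Z.of_nat (S n) - 1)%Z).
        exact IH. exact HQ. }
    intros x. reflexivity.
Qed.

(** Amount by which the slope at one end of a mesh interval differs from the
    divided difference; M is the second derivative at that end, M' the one at
    the other end. *)
Definition end_slope (y h M M' : R) : R :=
  h / theta y * ((1 / 2 - lam y) * M + lam y * M').

(** The four coefficients on a mesh interval are determined by the values and
    the second derivatives at its ends. *)
Lemma tension_spline_slopes rho a h N U U1 U2 i :
  0 < rho -> 0 < h -> tension_spline rho a h N U U1 U2 -> (i < N)%nat ->
  let x := a + INR i * h in let x' := a + INR (S i) * h in
  U1 x = (U x' - U x) / h - end_slope (rho * h) h (U2 x) (U2 x') /\
  U1 x' = (U x' - U x) / h + end_slope (rho * h) h (U2 x') (U2 x).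
Proof.
  intros Hr Hh [_ [_ HI]] Hi x x'.
  destruct (HI i Hi) as (A & B & C & D & H).
  assert (Ex' : x' = x + h) by (unfold x, x'; rewrite S_INR; ring).
  assert (Hx : U x = _ /\ U1 x = _ /\ U2 x = _)
    by (apply H; fold x x'; lra).
  assert (Hx' : U x' = _ /\ U1 x' = _ /\ U2 x' = _)
    by (apply H; fold x x'; lra).
  destruct Hx as (-> & -> & ->). destruct Hx' as (-> & -> & ->).
  rewrite Ex'. clear Ex'. generalize x. clear - Hr Hh. intros x.
  assert (Hy : 0 < rho * h) by nra.
  pose proof (cosh_gt_1 _ Hy) as D1. pose proof (sinh_gt _ Hy) as D2.
  unfold end_slope, lam, theta.
  assert (D1' : cosh (rho * h) - 1 <> 0) by lra.
  assert (D2' : sinh (rho * h) <> 0) by lra.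
  clear D1 D2. revert D1' D2'. unfold cosh, sinh.
  replace (rho * (x + h)) with (rho * x + rho * h) by ring.
  repeat rewrite ?exp_Ropp, ?exp_plus.
  pose proof (exp_pos (rho * h)) as HE. pose proof (exp_pos (rho * x)) as HY.
  set (E := exp (rho * h)) in *. set (Y := exp (rho * x)) in *.
  intros D1 D2.
  assert (D1n : E * E + 1 - 2 * E <> 0).
  { intro Q. apply D1. apply (Rmult_eq_reg_l (2 * E)); [|lra].
    rewrite Rmult_0_r, <- Q. field. lra. }
  assert (D2n : E * E - 1 <> 0).
  { intro Q. apply D2. apply (Rmult_eq_reg_l (2 * E)); [|lra].
    rewrite Rmult_0_r, <- Q. field. lra. }
  split; field; repeat split; try lra; auto.
Qed.

(** Index i of [avg] and [dif2] stands for the operators centred at node i + 1,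
    so that the n interior nodes of a mesh with n + 1 intervals correspond to
    i < n. *)
Definition avg (l : R) (v : nat -> R) (i : nat) : R :=
  (1 - 2 * l) * v (S i) + l * (v i + v (S (S i))).
Definition dif2 (v : nat -> R) (i : nat) : R := v (S (S i)) - 2 * v (S i) + v i.

(** The slope at the middle node is computed in both adjacent intervals.  The
    difference of the two expressions is the first relation; in the second one
    the second derivatives cancel. *)
Lemma tension_spline_avg rho a h N U U1 U2 i :
  0 < rho -> 0 < h -> tension_spline rho a h N U U1 U2 -> (S i < N)%nat ->
  let X j := a + INR j * h in
  avg (lam (rho * h)) (fun j => U2 (X j)) i
    = theta (rho * h) * dif2 (fun j => U (X j)) i / h ^ 2 /\
  avg (lam (rho * h)) (fun j => U1 (X j)) i = (U (X (S (S i))) - U (X i)) / (2 * h).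
Proof.
  intros Hr Hh HU Hi X.
  destruct (tension_spline_slopes _ _ _ _ _ _ _ i Hr Hh HU ltac:(lia)) as [L0 R0].
  destruct (tension_spline_slopes _ _ _ _ _ _ _ (S i) Hr Hh HU Hi) as [L1 R1].
  fold (X i) (X (S i)) (X (S (S i))) in *.
  pose proof (theta_bounds (rho * h) ltac:(nra)) as HT.
  unfold avg, dif2, end_slope in *.
  set (l := lam (rho * h)) in *. set (t := theta (rho * h)) in *.
  split.
  - rewrite R0 in L1.
    apply (Rmult_eq_reg_l (h / t)).
    2:{ apply Rgt_not_eq, Rdiv_lt_0_compat; lra. }
    replace (h / t * (t * (U (X (S (S i))) - 2 * U (X (S i)) + U (X i)) / h ^ 2))
      with ((U (X (S (S i))) - U (X (S i))) / h - (U (X (S i)) - U (X i)) / h)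
      by (field; lra).
    lra.
  - assert (Hm : U1 (X (S i)) = (U1 (X (S i)) + U1 (X (S i))) / 2) by lra.
    rewrite Hm at 1. rewrite L0 at 1. rewrite R1 at 1.
    rewrite R0 at 1. rewrite L1. field. lra.
Qed.

(** On a mesh interval U'' solves w'' = rho^2 w, so it combines its end values
    with coefficients sinh(rho s) / sinh(rho h), 0 <= s <= h, which are at
    most 1. *)
Lemma tension_spline_second_bound rho a h N U U1 U2 i x :
  0 < rho -> 0 < h -> tension_spline rho a h N U U1 U2 -> (i < N)%nat ->
  a + INR i * h <= x <= a + INR (S i) * h ->
  Rabs (U2 x) <= Rabs (U2 (a + INR i * h)) + Rabs (U2 (a + INR (S i) * h)).
Proof.
  intros Hr Hh [_ [_ HI]] Hi Hx.
  destruct (HI i Hi) as (A & B & C & D & H).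
  set (x0 := a + INR i * h) in *. set (x1 := a + INR (S i) * h) in *.
  assert (E1 : x1 = x0 + h) by (unfold x0, x1; rewrite S_INR; ring).
  destruct (H x Hx) as (_ & _ & Ex).
  destruct (H x0 ltac:(lra)) as (_ & _ & E0x).
  destruct (H x1 ltac:(lra)) as (_ & _ & E1x).
  assert (K : sinh (rho * h) * U2 x
              = sinh (rho * (x1 - x)) * U2 x0 + sinh (rho * (x - x0)) * U2 x1).
  { rewrite Ex, E0x, E1x, E1. unfold sinh.
    replace (rho * (x0 + h - x)) with (rho * x0 + rho * h + - (rho * x)) by ring.
    replace (rho * (x - x0)) with (rho * x + - (rho * x0)) by ring.
    replace (rho * (x0 + h)) with (rho * x0 + rho * h) by ring.
    repeat rewrite ?Ropp_plus_distr, ?Ropp_involutive, ?exp_Ropp, ?exp_plus.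
    pose proof (exp_pos (rho * h)). pose proof (exp_pos (rho * x)).
    pose proof (exp_pos (rho * x0)).
    rewrite ?exp_Ropp. field. lra. }
  assert (P : 0 < sinh (rho * h)) by (apply sinh_gt; nra).
  assert (Mono : forall s t, 0 <= s <= t -> 0 <= sinh s <= sinh t).
  { intros s t Hst. split; [apply sinh_nonneg; lra|].
    destruct (Req_dec s t) as [->|]; [lra|]. apply Rlt_le, sinh_lt. lra. }
  pose proof (Mono (rho * (x1 - x)) (rho * h) ltac:(nra)) as W0.
  pose proof (Mono (rho * (x - x0)) (rho * h) ltac:(nra)) as W1.
  apply (Rmult_le_reg_l (sinh (rho * h))); [exact P|].
  rewrite <- (Rabs_pos_eq (sinh (rho * h))) at 1 by lra.
  rewrite <- Rabs_mult, K.
  eapply Rle_trans; [apply Rabs_triang|]. rewrite !Rabs_mult.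
  rewrite (Rabs_pos_eq (sinh (rho * (x1 - x)))) by lra.
  rewrite (Rabs_pos_eq (sinh (rho * (x - x0)))) by lra.
  pose proof (Rabs_pos (U2 x0)). pose proof (Rabs_pos (U2 x1)). nra.
Qed.

(** * The weights of the L1 formula *)

Definition frac_step (mu x : R) : R := Rpower (x + 1) (1 - mu) - Rpower x (1 - mu).

(** The weights are sampled from a differentiable function, whose monotonicity
    and convexity follow from the mean value theorem. *)
Lemma l1_weight_S mu k : l1_weight mu (S k) = frac_step mu (INR (S k)).
Proof. reflexivity. Qed.

Lemma is_derive_Rpower p x : 0 < x ->
  is_derive (fun x => Rpower x p) x (p * Rpower x (p - 1)).
Proof.
  intros Hx. apply is_derive_Reals. apply derivable_pt_lim_power. exact Hx.
Qed.

Lemma is_derive_frac_step mu x : 0 < x ->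
  is_derive (frac_step mu) x ((1 - mu) * (Rpower (x + 1) (- mu) - Rpower x (- mu))).
Proof.
  intros Hx. unfold frac_step. replace (- mu) with (1 - mu - 1) by ring.
  evar_last.
  - apply @is_derive_minus.
    + apply (is_derive_comp (fun x => Rpower x (1 - mu)) (fun x => x + 1)).
      apply is_derive_Rpower; lra. auto_derive; auto.
    + apply is_derive_Rpower; lra.
  - unfold minus, plus, opp, scal; simpl; unfold mult; simpl. ring.
Qed.

Lemma is_derive_power_step mu x : 0 < x ->
  is_derive (fun x => Rpower (x + 1) (- mu) - Rpower x (- mu)) x
    (- mu * (Rpower (x + 1) (- mu - 1) - Rpower x (- mu - 1))).
Proof.
  intros Hx. evar_last.
  - apply @is_derive_minus.
    + apply (is_derive_comp (fun x => Rpower x (- mu)) (fun x => x + 1)).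
      apply is_derive_Rpower; lra. auto_derive; auto.
    + apply is_derive_Rpower; lra.
  - unfold minus, plus, opp, scal; simpl; unfold mult; simpl. ring.
Qed.

Lemma Rpower_neg_decr p x y : p <= 0 -> 0 < x <= y -> Rpower y p <= Rpower x p.
Proof.
  intros Hp [Hx Hxy]. unfold Rpower.
  assert (ln x <= ln y) by (destruct Hxy as [H| ->]; [left; apply ln_increasing; auto|lra]).
  assert (E : p * ln y <= p * ln x) by nra.
  destruct E as [E| ->]; [left; apply exp_increasing; exact E|lra].
Qed.

Lemma l1_weight_nonneg mu k : 0 < mu <= 1 -> 0 <= l1_weight mu k.
Proof.
  intros Hmu. destruct k as [|k]; [simpl; lra|]. rewrite l1_weight_S.
  unfold frac_step. pose proof (lt_0_INR (S k) ltac:(lia)).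
  enough (Rpower (INR (S k)) (1 - mu) <= Rpower (INR (S k) + 1) (1 - mu)) by lra.
  apply Rle_Rpower_l; lra.
Qed.

Lemma l1_weight_decr mu k : 0 < mu <= 1 -> l1_weight mu (S k) <= l1_weight mu k.
Proof.
  intros Hmu. rewrite l1_weight_S. destruct k as [|k].
  - simpl l1_weight. unfold frac_step. simpl INR.
    replace (1 + 1) with 2 by ring.
    assert (H1 : Rpower 1 (1 - mu) = 1)
      by (unfold Rpower; rewrite ln_1, Rmult_0_r; apply exp_0).
    rewrite H1. assert (Rpower 2 (1 - mu) <= Rpower 2 1) by (apply Rle_Rpower; lra).
    rewrite Rpower_1 in H; lra.
  - rewrite l1_weight_S. pose proof (lt_0_INR (S k) ltac:(lia)) as Hk.
    rewrite (S_INR (S k)). set (x := INR (S k)) in *.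
    destruct (mvt_interval (frac_step mu)
      (fun x => (1 - mu) * (Rpower (x + 1) (- mu) - Rpower x (- mu))) x (x + 1))
      as [c [Hc E]]; [lra|intros; apply is_derive_frac_step; lra|].
    pose proof (Rpower_neg_decr (- mu) c (c + 1) ltac:(lra) ltac:(lra)). nra.
Qed.

Lemma l1_weight_convex mu k : 0 < mu <= 1 ->
  l1_weight mu (S (S k)) - l1_weight mu (S (S (S k)))
  <= l1_weight mu (S k) - l1_weight mu (S (S k)).
Proof.
  intros Hmu. rewrite !l1_weight_S. pose proof (lt_0_INR (S k) ltac:(lia)) as Hk.
  rewrite (S_INR (S (S k))), (S_INR (S k)). set (x := INR (S k)) in *.
  set (d := fun x => (1 - mu) * (Rpower (x + 1) (- mu) - Rpower x (- mu))).
  destruct (mvt_interval (frac_step mu) d x (x + 1))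
    as [c [Hc E]]; [lra|intros; apply is_derive_frac_step; lra|].
  destruct (mvt_interval (frac_step mu) d (x + 1) (x + 1 + 1))
    as [c' [Hc' E']]; [lra|intros; apply is_derive_frac_step; lra|].
  assert (d c <= d c').
  { destruct (Req_dec c c') as [->|Hne]; [lra|].
    destruct (mvt_interval (fun x => Rpower (x + 1) (- mu) - Rpower x (- mu))
      (fun x => - mu * (Rpower (x + 1) (- mu - 1) - Rpower x (- mu - 1))) c c')
      as [b [Hb F]]; [lra|intros; apply is_derive_power_step; lra|].
    pose proof (Rpower_neg_decr (- mu - 1) b (b + 1) ltac:(lra) ltac:(lra)).
    unfold d. assert (0 <= - mu * (Rpower (b + 1) (- mu - 1) - Rpower b (- mu - 1)) * (c' - c)).
    { apply Rmult_le_pos; nra. }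
    nra. }
  nra.
Qed.

Lemma l1_sum_ext mu v w n :
  (forall k, (k <= n + 1)%nat -> v k = w k) -> l1_sum mu v n = l1_sum mu w n.
Proof.
  intros H. apply sum_eq. intros k Hk. rewrite !H by lia. reflexivity.
Qed.

Lemma l1_sum_lin mu c d v w n :
  l1_sum mu (fun k => c * v k + d * w k) n = c * l1_sum mu v n + d * l1_sum mu w n.
Proof.
  unfold l1_sum. rewrite !scal_sum, <- sum_plus. apply sum_eq. intros; ring.
Qed.

(** Abel summation writes the L1 sum as y_(n+1) minus a combination of the
    earlier values with coefficients w_(k-1) - w_k and w_n.  These are
    nonnegative and add up to w_0 = 1. *)
Lemma l1_sum_lower_bound mu y b n : 0 < mu <= 1 ->
  (forall k, (k <= n)%nat -> y k <= b) -> y (n + 1)%nat - b <= l1_sum mu y n.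
Proof.
  intros Hmu Hy.
  assert (P : forall j, (j <= n)%nat ->
    y (n + 1)%nat - b - l1_weight mu j * (y (n - j)%nat - b) <=
    sum_f_R0 (fun k => l1_weight mu k * (y (n - k + 1)%nat - y (n - k)%nat)) j).
  { induction j as [|j IH]; intros Hj.
    - simpl. rewrite Nat.sub_0_r. lra.
    - rewrite tech5. specialize (IH ltac:(lia)).
      replace (n - S j + 1)%nat with (n - j)%nat by lia.
      pose proof (l1_weight_decr mu j Hmu). pose proof (Hy (n - j)%nat ltac:(lia)).
      nra. }
  specialize (P n ltac:(lia)). unfold l1_sum.
  pose proof (l1_weight_nonneg mu n Hmu). pose proof (Hy (n - n)%nat ltac:(lia)). nra.
Qed.

(** * Finite sums and the discrete energy *)

Fixpoint rsum (f : nat -> R) (n : nat) : R :=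
  match n with O => 0 | S n => rsum f n + f n end.

Lemma rsum_lin c d f g n :
  rsum (fun i => c * f i + d * g i) n = c * rsum f n + d * rsum g n.
Proof. induction n as [|n IH]; simpl; [ring|rewrite IH; ring]. Qed.

Lemma rsum_ext f g n : (forall i, (i < n)%nat -> f i = g i) -> rsum f n = rsum g n.
Proof. induction n as [|n IH]; simpl; intros H; [auto|rewrite IH, H; auto]. Qed.

Lemma rsum_le f g n : (forall i, (i < n)%nat -> f i <= g i) -> rsum f n <= rsum g n.
Proof.
  induction n as [|n IH]; simpl; intros H; [lra|].
  assert (rsum f n <= rsum g n) by auto. pose proof (H n ltac:(lia)). lra.
Qed.

Lemma rsum_const c n : rsum (fun _ => c) n = INR n * c.
Proof. induction n as [|n IH]; [simpl; ring|]. rewrite S_INR. simpl rsum. rewrite IH. ring. Qed.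

Lemma rsum_zero f n : (forall i, (i < n)%nat -> f i = 0) -> rsum f n = 0.
Proof. intros H. induction n as [|n IH]; simpl; [reflexivity|]. rewrite IH, H by auto. ring. Qed.

Lemma rsum_nonneg f n : (forall i, (i < n)%nat -> 0 <= f i) -> 0 <= rsum f n.
Proof.
  intros H. pose proof (rsum_le (fun _ => 0) f n H) as P. rewrite rsum_const in P. lra.
Qed.

Lemma rsum_S f n : rsum f (S n) = rsum f n + f n.
Proof. reflexivity. Qed.

Lemma rsum_shift f n : rsum f (S n) = f 0%nat + rsum (fun i => f (S i)) n.
Proof. induction n as [|n IH]; [simpl; ring|]. simpl in *. rewrite IH. ring. Qed.

Lemma l1_sum_rsum mu (e : nat -> nat -> R) t m n :
  l1_sum mu (fun k => rsum (fun i => e k i * t i) m) n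
  = rsum (fun i => l1_sum mu (fun k => e k i) n * t i) m.
Proof.
  induction m as [|m IH].
  - simpl. unfold l1_sum. rewrite <- (sum_eq (fun _ => 0) _ n), sum_cte; [ring|].
    intros; ring.
  - simpl. rewrite <- IH.
    rewrite <- (Rmult_1_l (l1_sum mu (fun k => rsum (fun i => e k i * t i) m) n)).
    rewrite (Rmult_comm _ (t m)), <- l1_sum_lin. apply l1_sum_ext. intros; ring.
Qed.

Definition dif1 (v : nat -> R) (i : nat) : R := v (S i) - v i.

Lemma summation_by_parts v w n : v 0%nat = 0 -> v (S n) = 0 ->
  rsum (fun i => dif2 w i * v (S i)) n = - rsum (fun i => dif1 w i * dif1 v i) (S n).
Proof.
  intros H0 Hn.
  assert (P : rsum (fun i => dif2 w i * v (S i)) n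
              = dif1 w n * v n - rsum (fun i => dif1 w i * dif1 v i) n).
  { clear Hn. induction n as [|n IH]; simpl; [rewrite H0; ring|].
    rewrite IH. unfold dif2, dif1. ring. }
  rewrite P, rsum_S. unfold dif1. rewrite Hn. ring.
Qed.

Lemma rsum_dif1_sqr_le v n : v 0%nat = 0 -> v (S n) = 0 ->
  rsum (fun i => dif1 v i ^ 2) (S n) <= 4 * rsum (fun i => v (S i) ^ 2) n.
Proof.
  intros H0 Hn.
  apply Rle_trans with (rsum (fun i => 2 * v (S i) ^ 2 + 2 * v i ^ 2) (S n)).
  - apply rsum_le. intros i _. unfold dif1.
    pose proof (pow2_ge_0 (v (S i) + v i)). lra.
  - rewrite rsum_lin. rewrite (rsum_shift (fun i => v i ^ 2)), rsum_S.
    cbv beta. rewrite H0, Hn. lra.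
Qed.

Lemma rsum_pair_le d n :
  rsum (fun i => 2 * d (S i) ^ 2 + 2 * d i ^ 2) n <= 4 * rsum (fun i => d i ^ 2) (S n).
Proof.
  rewrite rsum_lin. pose proof (rsum_shift (fun i => d i ^ 2) n) as P.
  rewrite rsum_S in P |- *.
  pose proof (pow2_ge_0 (d 0%nat)). pose proof (pow2_ge_0 (d n)). lra.
Qed.

Lemma rsum_dif2_sqr_le v n :
  rsum (fun i => dif2 v i ^ 2) n <= 4 * rsum (fun i => dif1 v i ^ 2) (S n).
Proof.
  eapply Rle_trans; [|apply rsum_pair_le]. apply rsum_le. intros i _.
  replace (dif2 v i) with (dif1 v (S i) - dif1 v i) by (unfold dif2, dif1; ring).
  pose proof (pow2_ge_0 (dif1 v (S i) + dif1 v i)). lra.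
Qed.

Lemma rsum_cdif_sqr_le v n :
  rsum (fun i => (v (S (S i)) - v i) ^ 2) n <= 4 * rsum (fun i => dif1 v i ^ 2) (S n).
Proof.
  eapply Rle_trans; [|apply rsum_pair_le]. apply rsum_le. intros i _.
  replace (v (S (S i)) - v i) with (dif1 v (S i) + dif1 v i) by (unfold dif1; ring).
  pose proof (pow2_ge_0 (dif1 v (S i) - dif1 v i)). lra.
Qed.

(** The terms v_(i+2) v_(i+1) - v_(i+1) v_i telescope: the central difference is
    skew-symmetric. *)
Lemma rsum_cdif_self v n : v 0%nat = 0 -> v (S n) = 0 ->
  rsum (fun i => (v (S (S i)) - v i) * v (S i)) n = 0.
Proof.
  intros H0 Hn.
  assert (P : rsum (fun i => (v (S (S i)) - v i) * v (S i)) n = v (S n) * v n).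
  { clear Hn. induction n as [|n IH]; simpl; [rewrite H0; ring|]. rewrite IH. ring. }
  rewrite P, Hn. ring.
Qed.

(** Inductive step of (d_1 + ... + d_k)^2 <= k (d_1^2 + ... + d_k^2). *)
Lemma cauchy_schwarz_step x d s k : 0 <= k -> 0 <= s -> x ^ 2 <= k * s ->
  (x + d) ^ 2 <= (k + 1) * (s + d ^ 2).
Proof.
  intros Hk Hs IH.
  enough (2 * x * d <= s + k * d ^ 2) by nra.
  destruct (Req_dec k 0) as [->|Hk0].
  - assert (Hx : x = 0) by (apply Rsqr_0_uniq; unfold Rsqr; nra).
    rewrite Hx. lra.
  - assert (0 <= (x - k * d) ^ 2 / k)
      by (apply Rdiv_le_0_compat; [apply pow2_ge_0|lra]).
    assert (x ^ 2 / k <= s) by (apply Rle_div_l; lra).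
    replace ((x - k * d) ^ 2 / k) with (x ^ 2 / k - 2 * x * d + k * d ^ 2) in H
      by (field; lra). lra.
Qed.

(** The discrete Sobolev inequality: v_i is the sum of the first i increments. *)
Lemma sqr_le_rsum_dif1 v n i : v 0%nat = 0 -> (i <= n)%nat ->
  v i ^ 2 <= INR n * rsum (fun j => dif1 v j ^ 2) n.
Proof.
  intros H0 Hi.
  assert (P : forall i, v i ^ 2 <= INR i * rsum (fun j => dif1 v j ^ 2) i).
  { clear i Hi. induction i as [|i IH].
    - rewrite H0. simpl. lra.
    - rewrite S_INR, rsum_S.
      replace (v (S i)) with (v i + dif1 v i) by (unfold dif1; ring).
      apply cauchy_schwarz_step; [apply pos_INR| |exact IH].
      apply rsum_nonneg; intros; apply pow2_ge_0. }
  eapply Rle_trans; [apply P|].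
  assert (M : rsum (fun j => dif1 v j ^ 2) i <= rsum (fun j => dif1 v j ^ 2) n).
  { clear - Hi. induction Hi as [|n Hi IH]; [lra|]. simpl.
    pose proof (pow2_ge_0 (dif1 v n)). simpl in *. lra. }
  pose proof (le_INR _ _ Hi). pose proof (pos_INR i).
  assert (0 <= rsum (fun j => dif1 v j ^ 2) i) by (apply rsum_nonneg; intros; apply pow2_ge_0).
  nra.
Qed.

(** The form obtained by summing P v against K w - q d2 w.  It is written in the
    shape that summation by parts gives it, which is symmetric. *)
Definition energy (K l q : R) (n : nat) (v w : nat -> R) : R :=
  K * (rsum (fun i => v (S i) * w (S i)) n
       - l * rsum (fun i => dif1 v i * dif1 w i) (S n))
  + q * (rsum (fun i => dif1 v i * dif1 w i) (S n)
         - l * rsum (fun i => dif2 v i * dif2 w i) n).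

Definition energy_test (K q : R) (w : nat -> R) (i : nat) : R :=
  K * w (S i) - q * dif2 w i.

Lemma energy_avg K l q n v w :
  v 0%nat = 0 -> v (S n) = 0 -> w 0%nat = 0 -> w (S n) = 0 ->
  rsum (fun i => avg l v i * energy_test K q w i) n = energy K l q n v w.
Proof.
  intros Hv0 Hvn Hw0 Hwn. unfold energy.
  pose proof (summation_by_parts w v n Hw0 Hwn) as P1.
  pose proof (summation_by_parts v w n Hv0 Hvn) as P2.
  transitivity (rsum (fun i => 1 * (K * (v (S i) * w (S i)) + (K * l) * (dif2 v i * w (S i)))
    + 1 * ((- q) * (dif2 w i * v (S i)) + (- (q * l)) * (dif2 v i * dif2 w i))) n).
  - apply rsum_ext. intros i _. unfold avg, energy_test, dif2. ring.
  - rewrite !rsum_lin, P1, P2.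
    rewrite (rsum_ext (fun i => dif1 w i * dif1 v i) (fun i => dif1 v i * dif1 w i))
      by (intros; ring). ring.
Qed.

(** A difference at most doubles the norm, so the terms with the factor l lose at
    most 4 l <= 2/3 of the leading ones. *)
Lemma energy_lower_bound K l q n v : 0 <= K -> 0 <= l <= 1 / 6 -> 0 <= q ->
  v 0%nat = 0 -> v (S n) = 0 ->
  K / 3 * rsum (fun i => v (S i) ^ 2) n + q / 3 * rsum (fun i => dif1 v i ^ 2) (S n)
  <= energy K l q n v v.
Proof.
  intros HK Hl Hq H0 Hn. unfold energy.
  rewrite (rsum_ext (fun i => v (S i) * v (S i)) (fun i => v (S i) ^ 2)) by (intros; ring).
  rewrite (rsum_ext (fun i => dif1 v i * dif1 v i) (fun i => dif1 v i ^ 2)) by (intros; ring).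
  rewrite (rsum_ext (fun i => dif2 v i * dif2 v i) (fun i => dif2 v i ^ 2)) by (intros; ring).
  pose proof (rsum_dif1_sqr_le v n H0 Hn) as P1.
  pose proof (rsum_dif2_sqr_le v n) as P2.
  assert (N0 : 0 <= rsum (fun i => v (S i) ^ 2) n) by (apply rsum_nonneg; intros; apply pow2_ge_0).
  assert (N1 : 0 <= rsum (fun i => dif1 v i ^ 2) (S n)) by (apply rsum_nonneg; intros; apply pow2_ge_0).
  set (s0 := rsum (fun i => v (S i) ^ 2) n) in *.
  set (s1 := rsum (fun i => dif1 v i ^ 2) (S n)) in *.
  set (s2 := rsum (fun i => dif2 v i ^ 2) n) in *.
  assert (1 / 3 * s0 <= s0 - l * s1) by nra.
  assert (1 / 3 * s1 <= s1 - l * s2) by nra.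
  nra.
Qed.

(** The Cauchy-Schwarz inequality of a positive form, from its value at v - w. *)
Lemma energy_cross K l q n v w : 0 <= K -> 0 <= l <= 1 / 6 -> 0 <= q ->
  v 0%nat = 0 -> v (S n) = 0 -> w 0%nat = 0 -> w (S n) = 0 ->
  2 * energy K l q n v w <= energy K l q n v v + energy K l q n w w.
Proof.
  intros HK Hl Hq Hv0 Hvn Hw0 Hwn.
  assert (P : 0 <= energy K l q n (fun i => v i - w i) (fun i => v i - w i)).
  { eapply Rle_trans; [|apply energy_lower_bound; cbv beta; lra].
    apply Rplus_le_le_0_compat; apply Rmult_le_pos; try lra;
      apply rsum_nonneg; intros; apply pow2_ge_0. }
  enough (E : energy K l q n (fun i => v i - w i) (fun i => v i - w i)
    = energy K l q n v v + energy K l q n w w - 2 * energy K l q n v w) by lra.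
  unfold energy.
  assert (Q : forall (f g : nat -> R) m,
    rsum (fun i => (f i - g i) * (f i - g i)) m
    = rsum (fun i => f i * f i) m + rsum (fun i => g i * g i) m
      - 2 * rsum (fun i => f i * g i) m).
  { intros f g m. induction m as [|m IH]; simpl; [ring|rewrite IH; ring]. }
  rewrite (rsum_ext (fun i => dif1 (fun i => v i - w i) i * dif1 (fun i => v i - w i) i)
    (fun i => (dif1 v i - dif1 w i) * (dif1 v i - dif1 w i)))
    by (intros; unfold dif1; ring).
  rewrite (rsum_ext (fun i => dif2 (fun i => v i - w i) i * dif2 (fun i => v i - w i) i)
    (fun i => (dif2 v i - dif2 w i) * (dif2 v i - dif2 w i)))
    by (intros; unfold dif2; ring).
  rewrite (Q (fun i => v (S i)) (fun i => w (S i))), !Q. ring.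
Qed.

(** With this factor alpha K >= beta^2 / alpha, which is what the diffusion needs
    to absorb the convection. *)
Definition energy_K (alpha beta : R) : R := beta ^ 2 / alpha ^ 2 + 1.
(** The factors that Young's inequality puts in front of the squared data, when
    a data term is compared with the reaction and with the diffusion. *)
Definition energy_C (alpha beta gamma : R) : R :=
  3 * energy_K alpha beta / (2 * gamma) + 1 / alpha.

Lemma Rmult_le_weighted c x y : 0 < c -> x * y <= c * x ^ 2 + y ^ 2 / (4 * c).
Proof.
  intros Hc. apply Rminus_le.
  replace (x * y - (c * x ^ 2 + y ^ 2 / (4 * c))) with (- ((2 * c * x - y) ^ 2 / (4 * c)))
    by (field; lra).
  assert (0 <= (2 * c * x - y) ^ 2 / (4 * c))
    by (apply Rdiv_le_0_compat; [apply pow2_ge_0|lra]). lra.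
Qed.

(** The convection tested with e vanishes.  Tested with the second difference it
    is split between the diffusion tested with the second difference and, thanks
    to K, the diffusion tested with e.  Half of the reaction is kept as damping,
    the other half absorbs the data. *)
Lemma energy_dissipation alpha beta gamma l t h n e r :
  0 < alpha -> 0 < gamma -> 0 <= l <= 1 / 6 -> 1 <= t -> 0 < h ->
  e 0%nat = 0 -> e (S n) = 0 ->
  let K := energy_K alpha beta in let q := / h ^ 2 in
  rsum (fun i => (alpha * (t * dif2 e i / h ^ 2)
                  + beta * ((e (S (S i)) - e i) / (2 * h))
                  - gamma * avg l e i + r i) * energy_test K q e i) n
  <= - (gamma / 2) * energy K l q n e e
     + energy_C alpha beta gamma * rsum (fun i => r i ^ 2) n.
Proof.
  intros Ha Hg Hl Ht Hh H0 Hn K q.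
  assert (Hq : 0 < q) by (apply Rinv_0_lt_compat, pow_lt; lra).
  assert (HK : alpha * K = beta ^ 2 / alpha + alpha)
    by (unfold K, energy_K; field; lra).
  assert (HK1 : 1 <= K).
  { unfold K, energy_K.
    assert (0 <= beta ^ 2 / alpha ^ 2)
      by (apply Rdiv_le_0_compat; [apply pow2_ge_0|apply pow_lt; lra]). lra. }
  pose proof (energy_lower_bound K l q n e ltac:(lra) Hl ltac:(lra) H0 Hn) as LB.
  pose proof (energy_avg K l q n e e H0 Hn H0 Hn) as EA.
  pose proof (summation_by_parts e e n H0 Hn) as SP.
  pose proof (rsum_cdif_self e n H0 Hn) as CS.
  pose proof (rsum_cdif_sqr_le e n) as C4.
  rewrite (rsum_ext (fun i => dif1 e i * dif1 e i) (fun i => dif1 e i ^ 2)) in SP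
    by (intros; ring).
  assert (N1 : 0 <= rsum (fun i => dif1 e i ^ 2) (S n))
    by (apply rsum_nonneg; intros; apply pow2_ge_0).
  assert (N2 : 0 <= rsum (fun i => dif2 e i ^ 2) n)
    by (apply rsum_nonneg; intros; apply pow2_ge_0).
  set (s0 := rsum (fun i => e (S i) ^ 2) n) in *.
  set (s1 := rsum (fun i => dif1 e i ^ 2) (S n)) in *.
  set (s2 := rsum (fun i => dif2 e i ^ 2) n) in *.
  set (sc := rsum (fun i => (e (S (S i)) - e i) ^ 2) n) in *.
  set (sr := rsum (fun i => r i ^ 2) n) in *.
  set (Y := energy K l q n e e) in *.
  apply Rle_trans with (rsum (fun i =>
    1 * (1 * (alpha * t * q * K * (dif2 e i * e (S i)) + - (alpha * t * q * q) * dif2 e i ^ 2)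
     + 1 * (beta * K / (2 * h) * ((e (S (S i)) - e i) * e (S i))
            + - gamma * (avg l e i * energy_test K q e i)))
    + 1 * (1 * (alpha * q * q / 4 * dif2 e i ^ 2
                + beta ^ 2 * q / (4 * alpha) * (e (S (S i)) - e i) ^ 2)
     + 1 * (1 * (K * gamma / 6 * e (S i) ^ 2 + alpha * q * q / 4 * dif2 e i ^ 2)
         + energy_C alpha beta gamma * r i ^ 2))) n).
  { apply rsum_le. intros i _.
    (* Q1: data against reaction; Q2: data against diffusion; Q3: convection
       against diffusion *)
    pose proof (Rmult_le_weighted (gamma / 6) (e (S i)) (r i) ltac:(lra)) as Q1.
    pose proof (Rmult_le_weighted (alpha / 4) (q * dif2 e i) (- r i) ltac:(lra)) as Q2.
    pose proof (Rmult_le_weighted (alpha / 4) (q * dif2 e i)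
      (- beta * ((e (S (S i)) - e i) / (2 * h))) ltac:(lra)) as Q3.
    assert (Q1' : K * (e (S i) * r i)
      <= K * (gamma / 6 * e (S i) ^ 2 + r i ^ 2 / (4 * (gamma / 6))))
      by (apply Rmult_le_compat_l; lra).
    replace ((- beta * ((e (S (S i)) - e i) / (2 * h))) ^ 2 / (4 * (alpha / 4)))
      with (beta ^ 2 * q / (4 * alpha) * (e (S (S i)) - e i) ^ 2) in Q3
      by (unfold q; field; lra).
    replace (K * (gamma / 6 * e (S i) ^ 2 + r i ^ 2 / (4 * (gamma / 6))))
      with (K * gamma / 6 * e (S i) ^ 2 + 3 * K / (2 * gamma) * r i ^ 2) in Q1'
      by (field; lra).
    replace ((- r i) ^ 2 / (4 * (alpha / 4))) with (1 / alpha * r i ^ 2) in Q2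
      by (field; lra).
    unfold energy_C. fold K.
    replace (t * dif2 e i / h ^ 2) with (t * q * dif2 e i) by (unfold q; field; lra).
    unfold energy_test.
    replace (beta * K / (2 * h) * ((e (S (S i)) - e i) * e (S i)))
      with (beta * ((e (S (S i)) - e i) / (2 * h)) * (K * e (S i))) by (field; lra).
    set (b := (e (S (S i)) - e i) / (2 * h)) in *.
    lra. }
  rewrite !rsum_lin, EA, SP, CS. fold s0 s2 sc sr.
  assert (A1 : beta ^ 2 * q / (4 * alpha) * sc <= beta ^ 2 * q / alpha * s1).
  { replace (beta ^ 2 * q / alpha * s1) with (beta ^ 2 * q / (4 * alpha) * (4 * s1))
      by (field; lra).
    apply Rmult_le_compat_l; [|lra].
    apply Rdiv_le_0_compat; [|lra]. pose proof (pow2_ge_0 beta). nra. }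
  assert (A2 : beta ^ 2 * q / alpha * s1 <= alpha * t * q * K * s1).
  { apply Rmult_le_compat_r; [exact N1|].
    replace (beta ^ 2 * q / alpha) with (q * (beta ^ 2 / alpha)) by (field; lra).
    replace (alpha * t * q * K) with (q * (t * (alpha * K))) by ring.
    apply Rmult_le_compat_l; [lra|]. rewrite HK.
    assert (0 <= beta ^ 2 / alpha) by (apply Rdiv_le_0_compat; [apply pow2_ge_0|lra]). nra. }
  assert (A3 : alpha * q * q * s2 <= alpha * t * q * q * s2).
  { apply Rmult_le_compat_r; [exact N2|].
    replace (alpha * t * q * q) with (alpha * q * q * t) by ring.
    assert (0 < alpha * q * q) by (apply Rmult_lt_0_compat; nra). nra. }
  assert (A4 : gamma / 2 * (K / 3 * s0 + q / 3 * s1) <= gamma / 2 * Y)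
    by (apply Rmult_le_compat_l; lra).
  assert (A5 : 0 <= gamma / 2 * (q / 3 * s1)) by (apply Rmult_le_pos; nra).
  assert (0 <= alpha * q * q * s2) by (apply Rmult_le_pos; [|exact N2]; nra).
  lra.
Qed.

Lemma l1_sum_avg mu l (e : nat -> nat -> R) n i :
  l1_sum mu (fun k => avg l (e k) i) n = avg l (fun j => l1_sum mu (fun k => e k j) n) i.
Proof.
  unfold avg. rewrite l1_sum_lin.
  rewrite (l1_sum_ext mu (fun k => e k i + e k (S (S i)))
                         (fun k => 1 * e k i + 1 * e k (S (S i))))
    by (intros; ring).
  rewrite l1_sum_lin. ring.
Qed.

(** If the earlier energies are at most M, the L1 sum of the energies of
    (e_k, e_(n+1)) is at least (Y - M) / 2, where Y is the new energy.  It is also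
    at most g (- gamma Y / 2 + gamma M / 2) for the stated value of M, since this
    is the level at which damping and data balance.  Hence Y <= M. *)
Lemma scheme_energy_bound mu alpha beta gamma l t h g n Nt
    (e r : nat -> nat -> R) rmax :
  0 < mu <= 1 -> 0 < alpha -> 0 < gamma -> 0 <= l <= 1 / 6 -> 1 <= t -> 0 < h -> 0 < g ->
  (forall i, (i <= S n)%nat -> e 0%nat i = 0) ->
  (forall k, (k <= Nt)%nat -> e k 0%nat = 0 /\ e k (S n) = 0) ->
  (forall k i, (k < Nt)%nat -> (i < n)%nat ->
     avg l (fun j => l1_sum mu (fun k => e k j) k) i
     = g * (alpha * (t * dif2 (e (k + 1)%nat) i / h ^ 2)
            + beta * ((e (k + 1)%nat (S (S i)) - e (k + 1)%nat i) / (2 * h))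
            - gamma * avg l (e (k + 1)%nat) i + r k i)) ->
  (forall k i, (k < Nt)%nat -> (i < n)%nat -> Rabs (r k i) <= rmax) ->
  forall k, (k <= Nt)%nat ->
  energy (energy_K alpha beta) l (/ h ^ 2) n (e k) (e k)
  <= 2 * energy_C alpha beta gamma / gamma * (INR n * rmax ^ 2).
Proof.
  intros Hmu Ha Hg Hl Ht Hh Hgt He0 Hbd Heq Hr.
  set (K := energy_K alpha beta). set (q := / h ^ 2).
  set (C0 := energy_C alpha beta gamma).
  assert (Hq : 0 < q) by (apply Rinv_0_lt_compat, pow_lt; lra).
  assert (HK1 : 1 <= K).
  { unfold K, energy_K.
    assert (0 <= beta ^ 2 / alpha ^ 2)
      by (apply Rdiv_le_0_compat; [apply pow2_ge_0|apply pow_lt; lra]). lra. }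
  assert (HC : 0 < C0).
  { unfold C0, energy_C. fold K. apply Rplus_lt_0_compat; apply Rdiv_lt_0_compat; lra. }
  set (Ymax := 2 * C0 / gamma * (INR n * rmax ^ 2)).
  intros k. induction k as [k IH] using lt_wf_ind. intros Hk.
  destruct k as [|k].
  { assert (E0 : energy K l q n (e 0%nat) (e 0%nat) = 0).
    { unfold energy, dif1, dif2.
      rewrite !rsum_zero by (intros; rewrite !He0 by lia; ring). ring. }
    rewrite E0. unfold Ymax. apply Rmult_le_pos.
    - apply Rdiv_le_0_compat; lra.
    - apply Rmult_le_pos; [apply pos_INR|apply pow2_ge_0]. }
  set (w := e (S k)).
  destruct (Hbd (S k) Hk) as [Hw0 Hwn].
  set (Y := energy K l q n w w).
  assert (Hlow : Y - (Ymax + Y) / 2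
    <= l1_sum mu (fun j => energy K l q n (e j) w) k).
  { pose proof (l1_sum_lower_bound mu (fun j => energy K l q n (e j) w)
      ((Ymax + Y) / 2) k Hmu) as P. cbv beta in P.
    replace (k + 1)%nat with (S k) in P by lia. apply P.
    intros j Hj. destruct (Hbd j ltac:(lia)) as [H0 Hn].
    pose proof (energy_cross K l q n (e j) w ltac:(lra) Hl ltac:(lra) H0 Hn Hw0 Hwn).
    pose proof (IH j ltac:(lia) ltac:(lia)). fold Ymax in H1. unfold Y. lra. }
  assert (Hup : l1_sum mu (fun j => energy K l q n (e j) w) k
    <= g * (- (gamma / 2) * Y + C0 * (INR n * rmax ^ 2))).
  { rewrite (l1_sum_ext mu _ (fun j => rsum (fun i => avg l (e j) i * energy_test K q w i) n)).
    2:{ intros j Hj. destruct (Hbd j ltac:(lia)) as [H0 Hn].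
        symmetry. apply energy_avg; assumption. }
    rewrite (l1_sum_rsum mu (fun j i => avg l (e j) i)).
    rewrite (rsum_ext _ (fun i => g * ((alpha * (t * dif2 w i / h ^ 2)
                  + beta * ((w (S (S i)) - w i) / (2 * h))
                  - gamma * avg l w i + r k i) * energy_test K q w i)
                  + 0 * 0)).
    2:{ intros i Hi. rewrite l1_sum_avg, Heq by (try lia; assumption).
        replace (k + 1)%nat with (S k) by lia. fold w. ring. }
    rewrite rsum_lin, Rmult_0_l, Rplus_0_r.
    apply Rmult_le_compat_l; [lra|].
    eapply Rle_trans; [apply energy_dissipation; assumption|].
    fold K q Y C0. apply Rplus_le_compat_l, Rmult_le_compat_l; [lra|].
    rewrite <- rsum_const. apply rsum_le. intros i Hi.
    pose proof (Hr k i ltac:(lia) Hi). pose proof (Rabs_pos (r k i)).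
    rewrite <- (pow2_abs (r k i)). nra. }
  assert (E : C0 * (INR n * rmax ^ 2) = gamma / 2 * Ymax) by (unfold Ymax; field; lra).
  rewrite E in Hup. fold Y.
  assert (0 < g * gamma) by nra.
  nra.
Qed.

(** The energy controls the sum of squared differences divided by h^2, and the
    Sobolev inequality contributes a factor n + 1 that combines with the n of the
    data sum: only the length (n + 1) h of the interval remains. *)
Lemma scheme_max_bound mu alpha beta gamma l t h g n Nt
    (e r : nat -> nat -> R) rmax :
  0 < mu <= 1 -> 0 < alpha -> 0 < gamma -> 0 <= l <= 1 / 6 -> 1 <= t -> 0 < h -> 0 < g ->
  0 <= rmax ->
  (forall i, (i <= S n)%nat -> e 0%nat i = 0) ->
  (forall k, (k <= Nt)%nat -> e k 0%nat = 0 /\ e k (S n) = 0) ->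
  (forall k i, (k < Nt)%nat -> (i < n)%nat ->
     avg l (fun j => l1_sum mu (fun k => e k j) k) i
     = g * (alpha * (t * dif2 (e (k + 1)%nat) i / h ^ 2)
            + beta * ((e (k + 1)%nat (S (S i)) - e (k + 1)%nat i) / (2 * h))
            - gamma * avg l (e (k + 1)%nat) i + r k i)) ->
  (forall k i, (k < Nt)%nat -> (i < n)%nat -> Rabs (r k i) <= rmax) ->
  forall k i, (k <= Nt)%nat -> (i <= S n)%nat ->
  Rabs (e k i) <= sqrt (6 * energy_C alpha beta gamma / gamma) * (INR (S n) * h) * rmax.
Proof.
  intros Hmu Ha Hg Hl Ht Hh Hgt Hrm He0 Hbd Heq Hr k i Hk Hi.
  pose proof (scheme_energy_bound mu alpha beta gamma l t h g n Nt e r rmax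
    Hmu Ha Hg Hl Ht Hh Hgt He0 Hbd Heq Hr k Hk) as HE.
  destruct (Hbd k Hk) as [H0 Hn].
  assert (HK1 : 1 <= energy_K alpha beta).
  { unfold energy_K.
    assert (0 <= beta ^ 2 / alpha ^ 2)
      by (apply Rdiv_le_0_compat; [apply pow2_ge_0|apply pow_lt; lra]). lra. }
  assert (HC : 0 < energy_C alpha beta gamma).
  { unfold energy_C. apply Rplus_lt_0_compat; apply Rdiv_lt_0_compat; lra. }
  assert (Hq : 0 < / h ^ 2) by (apply Rinv_0_lt_compat, pow_lt; lra).
  pose proof (energy_lower_bound (energy_K alpha beta) l (/ h ^ 2) n (e k)
    ltac:(lra) Hl ltac:(lra) H0 Hn) as LB.
  pose proof (sqr_le_rsum_dif1 (e k) (S n) i H0 Hi) as SQ.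
  set (s1 := rsum (fun j => dif1 (e k) j ^ 2) (S n)) in *.
  assert (N0 : 0 <= rsum (fun i => e k (S i) ^ 2) n)
    by (apply rsum_nonneg; intros; apply pow2_ge_0).
  set (s0 := rsum (fun i => e k (S i) ^ 2) n) in *.
  set (C0 := energy_C alpha beta gamma) in *.
  assert (B1 : s1 <= h ^ 2 * (6 * C0 / gamma * (INR n * rmax ^ 2))).
  { replace s1 with (3 * h ^ 2 * (/ h ^ 2 / 3 * s1)) by (field; lra).
    replace (h ^ 2 * (6 * C0 / gamma * (INR n * rmax ^ 2)))
      with (3 * h ^ 2 * (2 * C0 / gamma * (INR n * rmax ^ 2))) by (field; lra).
    apply Rmult_le_compat_l; [nra|]. nra. }
  assert (HP : 0 <= 6 * C0 / gamma) by (apply Rdiv_le_0_compat; lra).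
  assert (B2 : e k i ^ 2 <= (sqrt (6 * C0 / gamma) * (INR (S n) * h) * rmax) ^ 2).
  { replace ((sqrt (6 * C0 / gamma) * (INR (S n) * h) * rmax) ^ 2)
      with ((sqrt (6 * C0 / gamma) * sqrt (6 * C0 / gamma)) * INR (S n) ^ 2 * h ^ 2 * rmax ^ 2)
      by ring.
    rewrite sqrt_sqrt by exact HP.
    eapply Rle_trans; [exact SQ|].
    eapply Rle_trans; [apply Rmult_le_compat_l; [apply pos_INR|exact B1]|].
    replace (6 * C0 / gamma * INR (S n) ^ 2 * h ^ 2 * rmax ^ 2)
      with (INR (S n) * (h ^ 2 * (6 * C0 / gamma * (INR (S n) * rmax ^ 2)))) by ring.
    apply Rmult_le_compat_l; [apply pos_INR|].
    apply Rmult_le_compat_l; [apply pow2_ge_0|].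
    apply Rmult_le_compat_l; [exact HP|].
    apply Rmult_le_compat_r; [apply pow2_ge_0|]. apply le_INR; lia. }
  apply Rsqr_incr_0_var.
  - rewrite <- Rsqr_abs, !Rsqr_pow2. exact B2.
  - repeat apply Rmult_le_pos; try lra; [apply sqrt_pos|apply pos_INR].
Qed.

(** * Calculus on a segment and on a rectangle *)

(** Functions on a segment are continued to the line by their end values, so
    continuity is two-sided while the derivative is only asked for inside. *)
Definition seg_deriv (a b : R) (f f1 : R -> R) : Prop :=
  (forall x, continuous f x) /\ (forall x, a < x < b -> is_derive f x (f1 x)).

Lemma seg_mvt a b f f1 x y : seg_deriv a b f f1 -> a <= x -> x <= y -> y <= b ->
  exists c, x <= c <= y /\ f y - f x = f1 c * (y - x).
Proof.
  intros [Hc Hd] Hx Hxy Hy. destruct (Req_dec x y) as [->|Hne].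
  { exists y. split; [lra|ring]. }
  destruct (MVT_gen f x y f1) as [c [H E]].
  - intros t. rewrite Rmin_left, Rmax_right by lra. intros Ht. apply Hd. lra.
  - intros t _. apply continuity_pt_filterlim. apply Hc.
  - rewrite Rmin_left, Rmax_right in H by lra. eauto.
Qed.

(** Iterating this lemma gives Taylor remainders, without the factorials. *)
Lemma growth_bound G G1 C k h : 0 <= h -> 0 <= C -> seg_deriv 0 h G G1 ->
  G 0 = 0 -> (forall s, 0 <= s <= h -> Rabs (G1 s) <= C * s ^ k) ->
  Rabs (G h) <= C * h ^ S k.
Proof.
  intros Hh HC HG H0 HB.
  destruct (seg_mvt 0 h G G1 0 h HG) as [c [Hc E]]; try lra.
  rewrite H0, !Rminus_0_r in E. rewrite E, Rabs_mult, (Rabs_pos_eq h) by lra.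
  simpl. rewrite (Rmult_comm h), <- Rmult_assoc.
  apply Rmult_le_compat_r; [lra|].
  eapply Rle_trans; [apply HB; lra|]. apply Rmult_le_compat_l; [lra|].
  apply pow_incr. lra.
Qed.

Lemma second_difference_bound a b f f1 f2 K x h :
  seg_deriv a b f f1 -> seg_deriv a b f1 f2 ->
  (forall y, a <= y <= b -> Rabs (f2 y) <= K) ->
  0 <= h -> a <= x - h -> x + h <= b ->
  Rabs (f (x + h) - 2 * f x + f (x - h)) <= 2 * K * h ^ 2.
Proof.
  intros H H1 HK Hh Ha Hb.
  destruct (seg_mvt a b f f1 x (x + h) H) as [c [Hc E]]; try lra.
  destruct (seg_mvt a b f f1 (x - h) x H) as [d [Hd E']]; try lra.
  destruct (seg_mvt a b f1 f2 d c H1) as [z [Hz F]]; try lra.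
  replace (f (x + h) - 2 * f x + f (x - h)) with (h * (f1 c - f1 d)).
  2:{ replace (f (x + h) - 2 * f x + f (x - h))
        with ((f (x + h) - f x) - (f x - f (x - h))) by ring.
      rewrite E, E'. ring. }
  rewrite F, !Rabs_mult, (Rabs_pos_eq h), (Rabs_pos_eq (c - d)) by lra.
  pose proof (HK z ltac:(lra)). pose proof (Rabs_pos (f2 z)).
  replace (2 * K * h ^ 2) with (h * (K * (2 * h))) by ring.
  apply Rmult_le_compat_l; [lra|]. apply Rmult_le_compat; lra.
Qed.

Lemma is_derive_shift (f : R -> R) l x s (e : R) :
  is_derive f (x + e * s) l -> is_derive (fun s => f (x + e * s)) s (e * l).
Proof.
  intros H. evar_last.
  - apply (is_derive_comp f (fun s => x + e * s)). exact H.
    auto_derive; [exact I|reflexivity].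
  - unfold scal; simpl; unfold mult; simpl. ring.
Qed.

Lemma continuous_shift (f : R -> R) x s (e : R) :
  continuous f (x + e * s) -> continuous (fun s => f (x + e * s)) s.
Proof.
  intros H. apply (continuous_comp (fun s => x + e * s) f); [|exact H].
  apply (ex_derive_continuous (fun s => x + e * s)). auto_derive. exact I.
Qed.

(** As a function of the step, the error has as derivative the second difference
    of f'. *)
Lemma central_difference_error a b f f1 f2 f3 K x h :
  seg_deriv a b f f1 -> seg_deriv a b f1 f2 -> seg_deriv a b f2 f3 ->
  (forall y, a <= y <= b -> Rabs (f3 y) <= K) ->
  0 <= h -> a <= x - h -> x + h <= b ->
  Rabs (f (x + h) - f (x - h) - 2 * h * f1 x) <= 2 * K * h ^ 3.
Proof.
  intros H H1 H2 HK Hh Ha Hb.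
  pose proof (Rle_trans _ _ _ (Rabs_pos _) (HK x ltac:(lra))) as K0.
  set (G := fun s => f (x + 1 * s) - f (x + -1 * s) - 2 * s * f1 x).
  set (G1 := fun s => f1 (x + s) - 2 * f1 x + f1 (x - s)).
  replace (f (x + h) - f (x - h) - 2 * h * f1 x) with (G h)
    by (unfold G; rewrite Rmult_1_l; replace (x + -1 * h) with (x - h) by ring; ring).
  apply (growth_bound G G1); try lra.
  - split.
    + intros s. unfold G. apply @continuous_minus; [apply @continuous_minus|].
      * apply continuous_shift, H.
      * apply continuous_shift, H.
      * apply (ex_derive_continuous (fun s => 2 * s * f1 x)). auto_derive. exact I.
    + intros s Hs. unfold G. evar_last.
      * apply @is_derive_minus; [apply @is_derive_minus|].
        -- apply is_derive_shift, H. lra.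
        -- apply is_derive_shift, H. lra.
        -- instantiate (1 := 2 * f1 x). auto_derive; [exact I|ring].
      * unfold minus, plus, opp, G1; simpl. rewrite !Rmult_1_l.
        replace (x + -1 * s) with (x - s) by ring. ring.
  - unfold G. rewrite !Rmult_0_r. ring.
  - intros s Hs. unfold G1.
    apply (second_difference_bound a b f1 f2 f3); auto; lra.
Qed.

(** As a function of the step, the error has as derivative the central difference
    error of f'. *)
Lemma second_difference_error a b f f1 f2 f3 f4 K x h :
  seg_deriv a b f f1 -> seg_deriv a b f1 f2 -> seg_deriv a b f2 f3 ->
  seg_deriv a b f3 f4 ->
  (forall y, a <= y <= b -> Rabs (f4 y) <= K) ->
  0 <= h -> a <= x - h -> x + h <= b ->
  Rabs (f (x + h) - 2 * f x + f (x - h) - h ^ 2 * f2 x) <= 2 * K * h ^ 4.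
Proof.
  intros H H1 H2 H3 HK Hh Ha Hb.
  pose proof (Rle_trans _ _ _ (Rabs_pos _) (HK x ltac:(lra))) as K0.
  set (G := fun s => f (x + 1 * s) + f (x + -1 * s) - (2 * f x + s ^ 2 * f2 x)).
  set (G1 := fun s => f1 (x + s) - f1 (x - s) - 2 * s * f2 x).
  replace (f (x + h) - 2 * f x + f (x - h) - h ^ 2 * f2 x) with (G h)
    by (unfold G; rewrite Rmult_1_l; replace (x + -1 * h) with (x - h) by ring; ring).
  apply (growth_bound G G1); try lra.
  - split.
    + intros s. unfold G. apply @continuous_minus; [apply @continuous_plus|].
      * apply continuous_shift, H.
      * apply continuous_shift, H.
      * apply (ex_derive_continuous (fun s => 2 * f x + s ^ 2 * f2 x)). auto_derive. exact I.
    + intros s Hs. unfold G. evar_last.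
      * apply @is_derive_minus; [apply @is_derive_plus|].
        -- apply is_derive_shift, H. lra.
        -- apply is_derive_shift, H. lra.
        -- instantiate (1 := 2 * s * f2 x). auto_derive; [exact I|ring].
      * unfold minus, plus, opp, G1; simpl. rewrite !Rmult_1_l.
        replace (x + -1 * s) with (x - s) by ring. ring.
  - unfold G. rewrite !Rmult_0_r, !Rplus_0_r. ring.
  - intros s Hs. unfold G1.
    apply (central_difference_error a b f1 f2 f3 f4); auto; lra.
Qed.

(** The slope of the chord is a value of f', and f' varies by at most K (x1 - x0). *)
Lemma interpolation_bound x0 x1 f f1 f2 K e x :
  x0 < x1 -> seg_deriv x0 x1 f f1 -> seg_deriv x0 x1 f1 f2 ->
  (forall y, x0 <= y <= x1 -> Rabs (f2 y) <= K) ->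
  Rabs (f x0) <= e -> Rabs (f x1) <= e -> x0 <= x <= x1 ->
  Rabs (f x) <= e + K * (x1 - x0) ^ 2.
Proof.
  intros Hlt H H1 HK He0 He1 Hx.
  destruct (seg_mvt x0 x1 f f1 x0 x H) as [c [Hc E]]; try lra.
  destruct (seg_mvt x0 x1 f f1 x0 x1 H) as [d [Hd F]]; try lra.
  set (h := x1 - x0) in *.
  assert (B : Rabs (f1 c - f1 d) <= K * h).
  { destruct (Rle_dec c d) as [Hcd|Hcd].
    - destruct (seg_mvt x0 x1 f1 f2 c d H1) as [z [Hz G]]; try lra.
      rewrite Rabs_minus_sym, G, Rabs_mult, (Rabs_pos_eq (d - c)) by lra.
      pose proof (HK z ltac:(lra)). pose proof (Rabs_pos (f2 z)).
      apply Rmult_le_compat; unfold h; lra.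
    - destruct (seg_mvt x0 x1 f1 f2 d c H1) as [z [Hz G]]; try lra.
      rewrite G, Rabs_mult, (Rabs_pos_eq (c - d)) by lra.
      pose proof (HK z ltac:(lra)). pose proof (Rabs_pos (f2 z)).
      apply Rmult_le_compat; unfold h; lra. }
  assert (Hh : 0 < h) by (unfold h; lra).
  set (s := (x - x0) / h).
  assert (Hs : 0 <= s <= 1).
  { unfold s, h. split; [apply Rdiv_le_0_compat; lra|apply Rle_div_l; lra]. }
  replace (f x) with (((1 - s) * f x0 + s * f x1) + (x - x0) * (f1 c - f1 d)).
  2:{ replace (f x1) with (f x0 + f1 d * h) by lra.
      replace (f x) with (f x0 + f1 c * (x - x0)) by lra.
      unfold s. field. lra. }
  eapply Rle_trans; [apply Rabs_triang|]. apply Rplus_le_compat.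
  - eapply Rle_trans; [apply Rabs_triang|]. rewrite !Rabs_mult.
    rewrite (Rabs_pos_eq (1 - s)), (Rabs_pos_eq s) by lra. nra.
  - rewrite Rabs_mult, (Rabs_pos_eq (x - x0)) by lra.
    replace (K * h ^ 2) with (h * (K * h)) by ring.
    apply Rmult_le_compat; try lra; [apply Rabs_pos|unfold h; lra].
Qed.

Definition clamp (a b x : R) : R := Rmax a (Rmin b x).

Lemma clamp_in a b x : a <= b -> a <= clamp a b x <= b.
Proof.
  intros H. unfold clamp. split; [apply Rmax_l|].
  apply Rmax_lub; [lra|apply Rmin_l].
Qed.

Lemma clamp_id a b x : a <= x <= b -> clamp a b x = x.
Proof. intros H. unfold clamp. rewrite Rmin_right, Rmax_right; lra. Qed.

Lemma clamp_lipschitz a b x y : Rabs (clamp a b x - clamp a b y) <= Rabs (x - y).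
Proof.
  unfold clamp, Rmax, Rmin.
  repeat (destruct (Rle_dec _ _); simpl); unfold Rabs;
    repeat (destruct (Rcase_abs _)); lra.
Qed.

Lemma continuous_on_rect_clamp a b T (F : R * R -> R) x t :
  a <= b -> 0 <= T -> continuous_on (rect a b T) F ->
  continuous (fun p : R * R => F (clamp a b (fst p), clamp 0 T (snd p))) (x, t).
Proof.
  intros Hab HT HF.
  apply filterlim_locally. intros eps.
  assert (Hin : rect a b T (clamp a b x, clamp 0 T t)) by (split; apply clamp_in; lra).
  pose proof (proj1 (filterlim_locally _ _) (HF _ Hin) eps) as [d Hd].
  exists d. intros [y s] [H1 H2]. simpl in *.
  apply Hd.
  - split; simpl.
    + change (Rabs (clamp a b y - clamp a b x) < d).
      eapply Rle_lt_trans; [apply clamp_lipschitz|exact H1].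
    + change (Rabs (clamp 0 T s - clamp 0 T t) < d).
      eapply Rle_lt_trans; [apply clamp_lipschitz|exact H2].
  - split; apply clamp_in; lra.
Qed.

Lemma is_derive_of_seg a b f x l : a < x < b -> is_derive_seg a b f x l -> is_derive f x l.
Proof.
  intros Hx H. apply is_derive_Reals. intros eps Heps.
  destruct (H eps Heps) as [d [Hd P]].
  assert (Hm : 0 < Rmin d (Rmin (x - a) (b - x))) by (repeat apply Rmin_glb_lt; lra).
  exists (mkposreal _ Hm). intros h Hh Hlt. simpl in Hlt.
  pose proof (Rmin_l d (Rmin (x - a) (b - x))).
  pose proof (Rmin_r d (Rmin (x - a) (b - x))).
  pose proof (Rmin_l (x - a) (b - x)). pose proof (Rmin_r (x - a) (b - x)).
  specialize (P (x + h)). simpl in P. unfold Rdist in P.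
  replace (x + h - x) with h in P by ring. apply P.
  assert (Hlt' : Rabs h < Rmin (x - a) (b - x)) by lra.
  apply Rabs_def2 in Hlt'. split; [|lra]. split; [lra|].
  intros E. apply Hh. lra.
Qed.

(** Finitely many neighbourhoods on which the clamped function varies by less
    than 1 cover the rectangle. *)
Lemma bounded_on_rect a b T (F : R * R -> R) :
  a <= b -> 0 <= T -> continuous_on (rect a b T) F ->
  exists K, forall p, rect a b T p -> Rabs (F p) <= K.
Proof.
  intros Hab HT HF.
  pose (F' := fun p : R * R => F (clamp a b (fst p), clamp 0 T (snd p))).
  assert (Hd : forall p : R * R, exists d : posreal, forall q,
    Rabs (fst q - fst p) < d -> Rabs (snd q - snd p) < d -> Rabs (F' q - F' p) < 1).
  { intros [x t].
    destruct (proj1 (filterlim_locally _ _)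
      (continuous_on_rect_clamp a b T F x t Hab HT HF) (mkposreal 1 Rlt_0_1)) as [d P].
    exists d. intros q H1 H2. apply (P q). split; assumption. }
  pose (del := fun p => proj1_sig (constructive_indefinite_description _ (Hd p))).
  pose proof (fun p => proj2_sig (constructive_indefinite_description _ (Hd p))) as Hdel.
  fold del in Hdel.
  pose proof (compactness_list 2 (a, (0, tt)) (b, (T, tt))
    (fun t => del (fst t, fst (snd t)))) as C.
  apply NNPP in C. destruct C as [l Hl].
  exists (fold_right (fun t m => Rmax (Rabs (F' (fst t, fst (snd t))) + 1) m) 0 l).
  intros [x t] Hp.
  destruct (Hl (x, (t, tt))) as [[x' [t' []]] [Hin [_ Hc]]].
  { unfold rect in Hp. simpl in *. tauto. }
  simpl in Hc.
  assert (B : Rabs (F' (x, t) - F' (x', t')) < 1) by (apply Hdel; simpl; tauto).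
  assert (E : F' (x, t) = F (x, t)).
  { unfold F', rect in *. simpl in *. rewrite !clamp_id; tauto. }
  rewrite <- E.
  apply Rle_trans with (Rabs (F' (x', t')) + 1).
  { replace (F' (x, t)) with (F' (x', t') + (F' (x, t) - F' (x', t'))) by ring.
    eapply Rle_trans; [apply Rabs_triang|]. lra. }
  clear - Hin. induction l as [|p l IH]; [destruct Hin|].
  simpl. destruct Hin as [->|Hin].
  - simpl. apply Rmax_l.
  - eapply Rle_trans; [apply IH, Hin|apply Rmax_r].
Qed.

(** * Difference residuals and the spline error *)

Lemma exists_argmax (f : nat -> R) n :
  exists j, (j <= n)%nat /\ forall i, (i <= n)%nat -> f i <= f j.
Proof.
  induction n as [|n [j [Hj IH]]].
  - exists 0%nat. split; [lia|]. intros i Hi. replace i with 0%nat by lia. lra.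
  - destruct (Rle_dec (f (S n)) (f j)) as [H|H].
    + exists j. split; [lia|]. intros i Hi.
      destruct (Nat.eq_dec i (S n)) as [->|]; [exact H|apply IH; lia].
    + exists (S n). split; [lia|]. intros i Hi.
      destruct (Nat.eq_dec i (S n)) as [->|]; [lra|].
      pose proof (IH i ltac:(lia)). lra.
Qed.

Lemma end_slope_bound y h M M' m : 0 < y -> 0 < h ->
  Rabs M <= m -> Rabs M' <= m -> Rabs (end_slope y h M M') <= h / 2 * m.
Proof.
  intros Hy Hh H H'. unfold end_slope.
  pose proof (lam_bounds y Hy). pose proof (theta_bounds y Hy).
  assert (Hm : 0 <= m) by (eapply Rle_trans; [apply Rabs_pos|exact H]).
  assert (B : Rabs ((1 / 2 - lam y) * M + lam y * M') <= m / 2).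
  { eapply Rle_trans; [apply Rabs_triang|]. rewrite !Rabs_mult.
    rewrite (Rabs_pos_eq (1 / 2 - lam y)), (Rabs_pos_eq (lam y)) by lra. nra. }
  assert (Q : 0 < h / theta y <= h).
  { split; [apply Rdiv_lt_0_compat; lra|]. apply Rle_div_l; nra. }
  rewrite Rabs_mult, (Rabs_pos_eq (h / theta y)) by lra.
  replace (h / 2 * m) with (h * (m / 2)) by field.
  apply Rmult_le_compat; try lra. apply Rabs_pos.
Qed.

(** A row of the system for the second derivatives that comes from the
    collocation equation at an end point.  The slope contributes at most
    |beta| h m / 2 <= alpha m / 2, half of the diagonal term. *)
Lemma end_row_bound alpha beta h m M s B V es :
  0 < alpha -> 0 < h -> Rabs beta * h <= alpha ->
  Rabs M = m -> Rabs es <= h / 2 * m -> Rabs s <= V ->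
  Rabs (alpha * M + beta * (s + es)) <= B ->
  m <= 2 / alpha * (B + Rabs beta * V).
Proof.
  intros Ha Hh Hb HM Hes Hs HB.
  assert (Hm : 0 <= m) by (rewrite <- HM; apply Rabs_pos).
  assert (P : alpha * m <= B + Rabs beta * V + Rabs beta * (h / 2 * m)).
  { rewrite <- HM at 1. rewrite <- (Rabs_pos_eq alpha) at 1 by lra.
    rewrite <- Rabs_mult.
    replace (alpha * M) with ((alpha * M + beta * (s + es)) - beta * (s + es)) by ring.
    unfold Rminus at 1. eapply Rle_trans; [apply Rabs_triang|]. rewrite Rabs_Ropp, Rabs_mult.
    pose proof (Rabs_triang s es). pose proof (Rabs_pos beta). nra. }
  assert (Q : alpha * m / 2 <= B + Rabs beta * V) by nra.
  apply (Rmult_le_reg_l (alpha / 2)); [lra|].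
  replace (alpha / 2 * (2 / alpha * (B + Rabs beta * V))) with (B + Rabs beta * V)
    by (field; lra). lra.
Qed.

(** Diagonal dominance, read off the row in which the second derivative is
    largest: an interior row is the relation P U'' = theta d2 U / h^2, where
    1 - 4 lam >= 1/3, and the end rows are the collocation equations. *)
Lemma spline_curvature_bound alpha beta rho a h n U U1 U2 W V B :
  0 < alpha -> 0 < rho -> 0 < h -> Rabs beta * h <= alpha ->
  tension_spline rho a h (S n) U U1 U2 ->
  let X j := a + INR j * h in
  (forall i, (i < n)%nat -> Rabs (dif2 (fun j => U (X j)) i / h ^ 2) <= W) ->
  (forall i, (i <= n)%nat -> Rabs ((U (X (S i)) - U (X i)) / h) <= V) ->
  Rabs (alpha * U2 (X 0%nat) + beta * U1 (X 0%nat)) <= B ->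
  Rabs (alpha * U2 (X (S n)) + beta * U1 (X (S n))) <= B ->
  0 <= W ->
  forall i, (i <= S n)%nat ->
  Rabs (U2 (X i)) <= 3 * (1 + (rho * h) ^ 2) * W + 2 / alpha * (B + Rabs beta * V).
Proof.
  intros Ha Hr Hh Hb HU X HW HV HB0 HBn HW0 i Hi.
  assert (Hy : 0 < rho * h) by nra.
  destruct (exists_argmax (fun i => Rabs (U2 (X i))) (S n)) as [j [Hj Hmax]].
  set (m := Rabs (U2 (X j))) in *.
  assert (Hm : 0 <= m) by apply Rabs_pos.
  eapply Rle_trans; [apply Hmax, Hi|]. fold m. clear i Hi.
  assert (P1 : 0 <= 3 * (1 + (rho * h) ^ 2) * W).
  { pose proof (pow2_ge_0 (rho * h)). nra. }
  assert (P2 : 0 <= 2 / alpha * (B + Rabs beta * V)).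
  { apply Rmult_le_pos; [apply Rdiv_le_0_compat; lra|].
    pose proof (Rabs_pos beta).
    pose proof (Rle_trans _ _ _ (Rabs_pos _) (HV 0%nat ltac:(lia))).
    pose proof (Rle_trans _ _ _ (Rabs_pos _) HB0). nra. }
  destruct (Nat.eq_dec j 0) as [->|Hj0]; [|destruct (Nat.eq_dec j (S n)) as [->|Hjn]].
  - destruct (tension_spline_slopes _ _ _ _ _ _ _ 0 Hr Hh HU ltac:(lia)) as [L _].
    fold (X 0%nat) (X 1%nat) in L. rewrite L in HB0.
    enough (m <= 2 / alpha * (B + Rabs beta * V)) by lra.
    eapply (end_row_bound alpha beta h m (U2 (X 0%nat))); try eassumption.
    + reflexivity.
    + rewrite Rabs_Ropp. apply end_slope_bound; auto; apply Hmax; lia.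
    + apply HV; lia.
  - destruct (tension_spline_slopes _ _ _ _ _ _ _ n Hr Hh HU ltac:(lia)) as [_ L].
    fold (X n) (X (S n)) in L. rewrite L in HBn.
    enough (m <= 2 / alpha * (B + Rabs beta * V)) by lra.
    eapply (end_row_bound alpha beta h m (U2 (X (S n)))); try eassumption.
    + reflexivity.
    + apply end_slope_bound; auto; apply Hmax; lia.
    + apply HV; lia.
  - destruct j as [|j]; [lia|].
    pose proof (proj1 (tension_spline_avg _ _ _ _ _ _ _ j Hr Hh HU ltac:(lia))
      : avg (lam (rho * h)) (fun j => U2 (X j)) j
        = theta (rho * h) * dif2 (fun j => U (X j)) j / h ^ 2) as E.
    pose proof (lam_bounds _ Hy) as HL. pose proof (theta_bounds _ Hy) as HT.
    set (l := lam (rho * h)) in *. set (t := theta (rho * h)) in *.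
    pose proof (HW j ltac:(lia)) as Hd.
    set (d := dif2 (fun j => U (X j)) j) in *.
    replace (t * d / h ^ 2) with (t * (d / h ^ 2)) in E by (field; lra).
    unfold avg in E. cbv beta in E.
    assert (P3 : (1 - 2 * l) * m <= t * W + 2 * l * m).
    { unfold m at 1. rewrite <- (Rabs_pos_eq (1 - 2 * l)) at 1 by lra.
      rewrite <- Rabs_mult.
      replace ((1 - 2 * l) * U2 (X (S j)))
        with (t * (d / h ^ 2) - l * (U2 (X j) + U2 (X (S (S j))))) by lra.
      unfold Rminus. eapply Rle_trans; [apply Rabs_triang|].
      rewrite Rabs_Ropp, !Rabs_mult, (Rabs_pos_eq t), (Rabs_pos_eq l) by lra.
      pose proof (Rabs_triang (U2 (X j)) (U2 (X (S (S j))))).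
      pose proof (Hmax j ltac:(lia)).
      pose proof (Hmax (S (S j)) ltac:(lia)). cbv beta in *.
      apply Rplus_le_compat; nra. }
    assert (m <= 3 * (t * W)) by nra.
    assert (t * W <= (1 + (rho * h) ^ 2) * W) by (apply Rmult_le_compat_r; lra). lra.
Qed.

(** The residual splits into the parts due to theta - 1 = O(y^2), to the mean of
    f'' and to the second difference. *)
Lemma curvature_residual a b f f1 f2 f3 f4 K x h y :
  seg_deriv a b f f1 -> seg_deriv a b f1 f2 -> seg_deriv a b f2 f3 ->
  seg_deriv a b f3 f4 ->
  (forall z, a <= z <= b -> Rabs (f2 z) <= K) ->
  (forall z, a <= z <= b -> Rabs (f4 z) <= K) ->
  0 < h -> 0 < y -> a <= x - h -> x + h <= b ->
  Rabs (f2 x + lam y * (f2 (x + h) - 2 * f2 x + f2 (x - h))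
        - theta y * (f (x + h) - 2 * f x + f (x - h)) / h ^ 2)
  <= (K * y ^ 2 + (K + 2 * (1 + y ^ 2) * K) * h ^ 2).
Proof.
  intros H H1 H2 H3 HK2 HK4 Hh Hy Ha Hb.
  pose proof (lam_bounds y Hy) as HL. pose proof (theta_bounds y Hy) as HT.
  pose proof (second_difference_bound a b f2 f3 f4 K x h H2 H3 HK4 ltac:(lra) Ha Hb) as P1.
  pose proof (second_difference_error a b f f1 f2 f3 f4 K x h H H1 H2 H3 HK4
                ltac:(lra) Ha Hb) as P2.
  set (d := f (x + h) - 2 * f x + f (x - h)) in *.
  set (d2 := f2 (x + h) - 2 * f2 x + f2 (x - h)) in *.
  set (l := lam y) in *. set (t := theta y) in *.
  assert (Hh2 : 0 < h ^ 2) by (apply pow_lt; lra).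
  replace (f2 x + l * d2 - t * d / h ^ 2)
    with (- ((t - 1) * f2 x) + (l * d2 + - (t * ((d - h ^ 2 * f2 x) / h ^ 2))))
    by (field; lra).
  assert (P3 : Rabs ((d - h ^ 2 * f2 x) / h ^ 2) <= 2 * K * h ^ 2).
  { unfold Rdiv. rewrite Rabs_mult, (Rabs_pos_eq (/ h ^ 2))
      by (left; apply Rinv_0_lt_compat, Hh2).
    apply Rle_div_l; [exact Hh2|]. replace (2 * K * h ^ 2 * h ^ 2) with (2 * K * h ^ 4) by ring.
    exact P2. }
  pose proof (HK2 x ltac:(lra)) as K2. pose proof (Rabs_pos (f2 x)).
  eapply Rle_trans; [apply Rabs_triang|].
  eapply Rle_trans; [apply Rplus_le_compat_l, Rabs_triang|].
  rewrite !Rabs_Ropp, !Rabs_mult.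
  rewrite (Rabs_pos_eq (t - 1)), (Rabs_pos_eq l), (Rabs_pos_eq t) by lra.
  assert (Q1 : (t - 1) * Rabs (f2 x) <= y ^ 2 * K) by (apply Rmult_le_compat; lra).
  pose proof (Rabs_pos d2). pose proof (Rabs_pos ((d - h ^ 2 * f2 x) / h ^ 2)).
  assert (Q2 : l * Rabs d2 <= 1 / 2 * (2 * K * h ^ 2)) by (apply Rmult_le_compat; lra).
  assert (Q3 : t * Rabs ((d - h ^ 2 * f2 x) / h ^ 2) <= (1 + y ^ 2) * (2 * K * h ^ 2))
    by (apply Rmult_le_compat; lra).
  lra.
Qed.

Lemma slope_residual a b f f1 f2 f3 K x h y :
  seg_deriv a b f f1 -> seg_deriv a b f1 f2 -> seg_deriv a b f2 f3 ->
  (forall z, a <= z <= b -> Rabs (f3 z) <= K) ->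
  0 < h -> 0 < y -> a <= x - h -> x + h <= b ->
  Rabs (f1 x + lam y * (f1 (x + h) - 2 * f1 x + f1 (x - h))
        - (f (x + h) - f (x - h)) / (2 * h)) <= 2 * K * h ^ 2.
Proof.
  intros H H1 H2 HK3 Hh Hy Ha Hb.
  pose proof (lam_bounds y Hy) as HL.
  pose proof (second_difference_bound a b f1 f2 f3 K x h H1 H2 HK3 ltac:(lra) Ha Hb) as P1.
  pose proof (central_difference_error a b f f1 f2 f3 K x h H H1 H2 HK3
                ltac:(lra) Ha Hb) as P2.
  set (d2 := f1 (x + h) - 2 * f1 x + f1 (x - h)) in *.
  set (d := f (x + h) - f (x - h) - 2 * h * f1 x) in *.
  replace (f1 x + lam y * d2 - (f (x + h) - f (x - h)) / (2 * h))
    with (lam y * d2 + - (d / (2 * h))) by (unfold d; field; lra).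
  eapply Rle_trans; [apply Rabs_triang|]. rewrite Rabs_Ropp.
  assert (P3 : Rabs (d / (2 * h)) <= K * h ^ 2).
  { unfold Rdiv. rewrite Rabs_mult, (Rabs_pos_eq (/ (2 * h)))
      by (left; apply Rinv_0_lt_compat; lra).
    apply Rle_div_l; [lra|]. replace (K * h ^ 2 * (2 * h)) with (2 * K * h ^ 3) by ring.
    exact P2. }
  rewrite Rabs_mult, (Rabs_pos_eq (lam y)) by lra.
  pose proof (Rabs_pos d2).
  assert (Q2 : lam y * Rabs d2 <= 1 / 2 * (2 * K * h ^ 2)) by (apply Rmult_le_compat; lra).
  lra.
Qed.

Lemma exists_cell a h n x : a <= x <= a + INR (S n) * h ->
  exists i, (i <= n)%nat /\ a + INR i * h <= x <= a + INR (S i) * h.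
Proof.
  induction n as [|n IH]; intros Hx.
  - exists 0%nat. split; [lia|]. simpl in *. lra.
  - destruct (Rle_dec x (a + INR (S n) * h)) as [H|H].
    + destruct (IH ltac:(lra)) as [i [Hi E]]. exists i. split; [lia|exact E].
    + exists (S n). split; [lia|]. lra.
Qed.

(** Second differences of U differ from those of v by at most 4 eps, so the
    second derivatives of U are O(1 + eps / h^2), and the interpolation error
    h^2 sup |v'' - U''| is O(h^2 + eps). *)
Lemma spline_sup_error alpha beta rho a b h n v v1 v2 U U1 U2 K eps B :
  0 < alpha -> 0 < rho -> 0 < h -> Rabs beta * h <= alpha -> b = a + INR (S n) * h ->
  seg_deriv a b v v1 -> seg_deriv a b v1 v2 ->
  (forall z, a <= z <= b -> Rabs (v1 z) <= K) ->
  (forall z, a <= z <= b -> Rabs (v2 z) <= K) ->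
  tension_spline rho a h (S n) U U1 U2 ->
  (forall i, (i <= S n)%nat -> Rabs (v (a + INR i * h) - U (a + INR i * h)) <= eps) ->
  Rabs (alpha * U2 a + beta * U1 a) <= B ->
  Rabs (alpha * U2 b + beta * U1 b) <= B ->
  forall x, a <= x <= b ->
  Rabs (v x - U x) <=
    (1 + 24 * (1 + (rho * h) ^ 2) + 8 / alpha * Rabs beta * h) * eps
    + (K + 12 * (1 + (rho * h) ^ 2) * K + 4 / alpha * (B + Rabs beta * K)) * h ^ 2.
Proof.
  intros Ha Hr Hh Hb Eb Hv Hv1 HK1 HK2 HU He HBa HBb x Hx.
  set (X j := a + INR j * h).
  assert (HX : forall j, (j <= S n)%nat -> a <= X j <= b).
  { intros j Hj. unfold X. pose proof (pos_INR j). apply le_INR in Hj. subst b. nra. }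
  assert (HXS : forall j, X (S j) = X j + h) by (intros j; unfold X; rewrite S_INR; ring).
  assert (Heps : 0 <= eps) by (eapply Rle_trans; [apply Rabs_pos|apply (He 0%nat); lia]).
  assert (HK : 0 <= K) by (eapply Rle_trans; [apply Rabs_pos|apply (HK1 x Hx)]).
  assert (Hh2 : 0 < h ^ 2) by (apply pow_lt; lra).
  assert (HM : forall i, (i <= S n)%nat -> Rabs (U2 (X i)) <=
    3 * (1 + (rho * h) ^ 2) * (2 * K + 4 * eps / h ^ 2)
    + 2 / alpha * (B + Rabs beta * (K + 2 * eps / h))).
  { apply (spline_curvature_bound alpha beta rho a h n U U1 U2); auto.
    - intros i Hi.
      change (Rabs ((U (X (S (S i))) - 2 * U (X (S i)) + U (X i)) / h ^ 2)
              <= 2 * K + 4 * eps / h ^ 2).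
      replace ((U (X (S (S i))) - 2 * U (X (S i)) + U (X i)) / h ^ 2) with
        (((v (X (S i) + h) - 2 * v (X (S i)) + v (X (S i) - h)) +
          ((- (v (X (S (S i))) - U (X (S (S i))))) +
           (2 * (v (X (S i)) - U (X (S i))) + - (v (X i) - U (X i))))) / h ^ 2).
      2:{ rewrite <- HXS. replace (X (S i) - h) with (X i) by (rewrite HXS; ring).
          f_equal. ring. }
      unfold Rdiv at 1. rewrite Rabs_mult, (Rabs_pos_eq (/ h ^ 2))
        by (left; apply Rinv_0_lt_compat, Hh2).
      apply Rle_div_l; [exact Hh2|].
      replace ((2 * K + 4 * eps / h ^ 2) * h ^ 2) with (2 * K * h ^ 2 + 4 * eps) by (field; lra).
      pose proof (second_difference_bound a b v v1 v2 K (X (S i)) h Hv Hv1 HK2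
        ltac:(lra)) as P.
      rewrite <- HXS in P. replace (X (S i) - h) with (X i) in P by (rewrite HXS; ring).
      specialize (P (proj1 (HX i ltac:(lia))) (proj2 (HX (S (S i)) ltac:(lia)))).
      rewrite <- HXS. replace (X (S i) - h) with (X i) by (rewrite HXS; ring).
      eapply Rle_trans; [apply Rabs_triang|]. apply Rplus_le_compat; [exact P|].
      eapply Rle_trans; [apply Rabs_triang|]. rewrite Rabs_Ropp.
      eapply Rle_trans; [apply Rplus_le_compat_l, Rabs_triang|].
      rewrite Rabs_Ropp, Rabs_mult, (Rabs_pos_eq 2) by lra.
      pose proof (He i ltac:(lia)) as E0. fold (X i) in E0.
      pose proof (He (S i) ltac:(lia)) as E1. fold (X (S i)) in E1.
      pose proof (He (S (S i)) ltac:(lia)) as E2. fold (X (S (S i))) in E2. lra.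
    - intros i Hi.
      change (Rabs ((U (X (S i)) - U (X i)) / h) <= K + 2 * eps / h).
      replace ((U (X (S i)) - U (X i)) / h) with
        (((v (X (S i)) - v (X i)) + (- (v (X (S i)) - U (X (S i))) + (v (X i) - U (X i)))) / h)
        by (f_equal; ring).
      unfold Rdiv at 1. rewrite Rabs_mult, (Rabs_pos_eq (/ h))
        by (left; apply Rinv_0_lt_compat, Hh).
      apply Rle_div_l; [exact Hh|].
      replace ((K + 2 * eps / h) * h) with (K * h + 2 * eps) by (field; lra).
      eapply Rle_trans; [apply Rabs_triang|]. apply Rplus_le_compat.
      + destruct (seg_mvt a b v v1 (X i) (X (S i)) Hv) as [z [Hz E]].
        * apply HX; lia.
        * rewrite HXS; lra.
        * apply HX; lia.
        * rewrite E, HXS. replace (X i + h - X i) with h by ring.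
          rewrite Rabs_mult, (Rabs_pos_eq h) by lra. apply Rmult_le_compat_r; [lra|].
          apply HK1. pose proof (HX i ltac:(lia)). pose proof (HX (S i) ltac:(lia)). lra.
      + eapply Rle_trans; [apply Rabs_triang|]. rewrite Rabs_Ropp.
        pose proof (He i ltac:(lia)) as E0. fold (X i) in E0.
        pose proof (He (S i) ltac:(lia)) as E1. fold (X (S i)) in E1. lra.
    - replace (a + INR 0 * h) with a by (simpl; ring). exact HBa.
    - rewrite <- Eb. exact HBb.
    - assert (0 <= 4 * eps / h ^ 2) by (apply Rdiv_le_0_compat; lra). lra. }
  destruct (exists_cell a h n x) as [i [Hi Hxi]]; [lra|].
  fold (X i) (X (S i)) in Hxi.
  set (m := 3 * (1 + (rho * h) ^ 2) * (2 * K + 4 * eps / h ^ 2)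
    + 2 / alpha * (B + Rabs beta * (K + 2 * eps / h))) in *.
  pose proof (HX i ltac:(lia)) as Hi0. pose proof (HX (S i) ltac:(lia)) as Hi1.
  pose proof (HXS i) as HS.
  pose proof (proj1 HU) as DU. pose proof (proj1 (proj2 HU)) as DU1.
  assert (P : Rabs (v x - U x) <= eps + (K + 2 * m) * (X (S i) - X i) ^ 2).
  { apply (interpolation_bound (X i) (X (S i)) (fun x => v x - U x)
      (fun x => v1 x - U1 x) (fun x => v2 x - U2 x)); try lra.
    - split.
      + intros z. apply @continuous_minus; [apply Hv|].
        apply (ex_derive_continuous U). exists (U1 z). apply DU.
      + intros z Hz. apply @is_derive_minus; [apply Hv; lra|apply DU].
    - split.
      + intros z. apply @continuous_minus; [apply Hv1|].
        apply (ex_derive_continuous U1). exists (U2 z). apply DU1.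
      + intros z Hz. apply @is_derive_minus; [apply Hv1; lra|apply DU1].
    - intros z Hz. unfold Rminus. eapply Rle_trans; [apply Rabs_triang|]. rewrite Rabs_Ropp.
      apply Rplus_le_compat; [apply HK2; lra|].
      eapply Rle_trans; [apply (tension_spline_second_bound rho a h (S n) U U1 U2 i z); auto; lia|].
      fold (X i) (X (S i)).
      pose proof (HM i ltac:(lia)). pose proof (HM (S i) ltac:(lia)). lra.
    - apply (He i). lia.
    - apply (He (S i)). lia. }
  eapply Rle_trans; [exact P|]. right. rewrite HS. unfold m. field. lra.
Qed.

(** * The Caputo derivative at the final time *)

(** Tags chosen by the mean value theorem make the Riemann sum telescope. *)
Lemma mvt_tagged_subdivision (f f1 : R -> R) d n a : 0 < d ->
  (forall x, a <= x <= a + INR n * d -> is_derive f x (f1 x)) ->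
  exists ptd : SF_seq, pointed_subdiv ptd /\ SF_h ptd = a /\
    seq.last (SF_h ptd) (SF_lx ptd) = a + INR n * d /\
    seq_step (SF_lx ptd) <= d /\
    Riemann_sum f1 ptd = f (a + INR n * d) - f a.
Proof.
  intros Hd. revert a. induction n as [|n IH]; intros a Hf.
  - exists (SF_nil a). split; [|split; [|split; [|split]]].
    + intros i Hi. unfold SF_size in Hi. simpl in Hi. lia.
    + reflexivity.
    + simpl. ring.
    + unfold seq_step. simpl. lra.
    + replace (a + INR 0 * d) with a by (simpl; ring). change (0 = f a - f a); ring.
  - rewrite S_INR in *. pose proof (pos_INR n).
    destruct (IH (a + d)) as (s & Hp & Hh & Hl & Hs & HR).
    { intros x Hx. apply Hf. nra. }
    destruct (mvt_interval f f1 a (a + d)) as [c [Hc E]]; [lra|intros; apply Hf; nra|].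
    replace (a + d + INR n * d) with (a + (INR n + 1) * d) in * by ring.
    exists (SF_cons (a, c) s). split; [|split; [|split; [|split]]].
    + intros i Hi. rewrite SF_size_cons in Hi.
      rewrite SF_lx_cons, SF_ly_cons. destruct i as [|i].
      * simpl. rewrite Hh. lra.
      * simpl. apply (Hp i). lia.
    + reflexivity.
    + simpl in Hl |- *. exact Hl.
    + unfold seq_step in Hs |- *. simpl in Hs |- *. rewrite Hh.
      apply Rmax_lub; [|rewrite Hh in Hs; exact Hs].
      rewrite Rabs_pos_eq; lra.
    + rewrite Riemann_sum_cons, HR. simpl. rewrite Hh.
      unfold plus, scal; simpl; unfold mult; simpl. lra.
Qed.

(** The fundamental theorem for a derivative that is integrable but need not be
    continuous, as is the case under a Caputo integral. *)
Lemma is_RInt_derive_eq (f f1 : R -> R) a b I : a < b ->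
  (forall x, a <= x <= b -> is_derive f x (f1 x)) -> is_RInt f1 a b I ->
  I = f b - f a.
Proof.
  intros Hab Hf HI. apply cond_eq. intros eps Heps.
  destruct (proj1 (filterlim_locally _ _) HI (mkposreal eps Heps)) as [d Hd].
  destruct (nfloor_ex ((b - a) / d)) as [n [_ Hn]].
  { apply Rdiv_le_0_compat; [lra|apply d]. }
  set (h := (b - a) / (INR n + 1)).
  pose proof (pos_INR n) as Hn0. pose proof (cond_pos d) as Hd0.
  assert (Hh : 0 < h) by (apply Rdiv_lt_0_compat; lra).
  assert (Eb : a + INR (S n) * h = b) by (rewrite S_INR; unfold h; field; lra).
  destruct (mvt_tagged_subdivision f f1 h (S n) a Hh) as (s & Hp & Ha & Hl & Hs & HR).
  { rewrite Eb. exact Hf. }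
  rewrite Eb in Hl, HR.
  assert (Hstep : seq_step (SF_lx s) < d).
  { eapply Rle_lt_trans; [exact Hs|]. unfold h.
    apply Rlt_div_l; [lra|]. apply Rlt_div_l in Hn; lra. }
  specialize (Hd s Hstep). rewrite Rmin_left, Rmax_right in Hd by lra.
  specialize (Hd (conj Hp (conj Ha Hl))).
  change (Rabs (sign (b - a) * Riemann_sum f1 s - I) < eps) in Hd.
  rewrite HR, sign_eq_1, Rmult_1_l in Hd by lra.
  rewrite Rabs_minus_sym. exact Hd.
Qed.

(** Cauchy's criterion at the right end point of an improper integral. *)
Lemma improper_RInt_cauchy (G : R -> R) T (I : R) : 0 < T ->
  is_RInt_gen G (at_right 0) (at_left T) I ->
  forall eps, 0 < eps -> exists c, 0 < c < T /\ forall b, c < b < T ->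
    exists y, is_RInt G c b y /\ Rabs y <= eps.
Proof.
  intros HT HG eps Heps.
  destruct (HG (fun y => Rabs (y - I) < eps / 2)) as [Q R [da HQ] [db HR] HP].
  { exists (mkposreal (eps / 2) ltac:(lra)). intros y Hy. exact Hy. }
  pose proof (cond_pos da). pose proof (cond_pos db).
  set (a := Rmin da T / 2).
  assert (Ha : 0 < a < Rmin da T).
  { assert (0 < Rmin da T) by (apply Rmin_glb_lt; lra). unfold a; lra. }
  pose proof (Rmin_l da T). pose proof (Rmin_r da T).
  assert (Qa : Q a).
  { apply HQ; [|lra]. change (Rabs (a - 0) < da). rewrite Rabs_pos_eq; lra. }
  assert (Rb : forall b, T - db < b < T -> R b).
  { intros b Hb. apply HR; [|lra]. change (Rabs (b - T) < db). rewrite Rabs_left; lra. }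
  exists ((Rmax a (T - db) + T) / 2).
  assert (HM : Rmax a (T - db) < T) by (apply Rmax_lub_lt; lra).
  pose proof (Rmax_l a (T - db)). pose proof (Rmax_r a (T - db)).
  split; [lra|]. intros b Hb. set (c := (Rmax a (T - db) + T) / 2) in *.
  assert (Hc : T - db < c < T) by (unfold c; lra).
  destruct (HP a c Qa (Rb c Hc)) as [yc [Ic Bc]]. simpl in Ic.
  destruct (HP a b Qa (Rb b ltac:(lra))) as [yb [Ib Bb]]. simpl in Ib.
  exists (yb - yc). split.
  - replace (yb - yc) with (plus (opp yc) yb) by (unfold plus, opp; simpl; ring).
    apply (is_RInt_Chasles _ _ a); [apply is_RInt_swap|]; assumption.
  - replace (yb - yc) with ((yb - I) - (yc - I)) by ring.
    unfold Rminus at 1. eapply Rle_trans; [apply Rabs_triang|]. rewrite Rabs_Ropp. lra.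
Qed.

Lemma is_derive_Rpower_rev p T s : s < T ->
  is_derive (fun s => Rpower (T - s) p) s (- (p * Rpower (T - s) (p - 1))).
Proof.
  intros Hs. evar_last.
  - apply (is_derive_comp (fun x => Rpower x p) (fun s => T - s)).
    + apply is_derive_Rpower. lra.
    + auto_derive; [exact I|reflexivity].
  - unfold scal; simpl; unfold mult; simpl. ring.
Qed.

Lemma Rpower_pred x p : 0 < x -> Rpower x (p - 1) = Rpower x p / x.
Proof.
  intros Hx. unfold Rminus. rewrite Rpower_plus, Rpower_Ropp, Rpower_1 by exact Hx.
  reflexivity.
Qed.

Lemma Rpower_pos x p : 0 < Rpower x p.
Proof. apply exp_pos. Qed.

Lemma Rpower_small p eps : 0 < p -> 0 < eps ->
  exists d, 0 < d /\ forall x, 0 < x <= d -> Rpower x p <= eps.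
Proof.
  intros Hp Heps. exists (Rpower eps (/ p)). split; [apply Rpower_pos|].
  intros x Hx. apply Rle_trans with (Rpower (Rpower eps (/ p)) p).
  - apply Rle_Rpower_l; lra.
  - rewrite Rpower_mult, Rinv_l, Rpower_1; lra.
Qed.

(** Let Phi be the integral from c to s, which is small, and
    q = (T - s)^(-mu) (f(s) - f(T)).  Integration by parts shows that p = q - Phi
    satisfies p' = mu q / (T - s), so W = (T - s)^mu p has derivative
    mu (T - s)^(mu - 1) Phi.  With |Phi| <= eps / 2 this makes
    W + (eps / 2) (T - s)^mu nonincreasing and W - (eps / 2) (T - s)^mu
    nondecreasing.  Both tend to 0 at T, which bounds W and then f - f(T). *)
Lemma fractional_little_o mu T (f : R -> R) (I : R) : 0 < mu -> 0 < T ->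
  (forall s, 0 < s < T -> ex_derive f s) ->
  (forall eta, 0 < eta -> exists d, 0 < d /\
     forall s, T - d < s < T -> Rabs (f s - f T) <= eta) ->
  is_RInt_gen (fun s => Rpower (T - s) (- mu) * Derive f s) (at_right 0) (at_left T) I ->
  forall eps, 0 < eps -> exists c, 0 < c < T /\
    forall s, c < s < T -> Rabs (f s - f T) <= eps * Rpower (T - s) mu.
Proof.
  intros Hmu HT Hf Hc HI eps Heps.
  destruct (improper_RInt_cauchy _ T I HT HI (eps / 2) ltac:(lra)) as [c [Hc0 HC]].
  exists c. split; [exact Hc0|].
  set (G := fun s => Rpower (T - s) (- mu) * Derive f s) in *.
  set (q := fun s => Rpower (T - s) (- mu) * (f s - f T)).
  set (k := fun s => mu * q s / (T - s)).
  set (Phi := fun s => RInt G c s).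
  assert (HPhi : forall b, c < b < T -> is_RInt G c b (Phi b) /\ Rabs (Phi b) <= eps / 2).
  { intros b Hb. destruct (HC b Hb) as [y [Hy By]].
    unfold Phi. rewrite (is_RInt_unique _ _ _ _ Hy). split; assumption. }
  assert (Hq : forall s, 0 < s < T -> is_derive q s (G s + k s)).
  { intros s Hs. evar_last.
    - apply (is_derive_mult (fun s => Rpower (T - s) (- mu)) (fun s => f s - f T)).
      + apply is_derive_Rpower_rev. lra.
      + apply @is_derive_minus; [apply Derive_correct, Hf; lra|].
        apply @is_derive_const.
      + intros; apply Rmult_comm.
    - unfold G, k, q. rewrite Rpower_pred by lra.
      unfold plus, mult, minus, opp, zero; simpl.
      unfold plus, mult, opp, zero; simpl. field. lra. }
  assert (Hk : forall s, 0 < s < T -> continuous k s).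
  { intros s Hs. apply (continuous_ext (fun s => mu * (q s * / (T - s)))).
    { intros x. unfold k, Rdiv. symmetry. apply Rmult_assoc. }
    apply (continuous_scal_r (K := R_AbsRing) (V := R_NormedModule) mu (fun s => q s * / (T - s))).
    apply (continuous_mult (K := R_AbsRing) q (fun s => / (T - s))).
    - apply (ex_derive_continuous q). eexists. apply Hq. lra.
    - apply (ex_derive_continuous (fun s => / (T - s))). auto_derive. lra. }
  set (p := fun s => q c + RInt k c s).
  assert (Hkint : forall b, c < b < T -> is_RInt k c b (RInt k c b)).
  { intros b Hb. apply (RInt_correct (V := R_CompleteNormedModule)).
    apply (ex_RInt_continuous (V := R_CompleteNormedModule)).
    intros z. rewrite Rmin_left, Rmax_right by lra. intros Hz. apply Hk. lra. }
  (* integration by parts, for a derivative that is only integrable *)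
  assert (Hqp : forall s, c < s < T -> q s - Phi s = p s).
  { intros s Hs. destruct (HPhi s Hs) as [H1 _].
    pose proof (is_RInt_plus _ _ _ _ _ _ H1 (Hkint s Hs)) as H2.
    apply (is_RInt_derive_eq q) in H2; [|lra|intros x Hx; apply Hq; lra].
    unfold plus in H2; simpl in H2. unfold p. lra. }
  assert (Hp : forall s, c < s < T -> is_derive p s (k s)).
  { intros s Hs. unfold p. evar_last.
    - apply @is_derive_plus; [apply @is_derive_const|].
      apply (is_derive_RInt k _ c).
      + exists (mkposreal (Rmin (s - c) (T - s)) ltac:(apply Rmin_glb_lt; lra)).
        intros b Hb. change (Rabs (b - s) < Rmin (s - c) (T - s)) in Hb.
        pose proof (Rmin_l (s - c) (T - s)). pose proof (Rmin_r (s - c) (T - s)).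
        apply Rabs_def2 in Hb. apply Hkint. lra.
      + apply Hk. lra.
    - apply plus_zero_l. }
  assert (Hone : forall sg, Rabs sg = 1 -> forall s, c < s < T ->
    0 <= sg * (Rpower (T - s) mu * p s) + eps / 2 * Rpower (T - s) mu).
  { intros sg Hsg s Hs.
    set (V := fun s => sg * (Rpower (T - s) mu * p s) + eps / 2 * Rpower (T - s) mu).
    set (dV := fun s => mu * Rpower (T - s) (mu - 1) * (sg * Phi s - eps / 2)).
    assert (HV : forall s, c < s < T -> is_derive V s (dV s)).
    { clear s Hs. intros s Hs. unfold V. evar_last.
      - apply @is_derive_plus.
        + apply is_derive_scal.
          apply (is_derive_mult (fun s => Rpower (T - s) mu) p).
          * apply is_derive_Rpower_rev. lra.
          * apply Hp. lra.
          * intros; apply Rmult_comm.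
        + apply is_derive_scal. apply is_derive_Rpower_rev. lra.
      - unfold plus, mult, dV; simpl. unfold k.
        replace (q s) with (p s + Phi s) by (rewrite <- Hqp by lra; ring).
        rewrite Rpower_pred by lra. unfold mult; simpl. field. lra. }
    apply Rnot_lt_le. intros Hneg. fold (V s) in Hneg.
    destruct (Hc (- V s / 4) ltac:(lra)) as [d [Hd Hcd]].
    destruct (Rpower_small mu (- V s / 4 / (eps / 2)) Hmu) as [d' [Hd' Hsm]].
    { apply Rdiv_lt_0_compat; lra. }
    set (s' := T - Rmin (Rmin d d') (T - s) / 2).
    assert (P : 0 < Rmin (Rmin d d') (T - s)) by (repeat apply Rmin_glb_lt; lra).
    pose proof (Rmin_l (Rmin d d') (T - s)). pose proof (Rmin_r (Rmin d d') (T - s)).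
    pose proof (Rmin_l d d'). pose proof (Rmin_r d d').
    assert (Hs' : s < s' < T) by (unfold s'; lra).
    specialize (Hcd s' ltac:(unfold s'; lra)).
    specialize (Hsm (T - s') ltac:(unfold s'; lra)).
    assert (Hdec : V s' <= V s).
    { destruct (mvt_interval V dV s s') as [z [Hz E]]; [lra|intros; apply HV; lra|].
      assert (dV z <= 0).
      { unfold dV. destruct (HPhi z ltac:(lra)) as [_ B].
        assert (sg * Phi z <= eps / 2).
        { eapply Rle_trans; [apply Rle_abs|]. rewrite Rabs_mult, Hsg. lra. }
        pose proof (Rpower_pos (T - z) (mu - 1)).
        assert (0 <= mu * Rpower (T - z) (mu - 1)) by nra. nra. }
      nra. }
    assert (Eq : Rpower (T - s') mu * p s' = (f s' - f T) - Rpower (T - s') mu * Phi s').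
    { rewrite <- Hqp by lra. unfold q. rewrite Rpower_Ropp. field.
      apply Rgt_not_eq, Rpower_pos. }
    unfold V at 1 in Hdec. rewrite Eq in Hdec.
    destruct (HPhi s' ltac:(lra)) as [_ B].
    pose proof (Rpower_pos (T - s') mu) as Pp.
    assert (S1 : - (sg * (f s' - f T)) <= - V s / 4).
    { eapply Rle_trans; [apply Rle_abs|]. rewrite Rabs_Ropp, Rabs_mult, Hsg. lra. }
    assert (S2 : sg * (Rpower (T - s') mu * Phi s') <= Rpower (T - s') mu * (eps / 2)).
    { eapply Rle_trans; [apply Rle_abs|].
      rewrite !Rabs_mult, Hsg, (Rabs_pos_eq (Rpower _ _)) by lra.
      rewrite Rmult_1_l. apply Rmult_le_compat_l; lra. }
    lra. }
  intros s Hs.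
  pose proof (Hone 1 ltac:(apply Rabs_R1) s Hs) as H1.
  pose proof (Hone (-1) ltac:(rewrite Rabs_left; lra) s Hs) as H2.
  destruct (HPhi s Hs) as [_ B]. apply Rabs_le_between in B.
  pose proof (Rpower_pos (T - s) mu) as Pp.
  assert (Eq : f s - f T = Rpower (T - s) mu * p s + Rpower (T - s) mu * Phi s).
  { rewrite <- Hqp by lra. unfold q. rewrite Rpower_Ropp. field.
    apply Rgt_not_eq, Pp. }
  rewrite Eq. apply Rabs_le_between. nra.
Qed.

Lemma l1_weight_le_1 mu k : 0 < mu <= 1 -> l1_weight mu k <= 1.
Proof.
  intros Hmu. induction k as [|k IH]; [simpl; lra|].
  pose proof (l1_weight_decr mu k Hmu). lra.
Qed.

Lemma l1_sum_increment mu v n :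
  let y k := v (n + 2)%nat - v (n + 2 - k)%nat in
  l1_sum mu v (S n) - l1_sum mu v n
  = y 1%nat - sum_f_R0 (fun j => (l1_weight mu j - l1_weight mu (S j))
                                 * (y (j + 2)%nat - y (j + 1)%nat)) n.
Proof.
  intros y. unfold l1_sum. rewrite (decomp_sum _ (S n)) by lia.
  replace (pred (S n)) with n by reflexivity. cbv beta.
  replace (l1_weight mu 0 * (v (S n - 0 + 1)%nat - v (S n - 0)%nat)) with (y 1%nat).
  2:{ unfold y. simpl l1_weight. rewrite Rmult_1_l.
      replace (S n - 0 + 1)%nat with (n + 2)%nat by lia.
      replace (S n - 0)%nat with (n + 2 - 1)%nat by lia. reflexivity. }
  match goal with |- _ + ?b - ?a = _ - ?c => enough (E : b + c = a); [rewrite <- E; ring|] end.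
  rewrite <- sum_plus. apply sum_eq. intros i Hi.
  replace (S n - S i + 1)%nat with (n - i + 1)%nat by lia.
  replace (S n - S i)%nat with (n - i)%nat by lia.
  unfold y. replace (n + 2 - (i + 2))%nat with (n - i)%nat by lia.
  replace (n + 2 - (i + 1))%nat with (n - i + 1)%nat by lia. ring.
Qed.

(** The increment is a sum of (w_j - w_(j+1)) (y_(j+2) - y_(j+1)).  After Abel
    summation the factors of y are second differences of the weights, which are
    nonnegative from index 1 on by convexity; against the bound delta k they sum
    up, by a second Abel summation, to a multiple of delta that does not depend
    on n. *)
Lemma l1_sum_increment_bound mu v n delta : 0 < mu <= 1 -> (1 <= n)%nat ->
  (forall k, (k <= n + 2)%nat ->
     Rabs (v (n + 2)%nat - v (n + 2 - k)%nat) <= delta * INR k) ->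
  Rabs (l1_sum mu v (S n) - l1_sum mu v n) <= 10 * delta.
Proof.
  intros Hmu Hn Hy. rewrite l1_sum_increment.
  set (y k := v (n + 2)%nat - v (n + 2 - k)%nat) in *.
  set (w := l1_weight mu). set (c j := w j - w (S j)).
  assert (Hd : 0 <= delta).
  { pose proof (Rle_trans _ _ _ (Rabs_pos _) (Hy 1%nat ltac:(lia))) as P.
    simpl in P. lra. }
  assert (Hw : forall j, 0 <= w j <= 1)
    by (intros j; split; [apply l1_weight_nonneg|apply l1_weight_le_1]; exact Hmu).
  assert (Hc : forall j, 0 <= c j <= 1).
  { intros j. pose proof (l1_weight_decr mu j Hmu). pose proof (Hw j).
    pose proof (Hw (S j)). unfold c, w in *. lra. }
  assert (Hcc : forall j, c (S (S j)) <= c (S j))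
    by (intros j; apply l1_weight_convex, Hmu).
  assert (P : forall m, (S m <= n)%nat ->
    Rabs (sum_f_R0 (fun j => c j * (y (j + 2)%nat - y (j + 1)%nat)) (S m)
          - c (S m) * y (S m + 2)%nat)
    <= delta * (5 + 2 * c 1%nat + w 1%nat - w (S m) - (INR m + 2) * c (S m))).
  { induction m as [|m IH]; intros Hm.
    - simpl sum_f_R0. simpl Nat.add.
      replace (c 0%nat * (y 2%nat - y 1%nat) + c 1%nat * (y 3%nat - y 2%nat) - c 1%nat * y 3%nat)
        with (c 0%nat * (y 2%nat - y 1%nat) - c 1%nat * y 2%nat) by ring.
      replace (delta * (5 + 2 * c 1%nat + w 1%nat - w 1%nat - (INR 0 + 2) * c 1%nat))
        with (5 * delta) by (simpl; ring).
      pose proof (Hy 1%nat ltac:(lia)) as Y1. pose proof (Hy 2%nat ltac:(lia)) as Y2.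
      fold (y 1%nat) in Y1. fold (y 2%nat) in Y2. simpl in Y1, Y2.
      apply Rabs_le_between in Y1. apply Rabs_le_between in Y2.
      pose proof (Hc 0%nat). pose proof (Hc 1%nat).
      set (y1 := y 1%nat) in *. set (y2 := y 2%nat) in *.
      assert (- (3 * delta) <= c 0%nat * (y2 - y1) <= 3 * delta) by nra.
      assert (- (2 * delta) <= c 1%nat * y2 <= 2 * delta) by nra.
      apply Rabs_le_between. lra.
    - specialize (IH ltac:(lia)). rewrite tech5, S_INR.
      replace (S (S m) + 1)%nat with (S m + 2)%nat by lia.
      set (s := sum_f_R0 (fun j => c j * (y (j + 2)%nat - y (j + 1)%nat)) (S m)) in *.
      replace (s + c (S (S m)) * (y (S (S m) + 2)%nat - y (S m + 2)%nat)
               - c (S (S m)) * y (S (S m) + 2)%nat)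
        with ((s - c (S m) * y (S m + 2)%nat) + (c (S m) - c (S (S m))) * y (S m + 2)%nat)
        by ring.
      eapply Rle_trans; [apply Rabs_triang|]. rewrite Rabs_mult.
      rewrite (Rabs_pos_eq (c (S m) - c (S (S m)))) by (pose proof (Hcc m); lra).
      assert (Ym : Rabs (y (S m + 2)%nat) <= delta * (INR m + 3)).
      { pose proof (Hy (S m + 2)%nat ltac:(lia)) as Q. change (Rabs (y (S m + 2)%nat) <= delta * INR (S m + 2)) in Q.
        rewrite plus_INR, S_INR in Q. change (INR 2) with 2 in Q. lra. }
      assert (Q : (c (S m) - c (S (S m))) * Rabs (y (S m + 2)%nat)
                  <= (c (S m) - c (S (S m))) * (delta * (INR m + 3)))
        by (apply Rmult_le_compat_l; [pose proof (Hcc m); lra|exact Ym]).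
      assert (E : w (S (S m)) = w (S m) - c (S m)) by (unfold c; ring).
      rewrite E. lra. }
  destruct n as [|m]; [lia|]. specialize (P m ltac:(lia)).
  set (s := sum_f_R0 _ (S m)) in P.
  change (Rabs (y 1%nat - s) <= 10 * delta).
  assert (Ym : Rabs (y (S m + 2)%nat) <= delta * (INR m + 3)).
  { pose proof (Hy (S m + 2)%nat ltac:(lia)) as Q. change (Rabs (y (S m + 2)%nat) <= delta * INR (S m + 2)) in Q.
    rewrite plus_INR, S_INR in Q. change (INR 2) with 2 in Q. lra. }
  pose proof (Hy 1%nat ltac:(lia)) as Y1.
  change (Rabs (y 1%nat) <= delta * 1) in Y1.
  assert (Q : Rabs s <= 9 * delta).
  { replace s with ((s - c (S m) * y (S m + 2)%nat) + c (S m) * y (S m + 2)%nat) by ring.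
    eapply Rle_trans; [apply Rabs_triang|]. rewrite Rabs_mult.
    rewrite (Rabs_pos_eq (c (S m))) by (apply Hc).
    assert (c (S m) * Rabs (y (S m + 2)%nat) <= c (S m) * (delta * (INR m + 3)))
      by (apply Rmult_le_compat_l; [apply Hc|exact Ym]).
    pose proof (Hc 1%nat). pose proof (Hc (S m)). pose proof (Hw 1%nat).
    pose proof (Hw (S m)).
    assert (delta * (5 + 2 * c 1%nat + w 1%nat - w (S m) + c (S m)) <= delta * 9)
      by (apply Rmult_le_compat_l; lra). lra. }
  unfold Rminus. eapply Rle_trans; [apply Rabs_triang|]. rewrite Rabs_Ropp. lra.
Qed.

Definition left_continuous (f : R -> R) (T : R) : Prop :=
  forall eta, 0 < eta -> exists d, 0 < d /\
    forall s, T - d < s < T -> Rabs (f s - f T) <= eta.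

Lemma node_t_final T N : (0 < N)%nat -> node_t T N N = T.
Proof.
  intros HN. unfold node_t, step_t. pose proof (lt_0_INR N HN). field. lra.
Qed.

(** The L1 quotients at T and at the level before T approximate D and the values
    of g, respectively.  Their difference is h^(-mu) times an increment of L1
    sums.  Since |f(T) - f(T - s)| <= eps s^mu near T and is bounded elsewhere,
    |f(T) - f(T - k h)| <= (eps h^mu + C h) k, so that difference is at most a
    constant times eps + C h^(1 - mu).  Thus D = g(T) in the limit. *)
Lemma caputo_final_fractional mu T f g D K M (I : R) :
  0 < mu < 1 -> 0 < T -> 0 < GammaR (2 - mu) ->
  (forall s, 0 < s < T -> ex_derive f s) -> left_continuous f T ->
  is_RInt_gen (fun s => Rpower (T - s) (- mu) * Derive f s) (at_right 0) (at_left T) I ->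
  (forall s, 0 <= s <= T -> Rabs (f s) <= M) ->
  left_continuous g T -> 0 <= K ->
  (forall N n, (n + 1 < N)%nat ->
     Rabs (g (node_t T N (n + 1)) - Rpower (step_t T N) (- mu) / GammaR (2 - mu)
            * l1_sum mu (fun k => f (node_t T N k)) n) <= K * Rpower (step_t T N) (2 - mu)) ->
  (forall n, Rabs (D - Rpower (step_t T (S n)) (- mu) / GammaR (2 - mu)
            * l1_sum mu (fun k => f (node_t T (S n) k)) n)
     <= K * Rpower (step_t T (S n)) (2 - mu)) ->
  D = g T.
Proof.
  intros Hmu HT HG Hf Hfc HI HM Hgc HK Hg HD.
  assert (HM0 : 0 <= M) by (eapply Rle_trans; [apply Rabs_pos|apply (HM 0); lra]).
  apply cond_eq. intros eta0 Heta0. set (eta := eta0 / 2).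
  assert (Heta : 0 < eta) by (unfold eta; lra).
  enough (Rabs (D - g T) <= eta) by (unfold eta in *; lra).
  set (Gam := GammaR (2 - mu)) in *.
  (* The increment bound 10 delta, scaled by h^(-mu) / Gam, turns this eps into
     eta / 4. *)
  set (eps := eta * Gam / 40).
  destruct (fractional_little_o mu T f I ltac:(lra) HT Hf Hfc HI eps) as [c [Hc Ho]].
  { unfold eps. apply Rdiv_lt_0_compat; [nra|lra]. }
  set (C := 2 * M / (T - c)).
  assert (HC : 0 <= C) by (apply Rdiv_le_0_compat; lra).
  destruct (Rpower_small (1 - mu) (eta / 4 / (10 * C / Gam + 1)) ltac:(lra))
    as [d1 [Hd1 S1]].
  { apply Rdiv_lt_0_compat; [lra|].
    assert (0 <= 10 * C / Gam) by (apply Rdiv_le_0_compat; lra). lra. }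
  destruct (Rpower_small (2 - mu) (eta / 4 / (2 * K + 1)) ltac:(lra)) as [d2 [Hd2 S2]].
  { apply Rdiv_lt_0_compat; lra. }
  destruct (Hgc (eta / 4) ltac:(lra)) as [d3 [Hd3 S3]].
  set (d := Rmin d1 (Rmin d2 d3)).
  assert (Hd : 0 < d) by (repeat apply Rmin_glb_lt; lra).
  destruct (nfloor_ex (T / d)) as [n0 [_ Hn0]].
  { apply Rdiv_le_0_compat; lra. }
  set (n := S n0). set (N := S (S n)).
  assert (HN : 0 < INR N) by (apply lt_0_INR; unfold N; lia).
  set (h := step_t T N).
  assert (Hh : 0 < h < d).
  { unfold h, step_t. split; [apply Rdiv_lt_0_compat; lra|].
    apply Rlt_div_l; [exact HN|].
    apply Rlt_div_l in Hn0; [|exact Hd].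
    assert (INR n0 + 1 <= INR N) by (rewrite <- S_INR; apply le_INR; unfold N, n; lia).
    nra. }
  pose proof (Rmin_l d1 (Rmin d2 d3)). pose proof (Rmin_r d1 (Rmin d2 d3)).
  pose proof (Rmin_l d2 d3). pose proof (Rmin_r d2 d3). fold d in H, H0.
  set (v k := f (node_t T N k)).
  assert (HNT : node_t T N N = T) by (apply node_t_final; unfold N; lia).
  assert (HNh : INR N * h = T) by exact HNT.
  assert (Hnode : forall k, (k <= N)%nat -> node_t T N (N - k) = T - INR k * h).
  { intros k Hk. unfold node_t. fold h.
    rewrite minus_INR, Rmult_minus_distr_r, HNh by exact Hk. reflexivity. }
  assert (Hp : Rpower h mu * Rpower h (- mu) = 1).
  { rewrite Rpower_Ropp. field. apply Rgt_not_eq, Rpower_pos. }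
  set (delta := eps * Rpower h mu + C * h).
  assert (Hy : forall k, (k <= n + 2)%nat ->
     Rabs (v (n + 2)%nat - v (n + 2 - k)%nat) <= delta * INR k).
  { intros k Hk. replace (n + 2)%nat with N in Hk |- * by (unfold N; lia).
    unfold v. rewrite Hnode by exact Hk. rewrite HNT.
    destruct k as [|k].
    { simpl. rewrite Rmult_0_l, !Rminus_0_r, Rminus_diag, Rabs_R0. lra. }
    assert (Hk1 : 1 <= INR (S k)) by (rewrite S_INR; pose proof (pos_INR k); lra).
    assert (HkT : INR (S k) * h <= T).
    { apply le_INR in Hk. rewrite <- HNh.
      apply Rmult_le_compat_r; lra. }
    pose proof (Rpower_pos h mu) as Ph.
    destruct (Rlt_dec (INR (S k) * h) (T - c)) as [Hlt|Hge].
    - rewrite Rabs_minus_sym.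
      eapply Rle_trans; [apply Ho; split; nra|].
      replace (T - (T - INR (S k) * h)) with (INR (S k) * h) by ring.
      rewrite <- Rpower_mult_distr by lra.
      assert (Rpower (INR (S k)) mu <= INR (S k)).
      { rewrite <- (Rpower_1 (INR (S k))) at 2 by lra. apply Rle_Rpower; lra. }
      assert (He : 0 < eps * Rpower h mu).
      { apply Rmult_lt_0_compat; [|exact Ph]. unfold eps.
        apply Rdiv_lt_0_compat; [nra|lra]. }
      replace (eps * (Rpower (INR (S k)) mu * Rpower h mu))
        with ((eps * Rpower h mu) * Rpower (INR (S k)) mu) by ring.
      apply Rmult_le_compat; try lra; [left; apply Rpower_pos|].
      unfold delta. assert (0 <= C * h) by nra. lra.
    - assert (B1 := HM T ltac:(lra)).
      assert (B2 := HM (T - INR (S k) * h) ltac:(split; nra)).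
      apply Rle_trans with (2 * M).
      { unfold Rminus at 1. eapply Rle_trans; [apply Rabs_triang|]. rewrite Rabs_Ropp. lra. }
      replace (2 * M) with (C * (T - c)) by (unfold C; field; lra).
      unfold delta. assert (0 < eps * Rpower h mu).
      { apply Rmult_lt_0_compat; [|exact Ph]. unfold eps.
        apply Rdiv_lt_0_compat; [nra|lra]. }
      assert (C * (T - c) <= C * (INR (S k) * h)) by (apply Rmult_le_compat_l; lra).
      nra. }
  pose proof (l1_sum_increment_bound mu v n delta ltac:(lra) ltac:(unfold n; lia) Hy) as HI'.
  pose proof (HD (S n)) as E1. fold N h v Gam in E1.
  pose proof (Hg N n ltac:(unfold N; lia)) as E2. fold h v Gam in E2.
  assert (Et : node_t T N (n + 1) = T - h).
  { replace (n + 1)%nat with (N - 1)%nat by (unfold N; lia).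
    rewrite Hnode by (unfold N; lia). simpl. ring. }
  rewrite Et in E2.
  specialize (S3 (T - h) ltac:(lra)).
  specialize (S1 h ltac:(lra)). specialize (S2 h ltac:(lra)).
  set (b := Rpower h (- mu) / Gam) in *.
  assert (Hb : 0 < b) by (apply Rdiv_lt_0_compat; [apply Rpower_pos|exact HG]).
  assert (B1 : b * (10 * delta) <= eta / 4 + eta / 4).
  { replace (b * (10 * delta)) with (eta / 4 * (Rpower h mu * Rpower h (- mu))
      + 10 * C / Gam * (h * Rpower h (- mu))).
    2:{ unfold b, delta, eps. field. lra. }
    rewrite Hp.
    assert (Eh : h * Rpower h (- mu) = Rpower h (1 - mu)).
    { unfold Rminus. rewrite Rpower_plus, Rpower_1; lra. }
    rewrite Eh. pose proof (Rpower_pos h (1 - mu)).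
    assert (Q : 0 <= 10 * C / Gam) by (apply Rdiv_le_0_compat; lra).
    apply Rle_div_r in S1; [|lra]. nra. }
  assert (B2 : K * Rpower h (2 - mu) + K * Rpower h (2 - mu) <= eta / 4).
  { apply Rle_div_r in S2; [|lra]. pose proof (Rpower_pos h (2 - mu)). nra. }
  assert (B3 : b * Rabs (l1_sum mu v (S n) - l1_sum mu v n) <= b * (10 * delta))
    by (apply Rmult_le_compat_l; lra).
  replace (D - g T) with ((D - b * l1_sum mu v (S n))
    + (- (g (T - h) - b * l1_sum mu v n))
    + b * (l1_sum mu v (S n) - l1_sum mu v n) + (g (T - h) - g T)) by ring.
  eapply Rle_trans; [apply Rabs_triang|].
  eapply Rle_trans; [apply Rplus_le_compat_r, Rabs_triang|].
  eapply Rle_trans; [apply Rplus_le_compat_r, Rplus_le_compat_r, Rabs_triang|].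
  rewrite Rabs_Ropp, Rabs_mult, (Rabs_pos_eq b) by lra. lra.
Qed.

(** A derivative with a one-sided limit takes this limit as its value. *)
Lemma caputo_final_classical T f g D : 0 < T ->
  (forall s, 0 < s < T -> is_derive_seg 0 T f s (g s)) ->
  is_derive_seg 0 T f T D -> left_continuous g T -> D = g T.
Proof.
  intros HT Hf HD Hg.
  assert (Hder : forall s, 0 < s < T -> is_derive f s (g s))
    by (intros s Hs; apply (is_derive_of_seg 0 T); auto).
  assert (HDq : forall eta, 0 < eta -> exists d, 0 < d /\
     forall s, T - d < s < T -> 0 < s -> Rabs ((f s - f T) - D * (s - T)) <= eta * (T - s)).
  { intros eta Heta. destruct (HD eta Heta) as [d [Hd P]]. exists d.
    split; [exact Hd|]. intros s Hs Hs0.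
    assert (Q : Rabs ((f s - f T) / (s - T) - D) < eta).
    { apply P. split; [split; [lra|apply Rgt_not_eq; lra]|].
      simpl. unfold Rdist. rewrite Rabs_left; lra. }
    replace (f s - f T - D * (s - T)) with (((f s - f T) / (s - T) - D) * (s - T))
      by (field; lra).
    rewrite Rabs_mult, (Rabs_left (s - T)) by lra.
    replace (- (s - T)) with (T - s) by ring. apply Rmult_le_compat_r; lra. }
  apply cond_eq. intros eta0 Heta0. set (eta := eta0 / 4).
  assert (Heta : 0 < eta) by (unfold eta; lra).
  enough (Rabs (D - g T) <= 3 * eta) by (unfold eta in *; lra).
  destruct (HDq eta Heta) as [d [Hd P]].
  destruct (Hg eta Heta) as [d' [Hd' P']].
  set (m := Rmin (Rmin d d') T).
  assert (Hm : 0 < m) by (repeat apply Rmin_glb_lt; lra).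
  pose proof (Rmin_l (Rmin d d') T). pose proof (Rmin_r (Rmin d d') T).
  pose proof (Rmin_l d d'). pose proof (Rmin_r d d'). fold m in H, H0.
  set (s := T - m / 2).
  (* The quotients from T are close to D at s and at s', hence so is the slope of
     the chord between them, because s' - s is comparable with T - s. *)
  set (s' := T - m / 6).
  assert (Hs : 0 < s < T /\ 0 < s' < T /\ s < s' /\ T - d < s /\ T - d' < s)
    by (unfold s, s'; lra).
  destruct (mvt_interval f g s s') as [z [Hz E]]; [lra|intros; apply Hder; lra|].
  pose proof (P s ltac:(lra) ltac:(lra)) as Q1. pose proof (P s' ltac:(lra) ltac:(lra)) as Q2.
  pose proof (P' z ltac:(lra)) as Q3.
  replace (D - g T) with ((D - g z) + (g z - g T)) by ring.
  eapply Rle_trans; [apply Rabs_triang|].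
  enough (Rabs (D - g z) <= 2 * eta) by lra.
  apply (Rmult_le_reg_l (s' - s)); [lra|].
  rewrite <- (Rabs_pos_eq (s' - s)) at 1 by lra. rewrite <- Rabs_mult.
  replace ((s' - s) * (D - g z)) with
    ((f s - f T - D * (s - T)) - (f s' - f T - D * (s' - T))).
  2:{ replace (f s') with (f s + g z * (s' - s)) by lra. ring. }
  unfold Rminus at 1. eapply Rle_trans; [apply Rabs_triang|]. rewrite Rabs_Ropp.
  replace (s' - s) with (m / 3) by (unfold s, s'; field).
  replace (T - s) with (m / 2) in Q1 by (unfold s; ring).
  replace (T - s') with (m / 6) in Q2 by (unfold s'; ring). lra.
Qed.

(** * Positivity of the Gamma function *)

(** The integrand is positive and below (1 + t) e^(-t), which has the primitive
    - (2 + t) e^(-t); so the integrals over compact intervals are bounded, and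
    their supremum is the improper integral. *)
Lemma GammaR_pos s : 1 <= s <= 2 -> 0 < GammaR s.
Proof.
  intros Hs. unfold GammaR. set (f := fun t => Rpower t (s - 1) * exp (- t)).
  assert (Hpos : forall t, 0 < f t)
    by (intros t; apply Rmult_lt_0_compat; apply exp_pos).
  assert (Hcont : forall t, 0 < t -> continuous f t).
  { intros t Ht. apply (ex_derive_continuous f). unfold f.
    apply @ex_derive_mult.
    - eexists. apply is_derive_Rpower, Ht.
    - auto_derive. exact I. }
  assert (Hex : forall a b, 0 < a -> a <= b -> ex_RInt f a b).
  { intros a b Ha Hab. apply (ex_RInt_continuous (V := R_CompleteNormedModule)).
    intros z. rewrite Rmin_left, Rmax_right by lra. intros Hz. apply Hcont. lra. }
  assert (Hdom : forall t, 0 < t -> f t <= (1 + t) * exp (- t)).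
  { intros t Ht. apply Rmult_le_compat_r; [left; apply exp_pos|].
    destruct (Rle_dec t 1).
    - apply Rle_trans with (Rpower 1 (s - 1)).
      + apply Rle_Rpower_l; lra.
      + unfold Rpower. rewrite ln_1, Rmult_0_r, exp_0. lra.
    - apply Rle_trans with (Rpower t 1).
      + apply Rle_Rpower; lra.
      + rewrite Rpower_1; lra. }
  assert (Hbd : forall a b, 0 < a -> a <= b -> RInt f a b <= 2).
  { intros a b Ha Hab.
    assert (HI : is_RInt (fun t => (1 + t) * exp (- t)) a b
                  (minus (- ((2 + b) * exp (- b))) (- ((2 + a) * exp (- a))))).
    { apply (is_RInt_derive (V := R_CompleteNormedModule) (fun t => - ((2 + t) * exp (- t)))).
      - intros x _. auto_derive; [exact I|ring].
      - intros x _. apply (ex_derive_continuous (fun t => (1 + t) * exp (- t))).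
        auto_derive. exact I. }
    apply Rle_trans with (RInt (fun t => (1 + t) * exp (- t)) a b).
    - apply RInt_le; auto; [eexists; exact HI|]. intros x Hx. apply Hdom. lra.
    - rewrite (is_RInt_unique _ _ _ _ HI). unfold minus, plus, opp; simpl.
      assert (0 < (2 + b) * exp (- b)) by (apply Rmult_lt_0_compat; [lra|apply exp_pos]).
      assert ((2 + a) * exp (- a) <= 2); [|lra].
      rewrite exp_Ropp. apply Rle_div_l; [apply exp_pos|].
      pose proof (exp_ineq1_le a). nra. }
  assert (Hmono : forall a a' b b', 0 < a' -> a' <= a -> a <= b -> b <= b' ->
    RInt f a b <= RInt f a' b').
  { intros a a' b b' Ha' Ha Hab Hb.
    rewrite <- (RInt_Chasles f a' a b') by (apply Hex; lra).
    rewrite <- (RInt_Chasles f a b b') by (apply Hex; lra).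
    unfold plus; simpl.
    assert (0 <= RInt f a' a)
      by (apply RInt_ge_0; [lra|apply Hex; lra|intros; left; apply Hpos]).
    assert (0 <= RInt f b b')
      by (apply RInt_ge_0; [lra|apply Hex; lra|intros; left; apply Hpos]).
    lra. }
  destruct (completeness (fun y => exists a b, 0 < a /\ a <= b /\ y = RInt f a b))
    as [L [Hub Hlub]].
  { exists 2. intros y (a & b & Ha & Hab & ->). auto. }
  { exists (RInt f 1 1), 1, 1. repeat split; lra. }
  assert (HL : 0 < L).
  { apply Rlt_le_trans with (RInt f 1 2).
    - apply RInt_gt_0; [lra|intros; apply Hpos|intros; apply Hcont; lra].
    - apply Hub. exists 1, 2. repeat split; lra. }
  rewrite (is_RInt_gen_unique (V := R_CompleteNormedModule) f L); [exact HL|].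
  intros P [eps HP].
  assert (Hnear : exists a0 b0, 0 < a0 /\ a0 <= b0 /\ L - eps < RInt f a0 b0).
  { apply NNPP. intros Hno. pose proof (cond_pos eps).
    enough (L <= L - eps) by lra. apply Hlub.
    intros y (a & b & Ha & Hab & ->). apply Rnot_lt_le. intros Hlt.
    apply Hno. exists a, b. auto. }
  destruct Hnear as (a0 & b0 & Ha0 & Hab0 & Hlt).
  exists (fun a => 0 < a < a0) (fun b => b0 < b).
  - exists (mkposreal a0 Ha0). intros a Ha Ha'.
    change (Rabs (a - 0) < a0) in Ha. apply Rabs_def2 in Ha. lra.
  - exists b0. auto.
  - intros a b Ha Hb. simpl. exists (RInt f a b). split.
    + apply (RInt_correct (V := R_CompleteNormedModule)). apply Hex; lra.
    + apply HP. change (Rabs (RInt f a b - L) < eps).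
      assert (RInt f a0 b0 <= RInt f a b) by (apply Hmono; lra).
      assert (RInt f a b <= L) by (apply Hub; exists a, b; repeat split; lra).
      pose proof (cond_pos eps). apply Rabs_lt_between. lra.
Qed.

(** * The truncation residual up to the boundary *)

Lemma is_caputo_unique mu T f t d d' : 0 < t -> (mu < 1 \/ t < T) ->
  is_caputo mu T f t d -> is_caputo mu T f t d' -> d = d'.
Proof.
  intros Ht Hor [(H1 & _ & I & HI & ->)|[H1 HD]] [(H1' & _ & I' & HI' & ->)|[H1' HD']];
    try lra.
  - f_equal. apply (is_RInt_gen_unique (V := R_CompleteNormedModule)) in HI, HI'.
    congruence.
  - assert (HtT : 0 < t < T) by lra.
    apply (is_derive_of_seg 0 T f t d HtT) in HD.
    apply (is_derive_of_seg 0 T f t d' HtT) in HD'.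
    apply is_derive_unique in HD, HD'. congruence.
Qed.

Lemma tension_spline_Derive rho a h N U U1 U2 :
  tension_spline rho a h N U U1 U2 ->
  tension_spline rho a h N U (Derive U) (Derive_n U 2).
Proof.
  intros (H1 & H2 & H3).
  assert (E1 : forall x, Derive U x = U1 x) by (intros; apply is_derive_unique, H1).
  assert (E2 : forall x, Derive_n U 2 x = U2 x).
  { intros x. simpl. rewrite (Derive_ext _ U1); [apply is_derive_unique, H2|exact E1]. }
  split; [|split].
  - intros x. rewrite E1. apply H1.
  - intros x. rewrite E2. apply (is_derive_ext U1); [intros; symmetry; apply E1|apply H2].
  - intros i Hi. destruct (H3 i Hi) as (A & B & C & D & H).
    exists A, B, C, D. intros x Hx. rewrite E1, E2. auto.
Qed.

(** Composing the partial derivatives with the projection onto the rectangle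
    makes them continuous everywhere and bounded. *)
Lemma class_C0_extension k a b T f : a < b -> 0 < T -> class_C0 k a b T f ->
  exists (D : nat -> R -> R -> R) (K : R),
    (forall x t, rect a b T (x, t) -> D 0%nat x t = f x t) /\
    (forall i t, (i < k)%nat -> seg_deriv a b (fun x => D i x t) (fun x => D (S i) x t)) /\
    (forall i x t, (i <= k)%nat ->
       continuous (fun p : R * R => D i (fst p) (snd p)) (x, t)) /\
    (forall i x t, (i <= k)%nat -> Rabs (D i x t) <= K).
Proof.
  intros Hab HT (D & H0 & H1 & H2).
  set (D' i x t := D i (clamp a b x) (clamp 0 T t)).
  assert (Hrect : forall x t, rect a b T (clamp a b x, clamp 0 T t))
    by (intros; split; apply clamp_in; lra).
  assert (HK : exists K, forall i p, (i <= k)%nat -> rect a b T p ->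
                 Rabs (D i (fst p) (snd p)) <= K).
  { assert (HB : forall i, (i <= k)%nat -> exists K, forall p, rect a b T p ->
                 Rabs (D i (fst p) (snd p)) <= K).
    { intros i Hi. apply (bounded_on_rect a b T (fun p => D i (fst p) (snd p)));
        [lra|lra|apply H2, Hi]. }
    clear - HB. induction k as [|k IH].
    - destruct (HB 0%nat ltac:(lia)) as [K HK]. exists K. intros i p Hi.
      replace i with 0%nat by lia. apply HK.
    - destruct IH as [K HK]; [intros i Hi; apply HB; lia|].
      destruct (HB (S k) ltac:(lia)) as [K' HK']. exists (Rmax K K').
      intros i p Hi Hp. destruct (Nat.eq_dec i (S k)) as [->|Hne].
      + eapply Rle_trans; [apply HK', Hp|apply Rmax_r].
      + eapply Rle_trans; [apply HK; [lia|exact Hp]|apply Rmax_l]. }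
  destruct HK as [K HK]. exists D', K.
  assert (HC : forall i x t, (i <= k)%nat ->
       continuous (fun p : R * R => D' i (fst p) (snd p)) (x, t)).
  { intros i x t Hi.
    apply (continuous_on_rect_clamp a b T (fun p => D i (fst p) (snd p)));
      [lra|lra|apply H2, Hi]. }
  split; [|split; [|split]]; [| |exact HC|].
  - intros x t Hxt. unfold D'. rewrite <- (H0 x t Hxt). destruct Hxt as [Hx Ht].
    simpl in Hx, Ht. rewrite !clamp_id; auto.
  - intros i t Hi. split.
    + intros x. apply (continuous_comp_2 (fun x => x) (fun _ => t) (D' i)).
      * apply continuous_id.
      * apply continuous_const.
      * apply HC. lia.
    + intros x Hx. apply (is_derive_ext_loc (fun y => D i y (clamp 0 T t))).
      * exists (mkposreal (Rmin (x - a) (b - x)) ltac:(apply Rmin_glb_lt; lra)).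
        intros y Hy. change (Rabs (y - x) < Rmin (x - a) (b - x)) in Hy.
        pose proof (Rmin_l (x - a) (b - x)). pose proof (Rmin_r (x - a) (b - x)).
        apply Rabs_def2 in Hy. unfold D'. rewrite (clamp_id a b y); [reflexivity|lra].
      * unfold D'. rewrite (clamp_id a b x) by lra.
        apply (is_derive_of_seg a b); [exact Hx|].
        apply (H1 i x (clamp 0 T t) Hi). split; simpl; [lra|apply clamp_in; lra].
  - intros i x t Hi. apply (HK i (clamp a b x, clamp 0 T t) Hi). apply Hrect.
Qed.

Lemma continuous_slice_x (F : R -> R -> R) x t :
  continuous (fun p : R * R => F (fst p) (snd p)) (x, t) -> continuous (fun x => F x t) x.
Proof.
  intros H. apply (continuous_comp_2 (fun x => x) (fun _ => t) F); auto.
  - apply continuous_id.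
  - apply continuous_const.
Qed.

Lemma continuous_slice_t (F : R -> R -> R) x t :
  continuous (fun p : R * R => F (fst p) (snd p)) (x, t) -> continuous (fun t => F x t) t.
Proof.
  intros H. apply (continuous_comp_2 (fun _ => x) (fun t => t) F); auto.
  - apply continuous_const.
  - apply continuous_id.
Qed.

Lemma continuous_Rmult_const c (f : R -> R) x : continuous f x -> continuous (fun x => c * f x) x.
Proof.
  intros H. apply (continuous_scal_r (K := R_AbsRing) (V := R_NormedModule) c f), H.
Qed.

Lemma left_continuous_of_continuous (f g : R -> R) T : 0 < T ->
  continuous f T -> (forall s, 0 <= s <= T -> f s = g s) -> left_continuous g T.
Proof.
  intros HT Hf E eta Heta.
  destruct (proj1 (filterlim_locally _ _) Hf (mkposreal eta Heta)) as [d Hd].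
  exists (Rmin d T). pose proof (Rmin_l d T). pose proof (Rmin_r d T).
  split; [apply Rmin_glb_lt; [apply cond_pos|lra]|].
  intros s Hs. rewrite <- !E by lra. left. apply Hd.
  change (Rabs (s - T) < d). rewrite Rabs_left; lra.
Qed.

Lemma bound_on_closure a b (f : R -> R) K : a < b ->
  (forall x, continuous f x) -> (forall x, a < x < b -> Rabs (f x) <= K) ->
  forall x, a <= x <= b -> Rabs (f x) <= K.
Proof.
  intros Hab Hf HK x Hx. apply le_epsilon. intros eps Heps.
  destruct (proj1 (filterlim_locally _ _) (Hf x) (mkposreal eps Heps)) as [d Hd].
  pose proof (cond_pos d).
  set (s := Rmin (d / 2) (b - a) / 4).
  assert (P : 0 < Rmin (d / 2) (b - a)) by (apply Rmin_glb_lt; lra).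
  pose proof (Rmin_l (d / 2) (b - a)). pose proof (Rmin_r (d / 2) (b - a)).
  assert (Hy : exists y, a < y < b /\ Rabs (y - x) < d).
  { destruct (Rle_dec x ((a + b) / 2)).
    - exists (x + s). unfold s. split; [lra|]. rewrite Rabs_pos_eq; lra.
    - exists (x - s). unfold s. split; [lra|]. rewrite Rabs_left; lra. }
  destruct Hy as [y [Hy1 Hy2]]. specialize (Hd y Hy2).
  change (Rabs (f y - f x) < eps) in Hd. specialize (HK y Hy1).
  replace (f x) with (f y + - (f y - f x)) by ring.
  eapply Rle_trans; [apply Rabs_triang|]. rewrite Rabs_Ropp. lra.
Qed.

Lemma node_t_bounds T Nt n : 0 < T -> (n <= Nt)%nat -> (0 < Nt)%nat ->
  0 <= node_t T Nt n <= T.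
Proof.
  intros HT Hn HNt. pose proof (node_t_final T Nt HNt) as E. unfold node_t, step_t in *.
  pose proof (lt_0_INR Nt HNt). pose proof (pos_INR n). apply le_INR in Hn.
  assert (0 < T / INR Nt) by (apply Rdiv_lt_0_compat; lra).
  set (q := T / INR Nt) in *.
  split; [apply Rmult_le_pos; lra|]. rewrite <- E. apply Rmult_le_compat_r; lra.
Qed.

Lemma node_t_S_bounds T Nt n : 0 < T -> (n + 1 < Nt)%nat ->
  0 < node_t T Nt (n + 1) < T.
Proof.
  intros HT Hn. pose proof (node_t_final T Nt ltac:(lia)) as E. unfold node_t, step_t in *.
  pose proof (lt_0_INR Nt ltac:(lia)). pose proof (lt_0_INR (n + 1) ltac:(lia)).
  apply lt_INR in Hn.
  assert (0 < T / INR Nt) by (apply Rdiv_lt_0_compat; lra).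
  set (q := T / INR Nt) in *.
  split; [apply Rmult_lt_0_compat; lra|]. rewrite <- E. apply Rmult_lt_compat_r; lra.
Qed.

(** Inside the rectangle this is uniqueness of the Caputo derivative.  The final
    time is settled by [caputo_final_fractional] or [caputo_final_classical], and
    the end points of the interval by continuity in x of the residual. *)
Lemma l1_residual_bound mu sigma rf Ip Fp T u psi z HH GG k1
    (D : nat -> R -> R -> R) (P : R -> R -> R) K :
  0 < mu <= 1 -> Ip < Fp -> 0 < T ->
  is_bs_solution mu sigma rf Ip Fp T psi z HH GG u ->
  (forall (Nt n : nat) (x : R), (n < Nt)%nat -> Ip <= x <= Fp ->
     exists r, is_l1_error mu T Nt (u x) n r /\
               Rabs r <= k1 * Rpower (step_t T Nt) (2 - mu)) ->
  (forall x t, rect Ip Fp T (x, t) -> D 0%nat x t = u x t) ->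
  (forall i t, (i < 2)%nat -> seg_deriv Ip Fp (fun x => D i x t) (fun x => D (S i) x t)) ->
  (forall i x t, (i <= 2)%nat ->
       continuous (fun p : R * R => D i (fst p) (snd p)) (x, t)) ->
  (forall x t, Rabs (D 0%nat x t) <= K) ->
  (forall x t, rect Ip Fp T (x, t) -> P x t = psi x t) ->
  (forall x t, continuous (fun p : R * R => P (fst p) (snd p)) (x, t)) ->
  let rhs x t := bs_alpha sigma * D 2%nat x t + bs_beta sigma rf * D 1%nat x t
                 - bs_gamma rf * D 0%nat x t + P x t in
  forall Nt n x, (n < Nt)%nat -> Ip <= x <= Fp ->
  Rabs (rhs x (node_t T Nt (n + 1))
        - Rpower (step_t T Nt) (- mu) / GammaR (2 - mu)
          * l1_sum mu (fun k => u x (node_t T Nt k)) n)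
  <= k1 * Rpower (step_t T Nt) (2 - mu).
Proof.
  intros Hmu HIF HT [Hpde _] Htr HD0 HD1 HDc HDK HP0 HPc rhs.
  assert (Hk1 : 0 <= k1).
  { destruct (Htr 1%nat 0%nat Ip ltac:(lia) ltac:(lra)) as [r [_ Hr]].
    pose proof (Rabs_pos r). pose proof (Rpower_pos (step_t T 1) (2 - mu)). nra. }
  (* The partial derivatives in the equation are those of the extension, as a
     neighbourhood of x lies inside the interval. *)
  assert (Hcap : forall x t, Ip < x < Fp -> 0 < t < T -> is_caputo mu T (u x) t (rhs x t)).
  { intros x t Hx Ht. pose proof (Hpde x t Hx Ht) as Q.
    assert (L0 : forall y, Ip < y < Fp -> D 0%nat y t = u y t)
      by (intros y Hy; apply HD0; split; simpl; lra).
    assert (Hloc : forall y, Ip < y < Fp -> locally y (fun w => Ip < w < Fp)).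
    { intros y Hy. apply (open_and _ _ (open_gt Ip) (open_lt Fp)); lra. }
    assert (L1 : forall y, Ip < y < Fp -> Derive (fun w => u w t) y = D 1%nat y t).
    { intros y Hy. apply is_derive_unique.
      apply (is_derive_ext_loc (fun w => D 0%nat w t)).
      - apply (filter_imp (fun w => Ip < w < Fp)); [exact L0|apply Hloc, Hy].
      - apply (HD1 0%nat t ltac:(lia)), Hy. }
    assert (L2 : Derive_n (fun w => u w t) 2 x = D 2%nat x t).
    { simpl. apply is_derive_unique.
      apply (is_derive_ext_loc (fun w => D 1%nat w t)).
      - apply (filter_imp (fun w => Ip < w < Fp)); [|apply Hloc, Hx].
        intros w Hw. symmetry. apply L1, Hw.
      - apply (HD1 1%nat t ltac:(lia)), Hx. }
    rewrite L2, (L1 x Hx), <- (HP0 x t), <- (L0 x Hx) in Q by (split; simpl; lra).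
    exact Q. }
  assert (Hrc : forall x t, continuous (fun s => rhs x s) t).
  { intros x t. unfold rhs.
    apply @continuous_plus; [apply @continuous_minus; [apply @continuous_plus|]|].
    - apply continuous_Rmult_const, (continuous_slice_t (D 2%nat)), HDc. lia.
    - apply continuous_Rmult_const, (continuous_slice_t (D 1%nat)), HDc. lia.
    - apply continuous_Rmult_const, (continuous_slice_t (D 0%nat)), HDc. lia.
    - apply (continuous_slice_t P), HPc. }
  assert (Hint : forall Nt n x, (n + 1 < Nt)%nat -> Ip < x < Fp ->
    Rabs (rhs x (node_t T Nt (n + 1))
        - Rpower (step_t T Nt) (- mu) / GammaR (2 - mu)
          * l1_sum mu (fun k => u x (node_t T Nt k)) n)
    <= k1 * Rpower (step_t T Nt) (2 - mu)).
  { intros Nt n x Hn Hx.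
    destruct (Htr Nt n x ltac:(lia) ltac:(lra)) as [r [[d [Hd ->]] Hr]].
    pose proof (node_t_S_bounds T Nt n HT Hn) as Ht.
    rewrite (is_caputo_unique mu T (u x) (node_t T Nt (n + 1)) (rhs x (node_t T Nt (n + 1))) d); auto; lra. }
  assert (Hfin : forall x d, Ip < x < Fp -> is_caputo mu T (u x) T d -> d = rhs x T).
  { intros x d Hx Hd.
    assert (Hgc : left_continuous (fun s => rhs x s) T)
      by (apply (left_continuous_of_continuous (fun s => rhs x s)); auto).
    pose proof Hd as Hd0.
    destruct Hd as [(Hlt & Hf & I & HI & _)|[-> HDs]].
    - apply (caputo_final_fractional mu T (u x) (fun s => rhs x s) d k1 K I);
        auto; try lra.
      + apply GammaR_pos. lra.
      + apply (left_continuous_of_continuous (fun s => D 0%nat x s)); auto.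
        * apply (continuous_slice_t (D 0%nat)), HDc. lia.
        * intros s Hs. apply HD0. split; simpl; lra.
      + intros s Hs. rewrite <- HD0 by (split; simpl; lra). apply HDK.
      + intros n. destruct (Htr (S n) n x ltac:(lia) ltac:(lra)) as [r [[d' [Hd' ->]] Hr]].
        replace (n + 1)%nat with (S n) in Hd' by lia.
        rewrite node_t_final in Hd' by lia.
        rewrite (is_caputo_unique mu T (u x) T d d'); auto.
    - apply (caputo_final_classical T (u x) (fun s => rhs x s) d HT); auto.
      intros s Hs. destruct (Hcap x s Hx Hs) as [[Q _]|[_ Q]]; [lra|exact Q]. }
  intros Nt n x Hn Hx.
  set (b := Rpower (step_t T Nt) (- mu) / GammaR (2 - mu)).
  set (t1 := node_t T Nt (n + 1)).
  pose proof (node_t_bounds T Nt (n + 1) HT ltac:(lia) ltac:(lia)) as Ht1. fold t1 in Ht1.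
  assert (Hl1 : forall x, Ip <= x <= Fp -> l1_sum mu (fun k => u x (node_t T Nt k)) n
     = l1_sum mu (fun k => D 0%nat x (node_t T Nt k)) n).
  { intros y Hy. apply l1_sum_ext. intros k Hk. symmetry. apply HD0.
    split; simpl; [lra|]. apply node_t_bounds; [lra|lia|lia]. }
  rewrite Hl1 by exact Hx.
  apply (bound_on_closure Ip Fp
    (fun x => rhs x t1 - b * l1_sum mu (fun k => D 0%nat x (node_t T Nt k)) n)); auto.
  - intros y. apply @continuous_minus.
    + unfold rhs.
      apply @continuous_plus; [apply @continuous_minus; [apply @continuous_plus|]|].
      * apply continuous_Rmult_const, (continuous_slice_x (D 2%nat)), HDc. lia.
      * apply continuous_Rmult_const, (continuous_slice_x (D 1%nat)), HDc. lia.
      * apply continuous_Rmult_const, (continuous_slice_x (D 0%nat)), HDc. lia.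
      * apply (continuous_slice_x P), HPc.
    + apply continuous_Rmult_const. unfold l1_sum.
      assert (Hterm : forall k y, continuous (fun x => l1_weight mu k
        * (D 0%nat x (node_t T Nt (n - k + 1)) - D 0%nat x (node_t T Nt (n - k)))) y).
      { intros k w. apply continuous_Rmult_const. apply @continuous_minus;
          apply (continuous_slice_x (D 0%nat)), HDc; lia. }
      generalize n at 3. intros m. induction m as [|m IH].
      * apply Hterm.
      * cbn [sum_f_R0]. apply @continuous_plus; [exact IH|apply (Hterm (S m))].
  - intros y Hy. rewrite <- Hl1 by lra. unfold b, t1.
    destruct (Nat.eq_dec (n + 1) Nt) as [E|E].
    + destruct (Htr Nt n y ltac:(lia) ltac:(lra)) as [r [[d [Hd ->]] Hr]].
      rewrite E in *. rewrite node_t_final in * by lia.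
      rewrite (Hfin y d Hy Hd) in Hr. exact Hr.
    + apply Hint; [lia|exact Hy].
Qed.

(** * Convergence of the collocation scheme *)

Lemma avg_bound l v i m : 0 <= l <= 1 / 6 ->
  Rabs (v i) <= m -> Rabs (v (S i)) <= m -> Rabs (v (S (S i))) <= m ->
  Rabs (avg l v i) <= m.
Proof.
  intros Hl H0 H1 H2. unfold avg.
  apply Rabs_le_between in H0, H1, H2. apply Rabs_le_between. nra.
Qed.

Theorem theorem5p4 :
  forall mu sigma rf rho Ip Fp T : R,
  0 < mu <= 1 -> 0 < sigma -> 0 < rf -> 0 < rho -> Ip < Fp -> 0 < T ->
  exists h0 : R, 0 < h0 /\
  forall (u psi : R -> R -> R) (z H G : R -> R) (k1 : R),
  is_bs_solution mu sigma rf Ip Fp T psi z H G u ->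
  class_C0 4 Ip Fp T u ->
  class_C0 2 Ip Fp T psi ->
  (forall (Nt n : nat) (x : R), (n < Nt)%nat -> Ip <= x <= Fp ->
     exists r, is_l1_error mu T Nt (u x) n r /\
               Rabs r <= k1 * Rpower (step_t T Nt) (2 - mu)) ->
  exists k2 k3 : R, 0 < k2 /\ 0 < k3 /\
  forall (Nx Nt : nat) (coef : nat -> Z -> R),
  (0 < Nx)%nat -> (0 < Nt)%nat ->
  step_x Ip Fp Nx <= h0 ->
  is_collocation_solution mu sigma rf rho Ip Fp T psi z H G Nx Nt coef ->
  forall n : nat, (n < Nt)%nat ->
  Rbar_le
    (sup_norm Ip Fp
       (fun x => u x (node_t T Nt (n + 1))
                 - spline rho Ip Fp Nx (coef (n + 1)%nat) x))
    (k2 * Rpower (step_t T Nt) (2 - mu) + k3 * step_x Ip Fp Nx ^ 2).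
Proof.
  intros mu sigma rf rho Ip Fp T Hmu Hsig Hrf Hrho HIF HT.
  set (al := bs_alpha sigma). set (be := bs_beta sigma rf). set (ga := bs_gamma rf).
  assert (Hal : 0 < al) by (unfold al, bs_alpha; nra).
  assert (Hga : 0 < ga) by exact Hrf.
  pose proof (Rabs_pos be) as Hbe.
  exists (al / (Rabs be + 1)). split; [apply Rdiv_lt_0_compat; lra|].
  intros u psi z H G k1 Hsol Hu Hpsi Htr.
  destruct (class_C0_extension 4 Ip Fp T u HIF HT Hu) as (D & K & HD0 & HD1 & HDc & HDK).
  destruct (class_C0_extension 2 Ip Fp T psi HIF HT Hpsi) as (P' & KP & HP0 & _ & HPc & _).
  set (P := P' 0%nat) in *.
  pose proof (l1_residual_bound mu sigma rf Ip Fp T u psi z H G k1 D P K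
    Hmu HIF HT Hsol Htr HD0 (fun i t Hi => HD1 i t ltac:(lia))
    (fun i x t Hi => HDc i x t ltac:(lia)) (fun x t => HDK 0%nat x t ltac:(lia)) HP0
    (fun x t => HPc 0%nat x t ltac:(lia))) as Hres.
  cbv zeta in Hres. fold al be ga in Hres.
  assert (Hk1 : 0 <= k1).
  { destruct (Htr 1%nat 0%nat Ip ltac:(lia) ltac:(lra)) as [r [_ Hr]].
    pose proof (Rabs_pos r). pose proof (Rpower_pos (step_t T 1) (2 - mu)). nra. }
  assert (HK : 0 <= K)
    by (eapply Rle_trans; [apply Rabs_pos|apply (HDK 0%nat 0 0); lia]).
  set (L := Fp - Ip). assert (HL : 0 < L) by (unfold L; lra).
  set (R2 := 1 + (rho * L) ^ 2).
  assert (HR2 : 1 <= R2) by (unfold R2; pose proof (pow2_ge_0 (rho * L)); lra).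
  (* tauc bounds the spatial residual divided by h^2; A is the stability constant
     of the nodal scheme; ce and ch are the factors of the nodal error and of h^2
     in the bound of the error between the nodes. *)
  set (tauc := al * (K * rho ^ 2 + (K + 2 * R2 * K)) + Rabs be * (2 * K)).
  assert (Htauc : 0 <= tauc).
  { unfold tauc. pose proof (pow2_ge_0 rho).
    assert (0 <= K * rho ^ 2) by nra. assert (0 <= 2 * R2 * K) by nra. nra. }
  set (A := sqrt (6 * energy_C al be ga / ga) * L).
  assert (HA : 0 <= A) by (apply Rmult_le_pos; [apply sqrt_pos|lra]).
  set (ce := 1 + 24 * R2 + 8 / al * Rabs be * L).
  assert (Hce : 0 <= ce).
  { unfold ce. assert (0 <= 8 / al) by (apply Rdiv_le_0_compat; lra).
    assert (0 <= 8 / al * Rabs be * L) by (repeat apply Rmult_le_pos; lra). lra. }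
  set (ch := K + 12 * R2 * K + 4 / al * ((al + Rabs be) * K + Rabs be * K)).
  assert (H4 : 0 <= 4 / al) by (apply Rdiv_le_0_compat; lra).
  assert (Hch : 0 <= ch).
  { unfold ch. assert (0 <= 12 * R2 * K) by nra.
    assert (0 <= (al + Rabs be) * K + Rabs be * K) by nra. nra. }
  exists ((ce * A + 4 / al * L ^ 2) * k1 + 1), (ce * A * tauc + ch + 1).
  assert (HceA : 0 <= ce * A) by (apply Rmult_le_pos; lra).
  split. { pose proof (pow2_ge_0 L). assert (0 <= 4 / al * L ^ 2) by nra. nra. }
  split. { nra. }
  intros Nx Nt coef HNx HNt Hh0 Hcoll n Hn.
  destruct Nx as [|m]; [lia|].
  set (h := step_x Ip Fp (S m)) in *.
  assert (HN0 : 0 < INR (S m)) by (apply lt_0_INR; lia).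
  assert (Hh : 0 < h) by (apply Rdiv_lt_0_compat; lra).
  assert (ELh : INR (S m) * h = L) by (unfold h, step_x, L; field; lra).
  assert (HhL : h <= L).
  { rewrite <- ELh, S_INR. pose proof (pos_INR m). nra. }
  assert (Hbh : Rabs be * h <= al).
  { apply Rle_div_r in Hh0; [|lra]. nra. }
  assert (Hrh : 1 + (rho * h) ^ 2 <= R2).
  { unfold R2. apply Rplus_le_compat_l. apply pow_incr. split; nra. }
  assert (Hy : 0 < rho * h) by nra.
  set (U k := spline rho Ip Fp (S m) (coef k)).
  assert (HU : forall k, tension_spline rho Ip h (S m) (U k) (Derive (U k)) (Derive_n (U k) 2)).
  { intros k. destruct (tension_spline_spline rho Ip Fp (S m) (S m) (coef k) Hrho Hh)
      as (U1 & U2 & Q). exact (tension_spline_Derive _ _ _ _ _ _ _ Q). }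
  set (X j := Ip + INR j * h).
  set (tau := node_t T Nt).
  assert (EX : forall j, node_x Ip Fp (S m) (Z.of_nat j) = X j)
    by (intros j; unfold node_x, X; rewrite INR_IZR_INZ; reflexivity).
  assert (HX0 : X 0%nat = Ip) by (unfold X; simpl; ring).
  assert (HXN : X (S m) = Fp) by (unfold X; rewrite ELh; unfold L; ring).
  assert (HXin : forall j, (j <= S m)%nat -> Ip <= X j <= Fp).
  { intros j Hj. rewrite <- HXN. unfold X. pose proof (pos_INR j).
    apply le_INR in Hj. nra. }
  assert (HXS : forall j, X (S j) = X j + h) by (intros j; unfold X; rewrite S_INR; ring).
  assert (Htau : forall k, (k <= Nt)%nat -> 0 <= tau k <= T)
    by (intros k Hk; apply node_t_bounds; auto).
  assert (Hrect : forall j k, (j <= S m)%nat -> (k <= Nt)%nat -> rect Ip Fp T (X j, tau k))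
    by (intros j k Hj Hk; split; simpl; [apply HXin|apply Htau]; assumption).
  set (ht := step_t T Nt) in *.
  set (g := GammaR (2 - mu) * Rpower ht mu).
  pose proof (GammaR_pos (2 - mu) ltac:(lra)) as HGam.
  assert (Hg : 0 < g) by (apply Rmult_lt_0_compat; [exact HGam|apply Rpower_pos]).
  assert (Eb : Rpower ht (- mu) / GammaR (2 - mu) = / g).
  { unfold g. rewrite Rpower_Ropp. field.
    split; [apply Rgt_not_eq, Rpower_pos|lra]. }
  set (rt := k1 * Rpower ht (2 - mu)) in *.
  assert (Hrt : 0 <= rt) by (apply Rmult_le_pos; [lra|left; apply Rpower_pos]).
  destruct Hcoll as (Hini & _ & _ & Hcol & Hbdy).
  fold U in Hini, Hcol, Hbdy. fold tau ht al be ga g in Hcol. fold tau in Hbdy.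
  set (rhs x t := al * D 2%nat x t + be * D 1%nat x t - ga * D 0%nat x t + P x t) in Hres.
  set (Rn k j := rhs (X j) (tau (k + 1)%nat)
                 - / g * l1_sum mu (fun q => u (X j) (tau q)) k).
  assert (HRn : forall k j, (k < Nt)%nat -> (j <= S m)%nat -> Rabs (Rn k j) <= rt).
  { intros k j Hk Hj. pose proof (Hres Nt k (X j) Hk (HXin j Hj)) as Q.
    fold ht rt in Q. rewrite Eb in Q. exact Q. }
  assert (Hl1u : forall k j, l1_sum mu (fun q => u (X j) (tau q)) k
                 = g * (rhs (X j) (tau (k + 1)%nat) - Rn k j))
    by (intros k j; unfold Rn; field; lra).
  assert (Hl1U : forall k j, (k < Nt)%nat -> (j <= S m)%nat ->
    l1_sum mu (fun q => U q (X j)) k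
    = g * (al * Derive_n (U (k + 1)%nat) 2 (X j) + be * Derive (U (k + 1)%nat) (X j)
           - ga * U (k + 1)%nat (X j) + P (X j) (tau (k + 1)%nat))).
  { intros k j Hk Hj. pose proof (Hcol k j Hk Hj) as Q. cbv beta in Q.
    rewrite !EX in Q. rewrite HP0 by (apply Hrect; lia). exact Q. }
  set (e k j := u (X j) (tau k) - U k (X j)).
  assert (He0 : forall j, (j <= S m)%nat -> e 0%nat j = 0).
  { intros j Hj. unfold e. pose proof (Hini j Hj) as Q. cbv beta in Q.
    rewrite EX in Q.
    change (U 0%nat (X j) = z (X j)) in Q. rewrite Q. destruct Hsol as (_ & Hz & _).
    rewrite <- Hz by (apply HXin, Hj).
    replace (tau 0%nat) with 0 by (unfold tau, node_t; simpl; ring). ring. }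
  assert (Hebd : forall k, (k <= Nt)%nat -> e k 0%nat = 0 /\ e k (S m) = 0).
  { intros k Hk. destruct k as [|k].
    - split; apply He0; lia.
    - destruct (Hbdy k ltac:(lia)) as [Q1 Q2].
      replace (k + 1)%nat with (S k) in Q1, Q2 by lia.
      destruct Hsol as (_ & _ & Hb).
      destruct (Hb (tau (S k))) as [Q3 Q4].
      { split; [|apply Htau, Hk].
        apply Rmult_lt_0_compat; [apply lt_0_INR; lia|].
        apply Rdiv_lt_0_compat; [exact HT|apply lt_0_INR; lia]. }
      change (U (S k) Ip = H (tau (S k))) in Q1. change (U (S k) Fp = G (tau (S k))) in Q2.
      unfold e. rewrite HX0, HXN, Q1, Q2, Q3, Q4. lra. }
  set (l := lam (rho * h)). set (t := theta (rho * h)).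
  pose proof (lam_bounds _ Hy) as Hl. pose proof (theta_bounds _ Hy) as Ht.
  fold l in Hl. fold t in Ht.
  set (r k i :=
    al * (avg l (fun j => D 2%nat (X j) (tau (k + 1)%nat)) i
          - t * dif2 (fun j => D 0%nat (X j) (tau (k + 1)%nat)) i / h ^ 2)
    + (be * (avg l (fun j => D 1%nat (X j) (tau (k + 1)%nat)) i
          - (D 0%nat (X (S (S i))) (tau (k + 1)%nat) - D 0%nat (X i) (tau (k + 1)%nat)) / (2 * h))
    + - avg l (Rn k) i)).
  assert (Heq : forall k i, (k < Nt)%nat -> (i < m)%nat ->
     avg l (fun j => l1_sum mu (fun q => e q j) k) i
     = g * (al * (t * dif2 (e (k + 1)%nat) i / h ^ 2)
            + be * ((e (k + 1)%nat (S (S i)) - e (k + 1)%nat i) / (2 * h))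
            - ga * avg l (e (k + 1)%nat) i + r k i)).
  { intros k i Hk Hi.
    assert (Hl1e : forall j, (j <= S m)%nat -> l1_sum mu (fun q => e q j) k
      = g * (al * (D 2%nat (X j) (tau (k + 1)%nat) - Derive_n (U (k + 1)%nat) 2 (X j))
             + be * (D 1%nat (X j) (tau (k + 1)%nat) - Derive (U (k + 1)%nat) (X j))
             - ga * (D 0%nat (X j) (tau (k + 1)%nat) - U (k + 1)%nat (X j)) - Rn k j)).
    { intros j Hj.
      rewrite (l1_sum_ext mu _ (fun q => 1 * u (X j) (tau q) + (-1) * U q (X j)))
        by (intros q Hq; unfold e; ring).
      rewrite l1_sum_lin, Hl1u, Hl1U by assumption. unfold rhs. ring. }
    destruct (tension_spline_avg rho Ip h (S m) _ _ _ i Hrho Hh (HU (k + 1)%nat) ltac:(lia))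
      as [E1 E2].
    fold l t in E1, E2.
    change (avg l (fun j => Derive_n (U (k + 1)%nat) 2 (X j)) i
            = t * dif2 (fun j => U (k + 1)%nat (X j)) i / h ^ 2) in E1.
    change (avg l (fun j => Derive (U (k + 1)%nat) (X j)) i
            = (U (k + 1)%nat (X (S (S i))) - U (k + 1)%nat (X i)) / (2 * h)) in E2.
    unfold r. unfold avg, dif2 in *. rewrite !Hl1e by lia.
    unfold e. rewrite <- !(HD0 (X _)) by (apply Hrect; lia).
    match type of E1 with ?a = ?b => match type of E2 with ?c = ?d =>
      match goal with |- ?x = ?y =>
        replace x with (y - g * al * (a - b) - g * be * (c - d)) by (field; lra)
      end; replace (a - b) with 0 by lra; replace (c - d) with 0 by lra end end.
    ring. }
  set (rmax := tauc * h ^ 2 + rt).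
  pose proof (pow2_ge_0 h) as Hh2.
  assert (Hrmax : 0 <= rmax) by (unfold rmax; nra).
  assert (Hr : forall k i, (k < Nt)%nat -> (i < m)%nat -> Rabs (r k i) <= rmax).
  { intros k i Hk Hi. set (s := tau (k + 1)%nat).
    assert (Hx1 : X i = X (S i) - h) by (rewrite HXS; ring).
    assert (Hlo : Ip <= X (S i) - h) by (rewrite <- Hx1; apply HXin; lia).
    assert (Hhi : X (S i) + h <= Fp) by (rewrite <- HXS; apply HXin; lia).
    pose proof (curvature_residual Ip Fp (fun x => D 0%nat x s) (fun x => D 1%nat x s)
      (fun x => D 2%nat x s) (fun x => D 3%nat x s) (fun x => D 4%nat x s) K (X (S i)) h
      (rho * h) (HD1 0%nat s ltac:(lia)) (HD1 1%nat s ltac:(lia)) (HD1 2%nat s ltac:(lia))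
      (HD1 3%nat s ltac:(lia)) (fun w _ => HDK 2%nat w s ltac:(lia))
      (fun w _ => HDK 4%nat w s ltac:(lia)) Hh Hy Hlo Hhi) as C1.
    pose proof (slope_residual Ip Fp (fun x => D 0%nat x s) (fun x => D 1%nat x s)
      (fun x => D 2%nat x s) (fun x => D 3%nat x s) K (X (S i)) h
      (rho * h) (HD1 0%nat s ltac:(lia)) (HD1 1%nat s ltac:(lia)) (HD1 2%nat s ltac:(lia))
      (fun w _ => HDK 3%nat w s ltac:(lia)) Hh Hy Hlo Hhi) as C2.
    pose proof (avg_bound l (Rn k) i rt Hl (HRn k i Hk ltac:(lia))
      (HRn k (S i) Hk ltac:(lia)) (HRn k (S (S i)) Hk ltac:(lia))) as C3.
    cbv beta in C1, C2. fold l t in C1, C2.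
    rewrite <- Hx1, <- HXS in C1, C2.
    unfold r. fold s.
    eapply Rle_trans; [apply Rabs_triang|].
    eapply Rle_trans; [apply Rplus_le_compat_l, Rabs_triang|].
    rewrite Rabs_Ropp, !Rabs_mult, (Rabs_pos_eq al) by lra.
    match type of C1 with Rabs ?a <= _ =>
      match goal with |- al * Rabs ?b + _ <= _ =>
        replace b with a by (unfold avg, dif2; field; lra) end end.
    match type of C2 with Rabs ?a <= _ =>
      match goal with |- _ + (Rabs be * Rabs ?b + _) <= _ =>
        replace b with a by (unfold avg; field; lra) end end.
    assert (C1' : K * (rho * h) ^ 2 + (K + 2 * (1 + (rho * h) ^ 2) * K) * h ^ 2
                  <= (K * rho ^ 2 + (K + 2 * R2 * K)) * h ^ 2).
    { replace (K * (rho * h) ^ 2) with (K * rho ^ 2 * h ^ 2) by ring.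
      rewrite <- Rmult_plus_distr_r. apply Rmult_le_compat_r; [exact Hh2|]. nra. }
    unfold rmax, tauc.
    pose proof (Rmult_le_compat_l al _ _ ltac:(lra) (Rle_trans _ _ _ C1 C1')).
    pose proof (Rmult_le_compat_l (Rabs be) _ _ Hbe C2). lra. }
  pose proof (scheme_max_bound mu al be ga l t h g m Nt e r rmax Hmu Hal Hga Hl
    ltac:(lra) Hh Hg Hrmax He0 Hebd Heq Hr) as Hmax.
  rewrite ELh in Hmax. fold A in Hmax.
  set (s := tau (n + 1)%nat).
  (* Where the error vanishes at all times, the L1 sums of u and U agree, so the
     collocation equation prescribes alpha U'' + beta U' up to the residual. *)
  assert (Hrow : forall j, (j <= S m)%nat -> (forall k, (k <= Nt)%nat -> e k j = 0) ->
    Rabs (al * Derive_n (U (n + 1)%nat) 2 (X j) + be * Derive (U (n + 1)%nat) (X j))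
    <= (al + Rabs be) * K + rt).
  { intros j Hj Hz.
    assert (Q : l1_sum mu (fun q => U q (X j)) n = l1_sum mu (fun q => u (X j) (tau q)) n).
    { apply l1_sum_ext. intros q Hq. pose proof (Hz q ltac:(lia)) as Q. unfold e in Q. lra. }
    rewrite Hl1u, Hl1U in Q by assumption. apply Rmult_eq_reg_l in Q; [|lra].
    pose proof (Hz (n + 1)%nat ltac:(lia)) as Q'. unfold e in Q'.
    rewrite <- HD0 in Q' by (apply Hrect; lia).
    unfold rhs in Q. fold s in Q, Q'.
    replace (U (n + 1)%nat (X j)) with (D 0%nat (X j) s) in Q by lra.
    replace (al * Derive_n (U (n + 1)%nat) 2 (X j) + be * Derive (U (n + 1)%nat) (X j))
      with (al * D 2%nat (X j) s + (be * D 1%nat (X j) s + - Rn n j)) by lra.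
    eapply Rle_trans; [apply Rabs_triang|].
    eapply Rle_trans; [apply Rplus_le_compat_l, Rabs_triang|].
    rewrite Rabs_Ropp, !Rabs_mult, (Rabs_pos_eq al) by lra.
    pose proof (HRn n j Hn Hj). pose proof (HDK 2%nat (X j) s ltac:(lia)).
    pose proof (HDK 1%nat (X j) s ltac:(lia)).
    pose proof (Rmult_le_compat_l (Rabs be) _ _ Hbe H2).
    pose proof (Rmult_le_compat_l al _ _ ltac:(lra) H1). lra. }
  assert (Hsup : forall x, Ip <= x <= Fp ->
    Rabs (u x s - U (n + 1)%nat x)
    <= ((ce * A + 4 / al * L ^ 2) * k1 + 1) * Rpower ht (2 - mu)
       + (ce * A * tauc + ch + 1) * h ^ 2).
  { intros x Hx.
    rewrite <- (HD0 x s) by (split; simpl; [lra|apply Htau; lia]).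
    pose proof (spline_sup_error al be rho Ip Fp h m (fun x => D 0%nat x s)
      (fun x => D 1%nat x s) (fun x => D 2%nat x s) (U (n + 1)%nat) _ _ K (A * rmax)
      ((al + Rabs be) * K + rt) Hal Hrho Hh Hbh (eq_sym HXN)
      (HD1 0%nat s ltac:(lia)) (HD1 1%nat s ltac:(lia))
      (fun w _ => HDK 1%nat w s ltac:(lia)) (fun w _ => HDK 2%nat w s ltac:(lia))
      (HU (n + 1)%nat)) as Q.
    assert (Q1 : forall i, (i <= S m)%nat ->
      Rabs (D 0%nat (Ip + INR i * h) s - U (n + 1)%nat (Ip + INR i * h)) <= A * rmax).
    { intros i Hi. rewrite HD0 by (apply (Hrect i (n + 1)%nat); lia).
      apply (Hmax (n + 1)%nat i); [lia|exact Hi]. }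
    specialize (Q Q1).
    pose proof (Hrow 0%nat ltac:(lia) (fun k Hk => proj1 (Hebd k Hk))) as B0.
    pose proof (Hrow (S m) ltac:(lia) (fun k Hk => proj2 (Hebd k Hk))) as B1.
    rewrite HX0 in B0. rewrite HXN in B1.
    specialize (Q B0 B1 x Hx). cbv beta in Q.
    eapply Rle_trans; [exact Q|].
    assert (HAr : 0 <= A * rmax) by (apply Rmult_le_pos; assumption).
    assert (S1 : (1 + 24 * (1 + (rho * h) ^ 2) + 8 / al * Rabs be * h) * (A * rmax)
                 <= ce * (A * rmax)).
    { apply Rmult_le_compat_r; [exact HAr|]. unfold ce.
      assert (8 / al * Rabs be * h <= 8 / al * Rabs be * L); [|lra].
      apply Rmult_le_compat_l; [|exact HhL].
      apply Rmult_le_pos; [apply Rdiv_le_0_compat; lra|exact Hbe]. }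
    assert (S2 : (K + 12 * (1 + (rho * h) ^ 2) * K
                  + 4 / al * ((al + Rabs be) * K + rt + Rabs be * K)) * h ^ 2
                 <= ch * h ^ 2 + 4 / al * L ^ 2 * rt).
    { assert (S3 : 12 * (1 + (rho * h) ^ 2) * K <= 12 * R2 * K)
        by (apply Rmult_le_compat_r; lra).
      assert (S4 : (4 / al * rt) * h ^ 2 <= (4 / al * rt) * L ^ 2).
      { apply Rmult_le_compat_l; [apply Rmult_le_pos; lra|]. apply pow_incr; lra. }
      pose proof (Rmult_le_compat_r (h ^ 2) _ _ Hh2 S3) as S5.
      unfold ch. lra. }
    pose proof (Rpower_pos ht (2 - mu)).
    apply Rle_trans with (ce * (A * rmax) + (ch * h ^ 2 + 4 / al * L ^ 2 * rt)); [lra|].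
    unfold rmax, rt. lra. }
  apply (proj2 (Lub_Rbar_correct _)). intros y [x [Hx ->]]. simpl.
  exact (Hsup x Hx).
Qed.
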